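(* Let $\Gamma$ be a countably infinite discrete abelian group. There is a sequence $(a_n)_{n \in \mathbb{N}}$ in $\Gamma$ such that $(a_n)_{n \in \mathbb{N}}$ is a rigidity sequence for a weakly mixing system but not for any ergodic system with discrete spectrum.
   Context: A measure-preserving system (or system) for $\Gamma$ is a quadruple $(X, \mathcal{B}, \mu, (T_g)_{g \in \Gamma})$, where $(X,\mathcal{B},\mu)$ is a non-atomic Lebesgue probability space and $(T_g)_{g\in\Gamma}$ is an action of $\Gamma$ by measure-preserving transformations; write $T_gf = f\circ T_g$. A sequence $(a_n)_{n\in\mathbb{N}}$ in $\Gamma$ is a rigidity sequence for the system if $\|f\circ T_{a_n} - f\|_2 \to 0$ for every $f \in L^2(\mu)$. The system is ergodic if $T_gA = A$ for all $g\in\Gamma$ implies $\mu(A)\in\{0,1\}$. A F{\o}lner sequence in $\Gamma$ is a sequence $(\Phi_N)$ of finite (nonempty) subsets with $|(\Phi_N+x)\triangle\Phi_N|/|\Phi_N| \to 0$ for every $x\in\Gamma$. The system is weakly mixing if $\frac{1}{|\Phi_N|}\sum_{g\in\Phi_N} |\mu(A\cap T_gB)-\mu(A)\mu(B)| \to 0$ for every F{\o}lner sequence $(\Phi_N)$ and all $A,B\in\mathcal{B}$. An eigenfunction is an $f\in L^2(\mu)$ for which there is $\chi:\Gamma\to\mathbb{C}$ with $T_gf=\chi(g)f$ for all $g\in\Gamma$; the system has discrete spectrum if $L^2(\mu)$ is spanned (as a Hilbert space) by eigenfunctions. *)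

(* Defs.v *)
From HB Require Import structures.
From mathcomp Require Import all_boot all_order all_algebra finmap.
From mathcomp Require Import all_classical all_reals all_analysis.
From mathcomp Require Import complex.

Set Implicit Arguments.
Unset Strict Implicit.
Unset Printing Implicit Defensive.

Import Order.TTheory GRing.Theory Num.Theory.
Import numFieldNormedType.Exports.

Local Open Scope classical_set_scope.
Local Open Scope ring_scope.

(* The sigma-algebra of Lebesgue-measurable (not only Borel) subsets of R, i.e.
   the domain of completed_lebesgue_measure. *)
Definition lebesgue_measurable (R : realType) : set (set R) :=
  ((@wlength R idfun)^*)%mu.-cara.-measurable.

(* A non-atomic Lebesgue probability space, in the sense of Rokhlin: a complete
   probability space that is isomorphic mod 0 to [0, 1] with its Lebesgue
   sigma-algebra and Lebesgue measure.  As phi is a bijection from X0 onto I0,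
   the equivalence below says that both phi and its inverse are measurable. *)
Definition nonatomic_lebesgue_space (R : realType) (d : measure_display)
    (X : measurableType d) (mu : probability X R) : Prop :=
  measure_is_complete mu /\
  exists (X0 : set X) (I0 : set R) (phi : X -> R),
    [/\ measurable X0 /\ mu X0 = 1%E,
        [/\ I0 `<=` `[0, 1], lebesgue_measurable I0
          & completed_lebesgue_measure I0 = 1%E],
        set_bij X0 I0 phi
      & forall A : set R, A `<=` I0 ->
          (lebesgue_measurable A <-> measurable (X0 `&` phi @^-1` A)) /\
          (lebesgue_measurable A ->
             mu (X0 `&` phi @^-1` A) = completed_lebesgue_measure A)].

Record system (R : realType) (G : zmodType) := System {
  sys_display : measure_display;
  sys_space : measurableType sys_display;
  sys_mu : probability sys_space R;
  sys_act : G -> sys_space -> sys_space;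
  sys_lebesgue : nonatomic_lebesgue_space sys_mu;
  sys_act0 : forall x, sys_act 0 x = x;
  sys_actD : forall g h x, sys_act (g + h) x = sys_act g (sys_act h x);
  sys_act_measurable : forall g, measurable_fun [set: sys_space] (sys_act g);
  sys_act_preserving : forall g (A : set sys_space), measurable A ->
    sys_mu (sys_act g @^-1` A) = sys_mu A
}.

Arguments sys_act {R G} s _ _ : rename.

Section ComplexL2.
Context (R : realType) (d : measure_display) (X : measurableType d).
Variable mu : probability X R.

Definition L2norm (f : X -> R[i]) : \bar R :=
  Lnorm mu 2%:E (fun x => (Normc.normc (f x))%:E).

(* Elements of L^2(mu; C) are represented by honest functions; identities
   between them are stated almost everywhere. *)
Definition inL2 (f : X -> R[i]) : Prop :=
  [/\ measurable_fun [set: X] (fun x => complex.Re (f x)),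
      measurable_fun [set: X] (fun x => complex.Im (f x))
    & (L2norm f < +oo)%E].

End ComplexL2.

Section Systems.
Context (R : realType) (G : zmodType).

Definition folner (Phi : nat -> {fset G}) : Prop :=
  (forall N, Phi N != fset0) /\
  forall x : G,
    (fun N => let S := Phi N in
       let Sx := [fset (g + x)%R | g in S]%fset in
       #|` ((Sx `\` S) `|` (S `\` Sx))%fset |%:R / #|` S|%:R : R)
    @ \oo --> (0 : R).

Variable S : system R G.
Local Notation X := (sys_space S).
Local Notation mu := (sys_mu S).
Local Notation T := (sys_act S).

Definition rigidity_sequence (a : nat -> G) : Prop :=
  forall f : X -> R[i], inL2 mu f ->
    (fun n => L2norm mu (fun x => f (T (a n) x) - f x)) @ \oo --> (0 : \bar R).

Definition ergodic : Prop :=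
  forall A : set X, measurable A -> (forall g, T g @` A = A) ->
    mu A = 0%E \/ mu A = 1%E.

Definition weakly_mixing : Prop :=
  forall Phi : nat -> {fset G}, folner Phi ->
  forall A B : set X, measurable A -> measurable B ->
    (fun N => (#|` Phi N|%:R)^-1 *
       \sum_(g <- Phi N)
         `|fine (mu (A `&` T g @` B)) - fine (mu A) * fine (mu B)| : R)
    @ \oo --> (0 : R).

Definition eigenfunction (f : X -> R[i]) : Prop :=
  inL2 mu f /\
  exists chi : G -> R[i],
    forall g, {ae mu, forall x, f (T g x) = chi g * f x}.

(* Finite linear combinations of eigenfunctions are dense in L^2. *)
Definition discrete_spectrum : Prop :=
  forall f : X -> R[i], inL2 mu f ->
  forall e : R, 0 < e ->
  exists (n : nat) (c : 'I_n -> R[i]) (h : 'I_n -> X -> R[i]),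
    (forall i, eigenfunction (h i)) /\
    (L2norm mu (fun x => f x - \sum_(i < n) c i * h i x)%R < e%:E)%E.

End Systems.

(* Main.v *)
(* Let Q be a quotient of Gamma that contains generic elements: Gamma itself if
   all multiples n Gamma are infinite, and otherwise some infinite
   Gamma / p Gamma.  Sets D_0, D_1, ... are built in Q with D_(k+1) = D_k + C_k,
   where C_k is almost invariant under a block {2^j b_i : j <= t_k} of elements
   that are generic up to the relation sum_i b_i = h_k, and where C_k is so
   dispersed that m(F) = |F + D_k| / |D_k| is eventually constant in k for every
   finite F.  Then exp(- m(F)) is the probability that a random subset of Q misses
   F, for a stationary random set whose law is, on finite sets, that of a dilated
   Bernoulli process.  Correlations at distance g are controlled by 2 - m({0, g});
   its Folner means vanish because there are arbitrarily many g_i with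
   m({g_i, g_j}) = 2, whence weak mixing.  As m({0, b}) <= 1 + 2 / (k + 2) for b
   in block k, the sequence enumerating the blocks is a rigidity sequence.

   If a character chi tends to 1 along the blocks, then |z - 1| <= 2/3 |z^2 - 1|
   near z = 1 forces |chi(b_i) - 1| <= (2/3)^(t_k), so that chi(h_k) is close to
   1; choosing each element of Gamma as h_k for infinitely many k gives chi = 1.
   Hence, if the sequence is a rigidity sequence of an ergodic system, every
   eigenfunction is invariant, and the constants would be dense in L^2 of a
   non-atomic space. *)

Require Import Defs.
From HB Require Import structures.
From mathcomp Require Import all_boot all_order all_algebra finmap.
From mathcomp Require Import generic_quotient ring_quotient.
From mathcomp Require Import all_classical all_reals all_analysis.
From mathcomp Require Import measurable_realfun complex zify ring lra.

Set Implicit Arguments.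
Unset Strict Implicit.
Unset Printing Implicit Defensive.

Import Order.TTheory GRing.Theory Num.Theory.
Import numFieldNormedType.Exports.

Local Open Scope classical_set_scope.
Local Open Scope ring_scope.

(** * Finite sets in an infinite abelian group *)

(** Every group element is [h_k] infinitely often, so a system rigid along the [h_k] would be
    trivial: the [b_i] have to be rigid although their sum is not. Each [b_i] of block [k] costs
    about [2 / (k + 2)], and [k + 2] such costs only add up to 2, which says nothing about [h_k].
    For a character, the doublings inside the block turn smallness into exponential smallness, and
    this survives the summation.

    The random set is a Poisson-like limit: at stage [k], translates of [- D_k] are placed along a
    Bernoulli set of density about [1 / |D_k|], so that [F] is missed with probability
    [exp(- |F + D_k| / |D_k|)]. As these ratios are eventually constant, and not merely convergent,
    finitely many cylinder weights can be read off one stage, and their positivity needs no limit.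
    Points with disjoint translates of [D_k] behave independently; their abundance yields both the
    mixing and the absence of atoms.

    The quotient is there because [n Gamma] may be finite and nontrivial: then [n b] can be neither
    generic nor known to vanish. *)

Section Sumsets.
Variable Q : zmodType.
Implicit Types (A B C E : {fset Q}).

Definition sumset A B : {fset Q} := [fset (x + y)%R | x in A, y in B]%fset.

Lemma sumsetP A B z :
  reflect (exists x y, [/\ x \in A, y \in B & z = x + y]) (z \in sumset A B).
Proof.
apply: (iffP idP) => [/imfset2P /= [x xA [y yB ->]]|[x [y [xA yB ->]]]].
  by exists x, y.
by apply/imfset2P; exists x => //; exists y.
Qed.

Lemma mem_sumset A B x y : x \in A -> y \in B -> x + y \in sumset A B.
Proof. by move=> xA yB; apply/sumsetP; exists x, y. Qed.

Lemma sumsetA A B C : sumset A (sumset B C) = sumset (sumset A B) C.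
Proof.
apply/fsetP => z; apply/sumsetP/sumsetP.
  move=> [a [_ [aA /sumsetP [b [c [bB cC ->]]] ->]]].
  by exists (a + b), c; rewrite addrA mem_sumset.
move=> [_ [c [/sumsetP [a [b [aA bB ->]]] cC ->]]].
by exists a, (b + c); rewrite addrA mem_sumset.
Qed.

Lemma sumsetC A B : sumset A B = sumset B A.
Proof.
apply/fsetP => z; apply/sumsetP/sumsetP => -[a [b [aA bB ->]]];
  by exists b, a; rewrite addrC.
Qed.

Lemma sumset0x A : sumset [fset 0]%fset A = A.
Proof.
apply/fsetP => z; apply/sumsetP/idP => [[x [y [/fset1P -> yA ->]]]|zA].
  by rewrite add0r.
by exists 0, z; rewrite inE eqxx add0r.
Qed.

Lemma sumsetSS A A' B B' : (A `<=` A')%fset -> (B `<=` B')%fset ->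
  (sumset A B `<=` sumset A' B')%fset.
Proof.
move=> /fsubsetP sA /fsubsetP sB; apply/fsubsetP => z.
by move=> /sumsetP [x [y [xA yB ->]]]; rewrite mem_sumset ?sA ?sB.
Qed.

Lemma sumsetUl A A' B :
  sumset (A `|` A')%fset B = (sumset A B `|` sumset A' B)%fset.
Proof.
apply/fsetP => z; apply/sumsetP/fsetUP.
  move=> [x [y [/fsetUP [xA|xA'] yB ->]]]; [left|right]; exact: mem_sumset.
by move=> [] /sumsetP [x [y [xA yB ->]]]; exists x, y; rewrite inE xA ?orbT.
Qed.

Let sumset_seq A B : sumset A B = [fset z in [seq (x + y)%R | x <- A, y <- B]]%fset.
Proof.
apply/fsetP => z; rewrite inE; apply/sumsetP/allpairsP => /=.
  by move=> [x [y [xA yB ->]]]; exists (x, y).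
by move=> [[x y] /= [xA yB ->]]; exists x, y.
Qed.

Lemma card_sumset_le A B : (#|` sumset A B| <= #|` A| * #|` B|)%N.
Proof.
by rewrite sumset_seq card_fseq (leq_trans (size_undup _)) // size_allpairs.
Qed.

Lemma card_sumset A B :
  (forall x x' y y', x \in A -> x' \in A -> y \in B -> y' \in B ->
    x + y = x' + y' -> y = y') ->
  #|` sumset A B| = (#|` A| * #|` B|)%N.
Proof.
move=> inj; rewrite sumset_seq card_fseq undup_id ?size_allpairs //.
apply: allpairs_uniq; rewrite ?fset_uniq // => -[x y] [x' y'].
move=> /allpairsP [[u v] /= [uA vB [-> ->]]].
move=> /allpairsP [[u' v'] /= [uA' vB' [-> ->]]] e.
have yy := inj _ _ _ _ uA uA' vB vB' e; rewrite yy in e *.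
by rewrite (addIr _ e).
Qed.

Lemma card_translate (q : Q) A : #|` sumset [fset q]%fset A| = #|` A|.
Proof.
rewrite card_sumset ?cardfs1 ?mul1n // => x x' y y' /fset1P -> /fset1P -> _ _.
exact: addrI.
Qed.

End Sumsets.

(** * Generic elements and dispersed, almost invariant sets *)

Section Generic.
Variable Q : zmodType.
Implicit Types (E : {fset Q}) (kappa N : nat).

(* Multiples of [b] by small integers stay out of [E], up to the unavoidable
   relation [kappa * b = 0]; [kappa = 0] means that there is no such relation. *)
Definition generic_exponent kappa : Prop :=
  [/\ kappa != 1%N, forall q : Q, q *+ kappa = 0 &
    forall N E, exists b : Q, forall y : int,
      (`|y| <= N)%N -> b *~ y \in E -> (kappa %| `|y|)%N].

Variable kappa : nat.
Hypothesis genQ : generic_exponent kappa.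

Lemma mulrz_generic (q : Q) (y : int) : (kappa %| `|y|)%N -> q *~ y = 0.
Proof.
case: genQ => _ k0 _ /dvdnP [c cE].
have k0' : q *+ `|y| = 0 by rewrite cE mulnC mulrnA k0 mul0rn.
by case: (intP y) k0' => // n; rewrite ?abszN ?mulrNz -?pmulrn => -> //; rewrite oppr0.
Qed.

(** The new element [b] is chosen against [E], the others against [E] minus all small multiples of
    [b]. So the coefficients of the others are controlled whatever that of [b] is; their terms then
    vanish, as [kappa] kills [Q], and the choice of [b] settles its own coefficient. *)
Lemma generic_seq n N E : exists w : nat -> Q, forall y : nat -> int,
  (forall i, (`|y i| <= N)%N) ->
  \sum_(i < n) w i *~ y i \in E -> forall i, (i < n)%N -> (kappa %| `|y i|)%N.
Proof.
case: genQ => _ _ gen.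
elim: n E => [|n IH] E; first by exists (fun=> 0).
have [b bP] := gen N E.
pose E' : {fset Q} := [fset (e - b *~ (z%:Z - N%:Z))%R | e in E, z in iota 0 (2 * N).+1]%fset.
have [w wP] := IH E'.
exists (fun i => if i is j.+1 then w j else b) => y yN.
rewrite big_ord_recl /= => yE.
have H i : (i < n)%N -> (kappa %| `|y i.+1|)%N.
  apply: (wP (fun i => y i.+1)) => // {i}.
  apply/imfset2P; exists (b *~ y 0%N + \sum_(i < n) w i *~ y (bump 0 i)) => //.
  exists `|(y 0%N + N%:Z)%R|%N => /=.
    by rewrite inE mem_iota; have := yN 0%N; lia.
  have -> : `|(y 0%N + N%:Z)%R|%N%:Z - N%:Z = y 0%N by have := yN 0%N; lia.
  by rewrite addrAC subrr add0r; apply: eq_bigr => i _; rewrite /bump.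
case=> [_|i]; last by rewrite ltnS; apply: H.
apply: bP => //; move: yE; rewrite big1 ?addr0 // => i _.
by apply: mulrz_generic; rewrite H.
Qed.

Lemma generic_family (J : finType) N E : exists w : J -> Q, forall y : J -> int,
  (forall j, (`|y j| <= N)%N) ->
  \sum_j w j *~ y j \in E -> forall j, (kappa %| `|y j|)%N.
Proof.
have [w wP] := generic_seq #|J| N E.
exists (fun j => w (enum_rank j)) => y yN yE j.
pose y' i := if insub i is Some u then y (enum_val (u : 'I_#|J|)) else 0.
have y'E (u : 'I_#|J|) : y' u = y (enum_val u).
  by rewrite /y' insubT // => ?; congr (y (enum_val _)); exact: val_inj.
rewrite -[j]enum_rankK -y'E; apply: wP => // [i|].
  by rewrite /y'; case: insub.
suff -> : \sum_(i < #|J|) w i *~ y' i = \sum_j w (enum_rank j) *~ y j by [].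
rewrite [RHS](reindex (@enum_val J predT)) /=; last first.
  by exists enum_rank => ? _; rewrite ?enum_valK ?enum_rankK.
by apply: eq_bigr => i _; rewrite y'E enum_valK.
Qed.

End Generic.

Section Stage.
Variables (G Q : zmodType) (f : {additive G -> Q}).
Hypothesis fsurj : forall q, exists g, f g = q.
Variable kappa : nat.
Hypothesis genQ : generic_exponent Q kappa.

(* [C] consists of the points [z (i, x i) + \sum_(j != i) x j * b j], [x j < S],
   with generic [z]: translation by [2 ^ j * b i] shifts the coordinate [x i] of
   the points with distinguished index other than [i], and thus keeps all but a
   proportion of about [2 / m] of [C] inside [C]. *)
Lemma stage (E : {fset Q}) (h : G) (m t : nat) : (0 < m)%N ->
  exists (C : {fset Q}) (b : 'I_m -> G),
  [/\ C != fset0, \sum_i b i = h,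
      (forall c c', c \in C -> c' \in C -> c - c' \in E -> c = c') &
      forall (i : 'I_m) j, (j <= t)%N ->
        (#|` sumset [fset 0%R; f (b i *+ 2 ^ j)%R]%fset C| * m <= (m + 2) * #|` C|)%N].
Proof.
move=> m0.
have [k1 k0 _] := genQ.
(* Range of the coordinates. Modulo [kappa] a shift wraps around without loss; in the absence of a
   relation, the range [m * 2 ^ t] lets a shift by at most [2 ^ t] overflow for at most a proportion
   [1 / m] of the values. *)
pose S := (if kappa == 0 then m * 2 ^ t else kappa)%N.
have S0 : (0 < S)%N.
  by rewrite /S; case: ifP => [_|/negbT]; rewrite ?muln_gt0 ?m0 ?expn_gt0 // lt0n.
have S1 : kappa = 0%N -> S = (m * 2 ^ t)%N by rewrite /S => ->.
have S2 : kappa != 0%N -> S = kappa by rewrite /S => /negbTE ->.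
move: S S0 S1 S2 => S S0 S1 S2.
pose o : 'I_m := Ordinal m0.
pose J := ('I_m + 'I_m * 'I_S)%type.
(* The relation between the [b j] leaves an uncontrolled multiple of [f h] in every difference of
   codes, hence this enlargement. With [0] included, the same separation also proves that the coding
   is injective. *)
pose E' : {fset Q} := [fset (e - f h *~ (z%:Z - S%:Z))%R | e in 0%R |` E, z in iota 0 (2 * S).+1]%fset.
have [w wP] := generic_family genQ J (2 * S) E'.
pose v (i : 'I_m) : G := sval (cid (fsurj (w (inl i)))).
have fv i : f (v i) = w (inl i) by rewrite /v; case: cid.
pose b i := if i == o then h - \sum_(j | j != o) v j else v i.
have bh : \sum_i b i = h.
  rewrite (bigD1 o) //= {1}/b eqxx (eq_bigr v) ?subrK // => i /negbTE io.
  by rewrite /b io.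
pose I := ('I_m * {ffun 'I_m -> 'I_S})%type.
pose c (u : I) := w (inr (u.1, u.2 u.1)) + \sum_(j | j != u.1) f (b j) *+ u.2 j.
(* Because of the relation, only the differences [d j - d o] appear as coefficients of independent
   generic elements. *)
have sumB (d : 'I_m -> int) : \sum_j f (b j) *~ d j =
    f h *~ d o + \sum_j w (inl j) *~ (d j - d o).
  rewrite (bigD1 o) //= [in RHS](bigD1 o) //= subrr mulr0z add0r.
  rewrite {1}/b eqxx raddfB mulrzBl raddf_sum -addrA; congr (_ + _).
  rewrite mulrz_suml -sumrN -big_split /=; apply: eq_bigr => j /negbTE jo.
  by rewrite /b jo fv mulrzBr addrC.
have csep (u u' : I) : c u - c u' \in (0 |` E)%fset -> u = u'.
  case: u u' => i x [i' x'] /=; rewrite {1 2}/c /= => cE.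
  pose d (j : 'I_m) : int := (if j == i then 0 else (x j)%:Z) - (if j == i' then 0 else (x' j)%:Z).
  pose y (j : J) : int := match j with
    | inl j => d j - d o
    | inr p => (p == (i, x i))%:Z - (p == (i', x' i'))%:Z end.
  have dS j : (`|d j| <= S)%N.
    have := ltn_ord (x j); have := ltn_ord (x' j).
    by rewrite /d; case: eqP; case: eqP; lia.
  have yS j : (`|y j| <= 2 * S)%N.
    case: j => [j|p] /=; last by do 2!case: eqP; lia.
    by have := dS j; have := dS o; lia.
  have sumy : \sum_j w j *~ y j = c (i, x) - c (i', x') - f h *~ d o.
    rewrite big_sumType /= /c /=.
    have H (a : 'I_m) (s : {ffun 'I_m -> 'I_S}) :
        \sum_(j | j != a) f (b j) *+ s j = \sum_j f (b j) *~ (if j == a then 0 else (s j)%:Z).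
      rewrite [RHS](bigD1 a) //= eqxx mulr0z add0r; apply: eq_bigr => j /negbTE ->.
      by rewrite pmulrn.
    have K p : \sum_j w (inr j) *~ (j == p)%:Z = w (inr p).
      rewrite (bigD1 p) //= eqxx mulr1z big1 ?addr0 // => j /negbTE ->.
      by rewrite mulr0z.
    rewrite !H.
    have -> : \sum_j w (inl j) *~ (d j - d o) = \sum_j f (b j) *~ d j - f h *~ d o.
      by rewrite sumB addrAC subrr add0r.
    have -> : \sum_j f (b j) *~ d j = \sum_j f (b j) *~ (if j == i then 0 else (x j)%:Z)
       - \sum_j f (b j) *~ (if j == i' then 0 else (x' j)%:Z).
      by rewrite -sumrB; apply: eq_bigr => j _; rewrite mulrzBr.
    rewrite (eq_bigr (fun j => w (inr j) *~ (j == (i, x i))%:Z - w (inr j) *~ (j == (i', x' i'))%:Z)).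
      rewrite sumrB !K opprD.
      by rewrite [RHS](AC (2*2*1) (2*4*5*(1*3))).
    by move=> j _; rewrite mulrzBr.
  have yE : \sum_j w j *~ y j \in E'.
    rewrite sumy; apply/imfset2P; exists (c (i, x) - c (i', x')) => //.
    exists `|(d o + S%:Z)%R|%N => /=.
      by rewrite inE mem_iota; have := dS o; lia.
    have -> : `|(d o + S%:Z)%R|%N%:Z - S%:Z = d o by have := dS o; lia.
    by [].
  have yk := wP y yS yE.
  (* If the distinguished elements differed, one of them would occur with coefficient 1, and [kappa]
     does not divide 1. *)
  have ii : (i, x i) = (i', x' i').
    apply/eqP; apply: contraT => ne; have := yk (inr (i, x i)).
    by rewrite /= eqxx (negbTE ne) subr0 dvdn1 (negbTE k1).
  case: ii => ii xx; subst i'.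
  (* The distinguished coordinate is absent from both codes. This pins down the common shift [d o]
     modulo [kappa], and with it every [d j]. *)
  have di : d i = 0 by rewrite /d eqxx.
  have ddo : (kappa %| `|d o|)%N by have := yk (inl i); rewrite /= di sub0r abszN.
  have dd j : (kappa %| `|d j|)%N.
    have := yk (inl j) => /= H.
    suff : (kappa%:Z %| d j)%Z by rewrite dvdzE.
    by rewrite -[d j](subrK (d o)) rpredD // dvdzE.
  congr (_, _); apply/ffunP => j; have [->|/negbTE ji] := eqVneq j i; first exact: xx.
  have := dd j; rewrite /d ji => dj; apply: val_inj => /=.
  have := ltn_ord (x j); have := ltn_ord (x' j) => lt1 lt2.
  have : (`|((x j)%:Z - (x' j)%:Z)%R| < S)%N by lia.
  have [kz|kn] := eqVneq kappa 0%N.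
    by move=> _; move: dj; rewrite kz dvd0n absz_eq0 subr_eq0 => /eqP [].
  have Sk := S2 kn; move: dj.
  set a := `|_|%N => ka aS; have : a = 0%N.
    by apply/eqP; apply: contraLR aS; rewrite -lt0n -leqNgt Sk => /dvdn_leq; apply.
  by rewrite /a; lia.
have injc : injective c by move=> u u' cuu; apply: csep; rewrite cuu subrr !inE eqxx.
pose C : {fset Q} := [fset x in codom c]%fset.
have memC x : reflect (exists u, x = c u) (x \in C).
  by rewrite inE; apply: (iffP codomP).
have cardC : #|` C| = (m * S ^ m)%N.
  rewrite card_fseq undup_id ?size_codom ?card_prod ?card_ffun ?card_ord //.
  by rewrite /codom /image_mem map_inj_uniq ?enum_uniq.
exists C, b; split => //.
- by rewrite -cardfs_gt0 cardC muln_gt0 m0 expn_gt0 S0.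
- move=> _ _ /memC [u ->] /memC [u' ->] H; congr c.
  by apply: csep; rewrite in_fsetU H orbT.
move=> l j jt.
set beta := f _.
(* Only two kinds of points can leave [C]: those without a term in [b l], and those whose coordinate
   [l] overflows. Each kind is at most a proportion [1 / m]. *)
pose bad1 : {set I} := finset.finset (fun u : I => u.1 == l).
pose bad2 : {set I} := finset.finset (fun u : I => (kappa == 0%N) && (S <= u.2 l + 2 ^ j)%N).
have H1 u : u \notin bad1 -> u \notin bad2 -> c u + beta \in C.
  case: u => i x; rewrite !finset.inE /= negb_and -ltnNge => il xl.
  apply/memC.
  exists (i, [ffun r => if r == l then Ordinal (ltn_pmod (x l + 2 ^ j) S0) else x r]).
  rewrite /c /= ffunE (negbTE il) -addrA; congr (_ + _).
  rewrite (bigD1 l) 1?eq_sym //= [in RHS](bigD1 l) 1?eq_sym //= ffunE eqxx /=.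
  rewrite addrAC; congr (_ + _).
    rewrite /beta raddfMn -mulrnDr.
    case/orP: xl => [kn|xS]; last by rewrite modn_small.
    rewrite {1}(divn_eq (x l + 2 ^ j) S) mulrnDr mulnC mulrnA.
    have -> : f (b l) *+ S = 0 by rewrite (S2 kn).
    by rewrite mul0rn add0r.
  by apply: eq_bigr => r /andP [_ /negbTE rl]; rewrite ffunE rl.
have cardS : (#|` sumset [fset 0%R; beta]%fset C| <= #|` C| + (#|bad1| + #|bad2|))%N.
  pose B : {fset Q} := [fset x in [seq (c u + beta)%R | u <- enum (bad1 :|: bad2)%SET]]%fset.
  have : (sumset [fset 0%R; beta] C `<=` C `|` B)%fset.
    apply/fsubsetP => _ /sumsetP [z [_ [z0 /memC [u ->] ->]]].
    rewrite inE; case/fset2P: z0 => ->.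
      by rewrite add0r; apply/orP; left; apply/memC; exists u.
    rewrite addrC; case: (boolP (u \in (bad1 :|: bad2)%SET)) => [ub|].
      apply/orP; right; rewrite inE; apply: map_f.
      by rewrite mem_enum.
    by rewrite finset.in_setU negb_or => /andP [u1 u2]; rewrite H1.
  move=> /fsubset_leq_card /leq_trans; apply.
  rewrite cardfsU (leq_trans (leq_subr _ _)) // leq_add2l.
  rewrite card_fseq (leq_trans (size_undup _)) // size_map -cardE.
  by rewrite finset.cardsU leq_subr.
have card1 : (#|bad1| * m <= #|` C|)%N.
  rewrite cardC mulnC leq_mul2l; apply/orP; right.
  have : bad1 \subset codom (fun x : {ffun 'I_m -> 'I_S} => (l, x)).
    by apply/fintype.subsetP => -[i x]; rewrite finset.inE /= => /eqP ->; apply: codom_f.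
  move=> /subset_leq_card /leq_trans; apply.
  by rewrite (leq_trans (leq_image_card _ _)) // card_ffun !card_ord.
have card2 : (#|bad2| * m <= #|` C|)%N.
  have [k0'|kn] := eqVneq kappa 0%N; last first.
    rewrite (_ : #|bad2| = 0%N) ?mul0n //; apply/eqP; rewrite cards_eq0.
    by apply/eqP/finset.setP => u; rewrite !finset.inE (negbTE kn).
  have SE : S = (m * 2 ^ t)%N by exact: S1.
  (* Overflowing values are among the top [2 ^ t]. Reflecting them to the bottom and moving them up
     by multiples of [2 ^ t] fits [m] disjoint copies of [bad2] into the index set. *)
  pose F (p : 'I_m * I) : I := (p.2.1, [ffun r => if r == l then
     insubd (Ordinal S0) ((S - 1 - p.2.2 l) + p.1 * 2 ^ t)%N else p.2.2 r]).
  have tj : (2 ^ j <= 2 ^ t)%N by rewrite leq_pexp2l.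
  have Fl p : p.2 \in bad2 -> ((F p).2 l : nat) = ((S - 1 - p.2.2 l) + p.1 * 2 ^ t)%N.
    case: p => r [i x]; rewrite finset.inE /= => /andP [_ Sx].
    rewrite /F /= ffunE eqxx val_insubd ifT //.
    have := ltn_ord r; have := ltn_ord (x l) => xS rm.
    have : (r.+1 * 2 ^ t <= m * 2 ^ t)%N by rewrite leq_mul2r rm orbT.
    by rewrite -SE mulSn; lia.
  have Finj : {in finset.setX [set: 'I_m]%SET bad2 &, injective F}.
    move=> [r [i x]] [r' [i' x']]; rewrite !finset.in_setX !finset.in_setT /=.
    move=> b2 b2' e.
    have := Fl (r, (i, x)) b2; have := Fl (r', (i', x')) b2'; rewrite e => -> /= e1.
    move: b2 b2'; rewrite !finset.inE /= => /andP [_ Sx] /andP [_ Sx'].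
    have := ltn_ord (x l); have := ltn_ord (x' l) => lx lx'.
    have T0 : (0 < 2 ^ t)%N by rewrite expn_gt0.
    have rr : r' = r :> nat.
      have aux (y : 'I_S) : (S <= y + 2 ^ j)%N -> (S - 1 - y < 2 ^ t)%N.
        by have := ltn_ord y; lia.
      have := congr1 (fun z => z %/ 2 ^ t)%N e1.
      by rewrite !(addnC (_ - _)%N) !divnMDl // !divn_small ?addn0 ?aux.
    have xx : x' l = x l :> nat.
      move: e1 lx lx'; rewrite rr => /addIn /=.
      move: (nat_of_ord (x l)) (nat_of_ord (x' l)) => a a'; clear; lia.
    case: e => -> /ffunP e; congr (_, (_, _)); first exact: val_inj.
    apply/ffunP => s; have := e s; rewrite !ffunE; case: eqP => // -> _.
    exact: val_inj.
  have := card_in_imset Finj; rewrite finset.cardsX finset.cardsT card_ord mulnC => <-.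
  rewrite (leq_trans (max_card _)) // cardC card_prod card_ffun !card_ord //.
have : (#|` sumset [fset 0%R; beta]%fset C| * m <= (#|` C| + (#|bad1| + #|bad2|)) * m)%N.
  by rewrite leq_mul2r cardS orbT.
move: card1 card2; set n1 := #|bad1|; set n2 := #|bad2|; nia.
Qed.
End Stage.

Section Blocks.
Variables (G Q : zmodType) (f : {additive G -> Q}).
Hypothesis fsurj : forall q, exists g, f g = q.
Variable kappa : nat.
Hypothesis genQ : generic_exponent Q kappa.
Variable eQ : nat -> Q.
Hypotheses (eQ_inj : injective eQ) (eQ_surj : forall q, exists i, eQ i = q).
Variables (h : nat -> G) (t : nat -> nat).

(* [D k.+1] is [D k + C] where [C] is given by [stage] for [E] the differences of
   [F k + D k], with finite sets [F k] exhausting [Q]; this separation makes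
   [|A + D k.+1| = |A + D k| |C|] for [A] inside [F k]. *)
Lemma rigid_blocks : exists (D : nat -> {fset Q}) (b : forall k, 'I_k.+2 -> G),
  [/\ forall k, D k != fset0,
      forall F : {fset Q}, exists K, forall k, (K <= k)%N ->
        (#|` sumset F (D k)| * #|` D K| = #|` sumset F (D K)| * #|` D k|)%N,
      forall k (i : 'I_k.+2) j k', (j <= t k)%N -> (k < k')%N ->
        (#|` sumset [fset 0%R; f (b k i *+ 2 ^ j)%R]%fset (D k')| * k.+2
          <= k.+4 * #|` D k'|)%N,
      forall k, \sum_i b k i = h k &
      forall J : {fset Q}, exists g K, forall k j, (K <= k)%N -> j \in J ->
        #|` sumset [fset g; j]%fset (D k)| = (2 * #|` D k|)%N].
Proof.
(* The summand [k] makes the sets [F k] exhaust [Q]; the other one makes [F k] larger than [k]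
   translates of [D - D], which leaves room for the sparse element at the end. *)
pose N k (D : {fset Q}) := (k + k * (#|` D| * #|` D|)).+1.
pose F k D : {fset Q} := [fset eQ i | i in iota 0 (N k D)]%fset.
have memF n j : (j < n)%N -> eQ j \in [fset eQ i | i in iota 0 n]%fset.
  by move=> jn; apply/imfsetP; exists j; rewrite // mem_iota.
have cardN n : #|` [fset eQ i | i in iota 0 n]%fset| = n.
  rewrite card_imfset // -[RHS](size_iota 0); apply/perm_size/uniq_perm.
  - exact: enum_finmem_uniq.
  - exact: iota_uniq.
  - by move=> x; rewrite enum_finmemE.
pose E k D : {fset Q} := let U := sumset (F k D) D in [fset (x - y)%R | x in U, y in U]%fset.
have st (p : nat * {fset Q}) : {q : {fset Q} * ('I_p.1.+2 -> G) |
    [/\ q.1 != fset0, \sum_i q.2 i = h p.1,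
      (forall c c', c \in q.1 -> c' \in q.1 -> c - c' \in E p.1 p.2 -> c = c') &
      forall (i : 'I_p.1.+2) j, (j <= t p.1)%N ->
        (#|` sumset [fset 0%R; f (q.2 i *+ 2 ^ j)%R]%fset q.1| * p.1.+2 <= (p.1.+2 + 2) * #|` q.1|)%N]}.
  apply: cid.
  have [C [b H]] := stage fsurj genQ (E p.1 p.2) (h p.1) (t p.1) (ltn0Sn p.1.+1).
  by exists (C, b).
pose D := fix D k := if k is k'.+1 then sumset (D k') (sval (st (k', D k'))).1 else [fset 0%R]%fset.
pose C k := (sval (st (k, D k))).1.
pose b k : 'I_k.+2 -> G := (sval (st (k, D k))).2.
have C0 k : C k != fset0 by case: (proj2_sig (st (k, D k))).
have bh k : \sum_i b k i = h k by case: (proj2_sig (st (k, D k))).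
have Csep k c c' : c \in C k -> c' \in C k -> c - c' \in E k (D k) -> c = c'.
  by case: (proj2_sig (st (k, D k))) => _ _ H _; apply: H.
have bC k (i : 'I_k.+2) j : (j <= t k)%N ->
    (#|` sumset [fset 0%R; f (b k i *+ 2 ^ j)%R]%fset (C k)| * k.+2 <= k.+4 * #|` C k|)%N.
  by rewrite -[X in (_ <= X * _)%N]addn2; case: (proj2_sig (st (k, D k))) => _ _ _; apply.
have DS k : D k.+1 = sumset (D k) (C k) by [].
have cardF k (A : {fset Q}) : (A `<=` F k (D k))%fset ->
    #|` sumset A (D k.+1)| = (#|` sumset A (D k)| * #|` C k|)%N.
  move=> AF; rewrite DS sumsetA card_sumset // => x x' y y' xA xA' yC yC' e.
  apply: Csep yC yC' _; apply/imfset2P => /=.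
  have sA : {subset sumset A (D k) <= sumset (F k (D k)) (D k)}.
    by apply/fsubsetP; exact: sumsetSS.
  exists x'; first exact: sA.
  exists x; first exact: sA.
  by apply/eqP; rewrite subr_eq addrAC eq_sym subr_eq (addrC y) e.
have F0 k (A : {fset Q}) i : (forall q, q \in A -> exists2 j, (j <= i)%N & q = eQ j) ->
    (i <= k)%N -> (A `<=` F k (D k))%fset.
  move=> Ai ik; apply/fsubsetP => q /Ai [j ji ->].
  by apply: memF; rewrite /N; lia.
have D0 k : D k != fset0.
  elim: k => [|k IH]; first by rewrite -cardfs_gt0 cardfs1.
  have /fset0Pn [x xD] := IH; have /fset0Pn [y yC] := C0 k.
  by apply/fset0Pn; exists (x + y); rewrite DS mem_sumset.
have cardD k : #|` D k.+1| = (#|` D k| * #|` C k|)%N.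
  have [i ei] := eQ_surj 0.
  have [z zF] : exists z, z \in F k (D k).
    by exists (eQ 0%N); apply: memF.
  have := @cardF k [fset z]%fset; rewrite !card_translate; apply.
  by apply/fsubsetP => x /fset1P ->.
have bound (A : {fset Q}) : exists i, forall q, q \in A -> exists2 j, (j <= i)%N & q = eQ j.
  pose r q := sval (cid (eQ_surj q)).
  exists (\max_(q <- A) r q)%N => q qA; exists (r q); last by rewrite /r; case: cid.
  by rewrite (big_fsetD1 _ qA) /= leq_maxl.
(* As long as [A] lies in the sets [F k], each stage multiplies the sizes of [A + D k] and [D k] by
   the same factor, so their ratio is frozen. *)
have persist (A : {fset Q}) K : (forall k, (K <= k)%N -> (A `<=` F k (D k))%fset) ->
  forall k, (K <= k)%N ->
    (#|` sumset A (D k)| * #|` D K| = #|` sumset A (D K)| * #|` D k|)%N.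
  move=> AF k /subnK <-; elim: (k - K)%N => [|n IH]; first by rewrite add0n.
  rewrite addSn cardF; last by apply: AF; rewrite leq_addl.
  by rewrite cardD mulnAC IH mulnA.
exists D, b; split => //.
- move=> A; have [i Ai] := bound A; exists i.
  by apply: persist => k; apply: F0.
(* The proportion is reached when [C k] is added and cannot grow later: a further [C k'] multiplies
   the left cardinal by at most its size and the right one by exactly its size. *)
- move=> k i j k' jt; elim: k' => // k' IH.
  rewrite ltnS leq_eqVlt => /orP [/eqP <-{k' IH}|/IH {}IH].
    rewrite DS sumsetA (sumsetC _ (D k)) -sumsetA -/(D k).
    rewrite -DS cardD mulnCA.
    apply: (@leq_trans (#|` D k| * #|` sumset [fset 0%R; f (b k i *+ 2 ^ j)%R]%fset (C k)| * k.+2)%N).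
      by rewrite leq_mul2r card_sumset_le orbT.
    by rewrite -mulnA leq_mul2l bC ?orbT.
  rewrite cardD DS sumsetA mulnA.
  apply: (@leq_trans (#|` sumset [fset 0%R; f (b k i *+ 2 ^ j)%R]%fset (D k')| * #|` C k'| * k.+2)%N).
    by rewrite leq_mul2r card_sumset_le orbT.
  by rewrite mulnAC leq_mul2r IH orbT.
move=> J; have [i Ji] := bound J.
have FJ k : (i <= k)%N -> (J `<=` F k (D k))%fset by exact: F0.
have J_le : (#|` J| <= i.+1)%N.
  have sub : (J `<=` [fset eQ j | j in iota 0 i.+1])%fset.
    by apply/fsubsetP => q /Ji [j ji ->]; apply: memF; rewrite ltnS.
  by rewrite (leq_trans (fsubset_leq_card sub)) // cardN.
(* For [g] outside [J + D k0 - D k0], the set [g + D k0] misses every [j + D k0]; [persist] then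
   keeps the ratio 2 at all later stages. *)
pose k0 := i.+1; pose D0' := D k0.
pose Bad : {fset Q} := sumset J [fset (x - y)%R | x in D0', y in D0']%fset.
have cardBad : (#|` Bad| <= k0 * (#|` D0'| * #|` D0'|))%N.
  rewrite (leq_trans (card_sumset_le _ _)) // leq_mul //.
  suff -> : [fset (x - y)%R | x in D0', y in D0']%fset = sumset D0' [fset (- y)%R | y in D0']%fset.
    rewrite (leq_trans (card_sumset_le _ _)) // leq_mul2l.
    by rewrite leq_imfset_card orbT.
  apply/fsetP => z; apply/imfset2P/sumsetP => /=.
    by move=> [x xD [y yD ->]]; exists x, (- y); split => //; apply: in_imfset.
  by move=> [x [_ [xD /imfsetP [/= y yD ->] ->]]]; exists x => //; exists y.
have [g gF gB] : exists2 g, g \in F k0 D0' & g \notin Bad.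
  apply: contrapT => H.
  have sub : (F k0 D0' `<=` Bad)%fset.
    by apply/fsubsetP => q qF; apply: contrapT => /negP qB; apply: H; exists q.
  have := leq_trans (fsubset_leq_card sub) cardBad.
  by rewrite cardN /N leqNgt ltnS leq_addl.
have Dmono k : (k0 <= k)%N -> (#|` D0'| <= #|` D k|)%N.
  move=> /subnK <-; elim: (k - k0)%N => [|n IH] //.
  by rewrite addSn cardD (leq_trans IH) // leq_pmulr // cardfs_gt0.
exists g, k0 => k j k0k jJ.
have AF l : (k0 <= l)%N -> ([fset g; j] `<=` F l (D l))%fset.
  move=> k0l; apply/fsubsetP => x /fset2P [] ->; last first.
    by apply: (fsubsetP (FJ l _)) => //; rewrite ltnW.
  case/imfsetP: gF => a; rewrite mem_iota add0n => aN ->.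
  apply: memF; rewrite (leq_trans aN) // /N ltnS.
  by rewrite leq_add // leq_mul // leq_mul // Dmono.
have := persist _ _ AF k k0k.
have notin x y : x \in D k0 -> y \in D k0 -> g + x = j + y -> False.
  move=> xD yD e; move/negP: gB; apply; apply/sumsetP; exists j, (y - x); split => //.
    by apply/imfset2P; exists y => //; exists x.
  by rewrite addrA -e addrK.
have gj : g != j.
  apply/eqP => gj; have /fset0Pn [x xD] := D0 k0.
  by apply: (notin x x) => //; rewrite gj.
rewrite (card_sumset (A := [fset g; j]%fset) (B := D k0)); last first.
  move=> x x' y y' /fset2P [] -> /fset2P [] -> yD yD'.
  - exact: addrI.
  - by move=> /(notin _ _ yD yD').
  - by move=> /esym /(notin _ _ yD' yD).
  - exact: addrI.
rewrite cardfs2 gj /= mulnAC => /eqP; rewrite eqn_pmul2r; last by rewrite cardfs_gt0; exact: (D0 k0).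
by move=> /eqP.
Qed.

End Blocks.

(** * Intensity of a sequence of finite sets *)

Section Translates.
Variables (Q : zmodType) (D : {fset Q}).
Implicit Types (x y g : Q) (s : seq Q) (X F : {fset Q}).
Local Notation tr x := (sumset [fset x]%fset D).
Local Notation trs s := (sumset [fset y in s]%fset D).

Lemma trs_cons x s : trs (x :: s) = (tr x `|` trs s)%fset.
Proof. by rewrite fset_cons sumsetUl. Qed.

Lemma trs_nil : trs [::] = fset0.
Proof.
by apply/fsetP => z; rewrite inE; apply/sumsetP => -[x [y []]]; rewrite inE.
Qed.

Lemma card_trsI_le s X :
  (#|` trs s `&` X|%fset <= \sum_(x <- s) #|` tr x `&` X|%fset)%N.
Proof.
elim: s => [|x s IH]; first by rewrite trs_nil fset0I cardfs0.
rewrite trs_cons fsetIUl big_cons cardfsU (leq_trans (leq_subr _ _)) //.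
by rewrite leq_add2l.
Qed.

Lemma card_trsI s X : uniq s ->
  {in s &, forall x y, x != y -> (tr x `&` tr y)%fset = fset0} ->
  #|` trs s `&` X|%fset = (\sum_(x <- s) #|` tr x `&` X|%fset)%N.
Proof.
elim: s => [|x s IH] /=; first by rewrite trs_nil fset0I cardfs0 big_nil.
move=> /andP [xs us] dis.
rewrite trs_cons fsetIUl big_cons cardfsU -IH //; last first.
  by move=> y z ys zs; apply: dis; rewrite inE ?ys ?zs orbT.
rewrite (_ : (tr x `&` X `&` (trs s `&` X))%fset = fset0) ?cardfs0 ?subn0 //.
apply/fsetP => z; rewrite !inE; apply/negbTE/negP => /andP [/andP [zx _] /andP []].
move=> /sumsetP [y [d [ys dD ze]]] _; rewrite inE in ys.
have : z \in (tr x `&` tr y)%fset.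
  by rewrite inE zx /=; apply/sumsetP; exists y, d; rewrite inE eqxx.
rewrite dis ?inE ?eqxx ?ys ?orbT //; apply: contraNN xs => /eqP ->.
by rewrite ys.
Qed.

Lemma card_sumsetI_le s F X : F =i s ->
  (#|` sumset F D `&` X|%fset <= \sum_(x <- s) #|` tr x `&` X|%fset)%N.
Proof.
move=> Fs; have -> : F = [fset y in s]%fset by apply/fsetP => z; rewrite Fs inE.
exact: card_trsI_le.
Qed.

Lemma card_sumsetI s F X : F =i s -> uniq s ->
  {in s &, forall x y, x != y -> (tr x `&` tr y)%fset = fset0} ->
  #|` sumset F D `&` X|%fset = (\sum_(x <- s) #|` tr x `&` X|%fset)%N.
Proof.
move=> Fs; have -> : F = [fset y in s]%fset by apply/fsetP => z; rewrite Fs inE.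
exact: card_trsI.
Qed.

Lemma card_tr2 x y :
  (#|` sumset [fset x; y]%fset D| + #|` tr x `&` tr y|%fset = 2 * #|` D|)%N.
Proof. by rewrite sumsetUl cardfsUI !card_translate mul2n addnn. Qed.

End Translates.

Local Notation fdisj A B := (fintype.disjoint (mem A) (mem B)).

(** * Finite Bernoulli sets and cylinder weights *)

Section FiniteBernoulli.
Variables (R : realType) (T : finType) (q : R).

Let W (w : {set T}) : R := \prod_(i : T) (if i \in w then 1 - q else q).

Lemma bernoulli_avoid (A : {set T}) :
  \sum_(w : {set T}) W w * (fdisj w A)%:R = q ^+ #|A|.
Proof.
have -> : q ^+ #|A| = \prod_(i : T) ((if i \in A then 0 else 1 - q) + q).
  rewrite (bigID (mem A)) /= (eq_bigr (fun=> q)); last by move=> i ->; rewrite add0r.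
  rewrite [X in _ * X]big1 ?mulr1 ?prodr_const //.
  by move=> i /negbTE ->; rewrite subrK.
rewrite bigA_distr; apply: eq_bigr => w _; rewrite /W.
case: (boolP (fdisj w A)) => [/pred0P dwA|].
  rewrite mulr1; apply: eq_bigr => i _; case: ifP => // iw.
  by have := dwA i; rewrite /= iw /= => ->.
rewrite mulr0 => H; have [i /= /andP [iw iA]] := pred0Pn H.
by rewrite (bigD1 i) //= iw iA mul0r.
Qed.

End FiniteBernoulli.

Section CylinderWeight.
Variables (R : realType) (Q : eqType).

(* Inclusion-exclusion: if [v O] is the probability of the event "1 on O",
   this is the probability of "1 on O and 0 on Z". *)
Fixpoint cylw (v : seq Q -> R) (O Z : seq Q) : R :=
  if Z is z :: Z' then cylw v O Z' - cylw v (z :: O) Z' else v O.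

Lemma eq_cylw v v' O Z :
  (forall O', {subset O' <= O ++ Z} -> v O' = v' O') -> cylw v O Z = cylw v' O Z.
Proof.
elim: Z O => [|z Z IH] O /= vv; first by apply: vv => x; rewrite cats0.
rewrite !IH // => O' sO; apply: vv => x /sO; rewrite !mem_cat !inE //.
  by rewrite orbA (orbC (x == z)).
by case/orP => ->; rewrite ?orbT.
Qed.

(** On each component of a mixture the inclusion-exclusion factorises into terms [1 - c i z]; with
    weights [W i >= 0] and [c i x] between 0 and 1, this makes the cylinder weights visibly
    nonnegative. *)
Lemma cylw_mixture (I : finType) (W : I -> R) (c : I -> Q -> R) O Z :
  cylw (fun O => \sum_i W i * \prod_(x <- O) c i x) O Z =
  \sum_i W i * \prod_(x <- O) c i x * \prod_(z <- Z) (1 - c i z).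
Proof.
elim: Z O => [|z Z IH] O /=; first by apply: eq_bigr => i _; rewrite big_nil mulr1.
rewrite !IH -sumrB; apply: eq_bigr => i _; rewrite !big_cons.
set a := \prod_(x <- O) _; set b := \prod_(z <- Z) _.
by ring.
Qed.

End CylinderWeight.

Section Intensity.
Variables (R : realType) (Q : zmodType) (D : nat -> {fset Q}).
Hypothesis D_neq0 : forall k, D k != fset0.
Hypothesis D_stable : forall F : {fset Q}, exists K, forall k, (K <= k)%N ->
  (#|` sumset F (D k)| * #|` D K| = #|` sumset F (D K)| * #|` D k|)%N.
Hypothesis D_sparse : forall J : {fset Q}, exists g K, forall k j, (K <= k)%N ->
  j \in J -> #|` sumset [fset g; j]%fset (D k)| = (2 * #|` D k|)%N.
Implicit Types (F : {fset Q}) (x y g : Q).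

Let ratio k F : R := #|` sumset F (D k)|%:R / #|` D k|%:R.

Let cD k : #|` D k|%:R != 0 :> R.
Proof. by rewrite pnatr_eq0 cardfs_eq0. Qed.

(* The eventual value of [|F + D k| / |D k|]. *)
Definition intensity F : R := ratio (sval (cid (D_stable F))) F.
Local Notation m := intensity.

Let mE F : exists K, forall k, (K <= k)%N -> m F = ratio k F.
Proof.
exists (sval (cid (D_stable F))) => k; rewrite /m; case: cid => K /= H Kk.
apply/eqP; rewrite /ratio eqr_div // -!natrM eqr_nat mulnC [X in _ == X]mulnC.
by rewrite mulnC -H // mulnC.
Qed.

Let mE_seq (s : seq {fset Q}) :
  exists K, forall k, (K <= k)%N -> {in s, forall F, m F = ratio k F}.
Proof.
elim: s => [|F s [K HK]]; first by exists 0%N.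
have [K' HK'] := mE F; exists (maxn K K') => k; rewrite geq_max => /andP [Kk K'k].
by move=> F'; rewrite inE => /predU1P [->|/HK]; [exact: HK'|apply].
Qed.

Let ratioM k F : ratio k F * #|` D k|%:R = #|` sumset F (D k)|%:R.
Proof. by rewrite /ratio divfK. Qed.

Let D_gt0 k : 0 < #|` D k|%:R :> R.
Proof. by rewrite ltr0n cardfs_gt0. Qed.

Lemma intensity0 : m fset0 = 0.
Proof.
have [K /(_ K (leqnn _)) ->] := mE fset0; rewrite /ratio.
suff -> : sumset fset0 (D K) = fset0 by rewrite cardfs0 mul0r.
by apply/fsetP => z; rewrite inE; apply/sumsetP => -[x [y []]]; rewrite inE.
Qed.

Lemma intensity1 x : m [fset x]%fset = 1.
Proof.
have [K /(_ K (leqnn _)) ->] := mE [fset x]%fset.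
by rewrite /ratio card_translate divff.
Qed.

Lemma intensity_translate g F : m (sumset [fset g]%fset F) = m F.
Proof.
have [K HK] := mE_seq [:: F; sumset [fset g]%fset F].
rewrite !(HK K) ?inE ?eqxx ?orbT //.
by rewrite /ratio -sumsetA card_translate.
Qed.

Lemma intensity_le F (c e : nat) (K : nat) :
  (forall k, (K < k)%N -> (#|` sumset F (D k)| * c <= e * #|` D k|)%N) ->
  m F * c%:R <= e%:R.
Proof.
move=> H; have [K' HK'] := mE F.
pose k := (K + K').+1; rewrite (HK' k) ?/k; last by lia.
rewrite -(ler_pM2r (D_gt0 k)) mulrAC ratioM -!natrM ler_nat.
by apply: H; rewrite /k; lia.
Qed.

Let overlap k x y : (2 - ratio k [fset x; y]%fset) * #|` D k|%:R =
  #|` sumset [fset x]%fset (D k) `&` sumset [fset y]%fset (D k)|%fset%:R.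
Proof.
rewrite mulrBl ratioM; apply/eqP; rewrite subr_eq addrC -natrD card_tr2.
by rewrite natrM.
Qed.

(** The middle term is the relative size of the overlap of [F + D k] and [F' + D k] at a late stage,
    and this overlap is covered by the overlaps of single translates. *)
Lemma intensityU F F' : 0 <= m F + m F' - m (F `|` F')%fset
  <= \sum_(x <- F) \sum_(y <- F') (2 - m [fset x; y]%fset).
Proof.
pose pairs := [seq [fset x; y]%fset | x <- F, y <- F'].
have [K HK] := mE_seq ([:: F; F'; (F `|` F')%fset] ++ pairs).
have {HK} HK := HK K (leqnn _).
rewrite !HK ?mem_cat ?inE ?eqxx ?orbT //.
set L := _ + _ - _.
have LE : L * #|` D K|%:R = #|` sumset F (D K) `&` sumset F' (D K)|%fset%:R.
  rewrite /L mulrBl mulrDl !ratioM sumsetUl; apply/eqP.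
  by rewrite subr_eq -!natrD [in eqbRHS]addnC cardfsUI.
apply/andP; split; first by rewrite -(pmulr_lge0 L (D_gt0 K)) LE ler0n.
rewrite -(ler_pM2r (D_gt0 K)) LE.
rewrite big_distrl /=.
apply: (@le_trans _ _ (\sum_(x <- F) #|` sumset [fset x]%fset (D K) `&` sumset F' (D K)|%fset%:R)).
  by rewrite -natr_sum ler_nat; exact: card_sumsetI_le.
rewrite big_seq [leRHS]big_seq; apply: ler_sum => x xF.
rewrite big_distrl /= fsetIC.
apply: (@le_trans _ _ (\sum_(y <- F') #|` sumset [fset y]%fset (D K) `&` sumset [fset x]%fset (D K)|%fset%:R)).
  by rewrite -natr_sum ler_nat; exact: card_sumsetI_le.
rewrite big_seq [leRHS]big_seq; apply: ler_sum => y yF.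
rewrite HK; last by rewrite mem_cat; apply/orP; right; apply/allpairsP; exists (x, y).
by rewrite overlap fsetIC.
Qed.

Lemma intensity_mono F F' : (F `<=` F')%fset -> m F <= m F'.
Proof.
move=> FF'; have [K HK] := mE_seq [:: F; F'].
rewrite !(HK K) ?inE ?eqxx ?orbT // -(ler_pM2r (D_gt0 K)) !ratioM ler_nat.
by rewrite fsubset_leq_card //; exact: sumsetSS.
Qed.

Lemma intensity_ge0 F : 0 <= m F.
Proof. by rewrite -intensity0 intensity_mono. Qed.

(** What [x + D k] adds to [F + D k] is contained in what it adds to [y + D k] alone. *)
Lemma intensityU1 F x y : y \in F ->
  m (x |` F)%fset <= m F + (m [fset x; y]%fset - 1).
Proof.
move=> yF; have [K HK] := mE_seq [:: F; (x |` F)%fset; [fset x; y]%fset].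
rewrite !(HK K) ?inE ?eqxx ?orbT // -(ler_pM2r (D_gt0 K)).
rewrite mulrDl mulrBl !ratioM mul1r !sumsetUl [leRHS]addrA lerBrDr -!natrD ler_nat.
have e1 := cardfsUI (sumset [fset x]%fset (D K)) (sumset [fset y]%fset (D K)).
have e2 := cardfsUI (sumset [fset x]%fset (D K)) (sumset F (D K)).
have : (#|` sumset [fset x]%fset (D K) `&` sumset [fset y]%fset (D K)|%fset
   <= #|` sumset [fset x]%fset (D K) `&` sumset F (D K)|%fset)%N.
  rewrite fsubset_leq_card // fsetIS //; apply: sumsetSS => //.
  by rewrite fsub1set.
by move: e1 e2; rewrite !card_translate; lia.
Qed.

(** Points whose translates of [D k] are eventually pairwise disjoint: the random set is independent
    over them. *)
Definition spread (s : seq Q) : Prop :=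
  uniq s /\ {in s &, forall x y, x != y -> m [fset x; y]%fset = 2}.

Let spread_disj k (s : seq Q) :
  {in s &, forall x y, x != y -> m [fset x; y]%fset = 2} ->
  {in [seq [fset x; y]%fset | x <- s, y <- s], forall F, m F = ratio k F} ->
  {in s &, forall x y, x != y ->
    (sumset [fset x] (D k) `&` sumset [fset y] (D k))%fset = fset0}.
Proof.
move=> ms mk x y xs ys xy; apply/cardfs0_eq/eqP; rewrite -(eqr_nat R) -overlap.
rewrite -mk ?ms ?subrr ?mul0r //.
by apply/allpairsP; exists (x, y).
Qed.

Lemma spread_intensity s F : spread s -> (forall x, x \in F -> x \in s) ->
  m F = #|` F|%:R.
Proof.
move=> [us ms] Fs.
have [K HK] := mE_seq (F :: [seq [fset x; y]%fset | x <- s, y <- s]).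
have {HK} HK := HK K (leqnn _).
rewrite HK ?mem_head // /ratio.
have dis : {in s &, forall x y, x != y ->
    (sumset [fset x] (D K) `&` sumset [fset y] (D K))%fset = fset0}.
  by apply: spread_disj => // F' H; apply: HK; rewrite inE H orbT.
have := @card_sumsetI _ (D K) F F (sumset F (D K)) (fun=> erefl) (fset_uniq _).
rewrite fsetIid => ->; last by move=> x y xF yF; apply: dis; exact: Fs.
rewrite big_seq (eq_bigr (fun=> #|` D K|)) => [|x xF]; last first.
  rewrite (_ : (_ `&` _)%fset = sumset [fset x]%fset (D K)) ?card_translate //.
  by apply/fsetIidPl/sumsetSS => //; rewrite fsub1set.
by rewrite -big_seq big_tnth sum_nat_const card_ord natrM mulfK.
Qed.

(** After a translation by [- g], the summands are the relative overlaps of the disjoint sets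
    [x + D k] with the single set [- g + D k]. *)
Lemma spread_overlap s g : spread s ->
  \sum_(x <- s) (2 - m [fset 0%R; (g + x)%R]%fset) <= 1.
Proof.
move=> [us ms].
have [K HK] := mE_seq ([seq [fset 0%R; (g + x)%R]%fset | x <- s] ++
  [seq [fset x; y]%fset | x <- s, y <- s]).
have {HK} HK := HK K (leqnn _).
have dis : {in s &, forall x y, x != y ->
    (sumset [fset x] (D K) `&` sumset [fset y] (D K))%fset = fset0}.
  by apply: spread_disj => // F H; apply: HK; rewrite mem_cat H orbT.
rewrite -(ler_pM2r (D_gt0 K)) mul1r big_distrl /=.
rewrite (eq_big_seq (fun x => #|` sumset [fset x] (D K) `&` sumset [fset (- g)%R] (D K)|%fset%:R)); last first.
  move=> x xs; rewrite HK; last by rewrite mem_cat; apply/orP; left; apply/mapP; exists x.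
  rewrite overlap sumset0x; congr (_%:R).
  have -> : (sumset [fset x] (D K) `&` sumset [fset (- g)%R] (D K))%fset
     = sumset [fset (- g)%R]%fset (D K `&` sumset [fset (g + x)%R] (D K))%fset.
    apply/fsetP => z; rewrite inE; apply/andP/sumsetP.
      move=> [/sumsetP [_ [d [/fset1P -> dD ->]]] /sumsetP [_ [d' [/fset1P -> dD' e]]]].
      exists (- g), d'; rewrite !inE eqxx dD' /=; split => //.
      apply/sumsetP; exists (g + x), d; rewrite inE eqxx; split => //.
      by rewrite -addrA e addNKr.
    move=> [_ [d [/fset1P -> ]]]; rewrite inE => /andP [dD /sumsetP [_ [d' [/fset1P -> dD' de]]]] ->.
    split; apply/sumsetP; last by exists (- g), d; rewrite inE eqxx.
    by exists x, d'; rewrite inE eqxx de; split => //; rewrite -addrA addKr.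
  by rewrite card_translate.
rewrite -natr_sum -card_trsI // ler_nat.
apply: leq_trans (_ : #|` sumset [fset (- g)%R] (D K)|%fset <= _)%N.
  by rewrite fsubset_leq_card // fsubsetIr.
by rewrite card_translate.
Qed.

Lemma spread_exists n : exists2 s, spread s & size s = n.
Proof.
elim: n => [|n [s [us ms] ss]]; first by exists [::].
have [g [K gK]] := D_sparse [fset x in s]%fset.
have mg x : x \in s -> m [fset g; x]%fset = 2.
  move=> xs; have [K' HK'] := mE [fset g; x]%fset.
  rewrite (HK' (maxn K K')) ?leq_maxr // /ratio gK ?leq_maxl ?inE //.
  by rewrite natrM mulfK.
exists (g :: s); last by rewrite /= ss.
split.
  rewrite /= us andbT; apply/negP => gs; have := mg g gs.
  by rewrite fsetUid intensity1 => /eqP; rewrite eq_sym -subr_eq0 addrK oner_eq0.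
move=> x y; rewrite !inE => /predU1P [->|xs] /predU1P [->|ys]; rewrite ?eqxx //.
- by move=> _; apply: mg.
- by move=> _; rewrite fsetUC mg.
- exact: ms.
Qed.

(* [expR (- m F)] is the probability that the translates [x + D K], [x] in [F],
   all miss a Bernoulli random set that avoids each point with probability
   [expR (- 1 / |D K|)]. *)
Lemma void_cylw_ge0 (O Z : seq Q) :
  0 <= cylw (fun s => expR (- m [fset x in s]%fset)) O Z.
Proof.
pose V := [fset x in O ++ Z]%fset.
(* One stage serves all subsets of [V] at once, so its probabilities are exactly the weights in
   question. *)
have [K HK] := mE_seq (fpowerset V).
have {HK} HK := HK K (leqnn _).
pose q := expR (- (#|` D K|%:R^-1 : R)).
have q01 : 0 <= q <= 1.
  by rewrite expR_ge0 -expR0 ler_expR oppr_le0 invr_ge0 ler0n.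
pose S := sumset V (D K).
pose W (w : {set S}) : R := \prod_(i : S) (if i \in w then 1 - q else q).
pose c (w : {set S}) (x : Q) : R := (fdisj w (fsub S (sumset [fset x]%fset (D K))))%:R.
rewrite (@eq_cylw _ _ _ (fun s => \sum_w W w * \prod_(x <- s) c w x)).
  rewrite cylw_mixture; apply: sumr_ge0 => w _; rewrite !mulr_ge0 //.
  - apply: prodr_ge0 => i _; case: ifP => _; first by case/andP: q01 => _; rewrite subr_ge0.
    by case/andP: q01.
  - by apply: prodr_ge0 => x _; rewrite ler0n.
  - by apply: prodr_ge0 => x _; rewrite subr_ge0 /c; case: (fdisj _ _).
move=> s sV.
have sV' : ([fset x in s] `<=` V)%fset.
  by apply/fsubsetP => x; rewrite /V !in_fset; exact: sV.
rewrite HK; last by rewrite fpowersetE.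
transitivity (q ^+ #|fsub S (sumset [fset x in s]%fset (D K))|).
  rewrite card_fsub; last exact: sumsetSS.
  by rewrite /q -expRM_natl /ratio mulrN.
rewrite -bernoulli_avoid; apply: eq_bigr => w _; congr (_ * _).
elim: s {sV sV'} => [|x s IH].
  rewrite big_nil (_ : (fdisj _ _) = true) //.
  apply/pred0P => u /=; rewrite in_fsub trs_nil inE andbF //.
rewrite big_cons -IH /c -natrM mulnb; congr (nat_of_bool _)%:R.
by rewrite trs_cons fsubU -!setI_eq0 finset.setIUr finset.setU_eq0.
Qed.

End Intensity.

(** * Lebesgue spaces of bit sequences *)

Section Completion.
Context d (T : measurableType d) (R : realType) (nu : probability T R).
Local Open Scope ereal_scope.

(** A system must carry a complete measure, so the law on bit sequences is replaced by its
    Caratheodory extension. *)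
Definition completion_type : measurableType _ := caratheodory_type ((nu : set T -> \bar R)^*)%mu.

Definition completion : set completion_type -> \bar R :=
  @completed_measure_extension _ _ _ nu.

HB.instance Definition _ := Measure.on completion.

Lemma completionE (A : set T) : measurable A -> completion A = nu A.
Proof. by move=> mA; rewrite /completion /completed_measure_extension measurable_mu_extE. Qed.

Lemma completion_setT : completion setT = 1.
Proof. by rewrite completionE // probability_setT. Qed.

HB.instance Definition _ :=
  Measure_isProbability.Build _ _ _ completion completion_setT.

Lemma measurable_completion (A : set T) :
  measurable A -> measurable (A : set completion_type).
Proof. by move=> mA; apply: sub_caratheodory; apply: sub_sigma_algebra. Qed.

Lemma completion_complete : measure_is_complete completion.
Proof. exact: measure_is_complete_caratheodory. Qed.

(** [B] is the union of a nearly optimal cover from the definition of the outer measure. This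
    carries statements from a sigma-algebra over to its completion. *)
Lemma completion_approx (A : set completion_type) (e : R) : (0 < e)%R ->
  measurable A -> exists B : set T,
    [/\ measurable B, A `<=` B & completion (B `\` A) <= e%:E].
Proof.
move=> e0 mA.
have fA : completion A \is a fin_num by exact: fin_num_measure.
have [F [mF AF] FA] : exists2 F : nat -> set T, @measurable_cover _ T A F &
    \sum_(k <oo) nu (F k) < completion A + e%:E.
  have [_ [F AF <-] FA] := lb_ereal_inf_adherent e0 fA; exists F;
    [exact: AF|exact: FA].
exists (\bigcup_k F k); split => //; first exact: bigcupT_measurable.
have mB : measurable (\bigcup_k F k) by exact: bigcupT_measurable.
rewrite measureD; last 3 first.
- exact: measurable_completion.
- exact: mA.
- by rewrite -ge0_fin_numE // fin_num_measure //; exact: measurable_completion.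
rewrite setIidr // leeBlDr // addeC; apply: le_trans (ltW FA).
by rewrite /= completionE //; apply: measure_sigma_subadditive.
Qed.

End Completion.
Arguments completion {d T R} nu _.

Section LebesgueCompletion.
Context d (T : measurableType d) (R : realType) (nu : probability T R).
Variables (psi : R -> T) (theta : T -> R).
Local Open Scope ereal_scope.
Local Notation U := (`[0%R, 1%R[%classic : set R).
Local Notation lam := ((@wlength R idfun)^*)%mu.
Hypothesis mtheta : measurable_fun [set: T] (theta : T -> measurableTypeR R).
Hypothesis mpsi : measurable_fun [set: R] (psi : measurableTypeR R -> T).
Hypothesis psiK : {in U, cancel psi theta}.
Hypothesis mX0 : measurable (psi @` U).
Hypothesis nuE : forall B, measurable B -> nu B = lebesgue_measure (U `&` psi @^-1` B).

Let lamE (A : set R) : lebesgue_measure A = lam A. Proof. by []. Qed.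

Let mU : measurable (U : set (measurableTypeR R)).
Proof. exact: measurable_itv. Qed.

Let mpre (B : set T) : measurable B ->
  measurable (U `&` psi @^-1` B : set (measurableTypeR R)).
Proof.
by move=> mB; apply: measurableI => //; rewrite -[X in measurable X]setTI; exact: mpsi.
Qed.

(** Covers are transported both ways: by [psi] from [T] to the interval, and by [theta] back, where
    the part of [T] missed by [psi] has to be added and is null. As outer measures agree on all
    sets, Caratheodory measurability can be transported as well. *)
Let nu_ext (E : set T) : (nu^*)%mu E = lam (U `&` psi @^-1` E).
Proof.
apply/eqP; rewrite eq_le; apply/andP; split; last first.
  apply: le_ereal_inf_tmp => _ [/= F [mF EF] <-].
  apply: (@le_trans _ _ (lam (\bigcup_k (U `&` psi @^-1` (F k))))).
    apply: le_outer_measure => x [Ux /EF [k _ Fk]].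
    by exists k.
  apply: (le_trans (outer_measure_sigma_subadditive _ _)).
  apply: lee_nneseries => k _ //.
  by rewrite nuE.
apply: le_ereal_inf_tmp => _ [/= F [mF EF] <-].
have mF' k : measurable (F k : set (measurableTypeR R)) by exact: sub_sigma_algebra.
have mtF k : measurable (theta @^-1` (F k)).
  by rewrite -[X in measurable X]setTI; exact: mtheta.
apply: (@le_trans _ _ ((nu^*)%mu (~` (psi @` U) `|` \bigcup_k (theta @^-1` (F k))))).
  apply: le_outer_measure => y Ey.
  have [[x Ux xy]|] := pselect ((psi @` U) y); last by left.
  right; have [|k _ Fk] := EF x; first by split => //=; rewrite xy.
  by exists k => //=; rewrite -xy psiK // inE.
have X0c : (nu^*)%mu (~` (psi @` U)) = 0.
  have mC : measurable (~` (psi @` U)) by exact: measurableC.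
  transitivity (nu (~` (psi @` U))); first exact: measurable_mu_extE.
  rewrite nuE // (_ : U `&` _ = set0) ?measure0 //.
  by apply/seteqP; split => // x [Ux] /=; apply; exists x.
apply: (le_trans (outer_measureU2 _ _ _)).
rewrite /= X0c add0e.
apply: (le_trans (outer_measure_sigma_subadditive _ _)).
apply: lee_nneseries => k _ //.
have e1 : (nu^*)%mu (theta @^-1` F k) = nu (theta @^-1` F k).
  exact: measurable_mu_extE.
have e2 : lam (F k) = @wlength R idfun (F k) by exact: measurable_mu_extE.
apply: (@le_trans _ _ (nu (theta @^-1` F k))); first by rewrite -e1.
apply: (@le_trans _ _ (lam (F k))); last by rewrite -e2.
rewrite nuE //.
rewrite -lamE; apply: le_measure; rewrite ?inE //; first exact: mpre.
by move=> x [Ux /=]; rewrite psiK // inE.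
Qed.

Let pre_restr (A : set R) : A `<=` U ->
  U `&` psi @^-1` (psi @` U `&` theta @^-1` A) = A.
Proof.
move=> AU; apply/seteqP; split => x.
  by move=> [Ux [_]] /=; rewrite psiK // inE.
move=> Ax; have Ux := AU _ Ax; split => //; split; first by exists x.
by rewrite /= psiK // inE.
Qed.

Lemma nonatomic_lebesgue_completion : nonatomic_lebesgue_space (completion nu).
Proof.
split; first exact: completion_complete.
have lebU : lebesgue_measure U = 1.
  by rewrite lebesgue_measure_itv /= lte01 sube0.
exists (psi @` U), U, theta; split.
- split; first exact: measurable_completion.
  transitivity (nu (psi @` U)); first exact: completionE.
  rewrite nuE // -[RHS]lebU; congr lebesgue_measure.
  by apply/seteqP; split => [x []//|x Ux]; split => //; exists x.
- split => //.
  + by move=> x /=; rewrite !in_itv /= => /andP [-> /ltW ->].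
  + by apply: sub_caratheodory.
- split.
  + by move=> _ [x Ux <-]; rewrite psiK // inE.
  + move=> _ _ /set_mem [x Ux <-] /set_mem [x' Ux' <-].
    by rewrite !psiK ?inE // => ->.
  + move=> x Ux; exists (psi x); first by exists x.
    by rewrite psiK // inE.
have caraN (A : set (completion_type nu)) :
    measurable A = caratheodory_measurable (nu^*)%mu A by [].
have caraL (A : set R) : lebesgue_measurable A = caratheodory_measurable lam A by [].
move=> A AU; pose B := psi @` U `&` theta @^-1` A; split; last first.
  by move=> _; transitivity (lam (U `&` psi @^-1` B)); [exact: nu_ext|rewrite pre_restr].
split.
  rewrite caraN caraL => mA X; rewrite !nu_ext; set W := U `&` psi @^-1` X.
  rewrite (mA W); congr (lam _ + lam _); apply/seteqP; split.
  - by move=> x [[Ux Xx] Ax]; split => //; split => //; rewrite -/(psi @^-1` _);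
      have := Ax; rewrite -{1}(pre_restr AU) => -[].
  - move=> x [Ux [Xx Bx]]; split => //; rewrite -(pre_restr AU).
    by split.
  - move=> x [[Ux Xx] Ax]; split => //; split => // Bx.
    by apply: Ax; rewrite -(pre_restr AU).
  - move=> x [Ux [Xx Bx]]; split => // Ax.
    by apply: Bx; have := Ax; rewrite -{1}(pre_restr AU) => -[].
rewrite caraN caraL => mB; apply: le_caratheodory_measurable => Z.
(* The criterion must be tested on an arbitrary [Z]. Its part in [U] is tested through the image
   under [psi]; the rest is split off because [U] is itself measurable. *)
pose X := psi @` (Z `&` U).
have XE : U `&` psi @^-1` X = Z `&` U.
  apply/seteqP; split => x.
    move=> [Ux [x' [Zx' Ux'] /(congr1 theta)]]; rewrite !psiK ?inE //.
    by move=> <-.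
  by move=> [Zx Ux]; split => //; exists x.
have memX x : U x -> X (psi x) -> Z x.
  by move=> Ux Xx; have [] : (Z `&` U) x by rewrite -XE.
have Xmem x : U x -> Z x -> X (psi x) by move=> Ux Zx; exists x.
have memB x : U x -> B (psi x) -> A x.
  by move=> Ux Bx; rewrite -(pre_restr AU).
have Bmem x : A x -> B (psi x) by rewrite -{1}(pre_restr AU) => -[].
have := mB X; rewrite !nu_ext.
have -> : U `&` psi @^-1` (X `&` B) = Z `&` A.
  apply/seteqP; split => x; first by move=> [Ux [/memX Zx /memB Ax]]; split; auto.
  by move=> [Zx Ax]; have Ux := AU _ Ax; split => //; split; auto.
have -> : U `&` psi @^-1` (X `&` ~` B) = Z `&` U `&` ~` A.
  apply/seteqP; split => x.
    move=> [Ux [Xx Bx]]; split; first by split => //; exact: memX.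
    by move=> Ax; apply: Bx; exact: Bmem.
  move=> [[Zx Ux] Ax]; split => //; split; first exact: Xmem.
  by move=> Bx; apply: Ax; exact: memB.
rewrite XE => ZU.
have cU : (lam.-cara.-measurable (U : set R)) by exact: sub_caratheodory.
apply: (@le_trans _ _ (lam (Z `&` U) + lam (Z `&` ~` U))); last by rewrite -(cU Z).
rewrite ZU -addeA leeD2l //.
apply: le_trans (outer_measureU2 _ _ _).
apply: le_outer_measure => x [Zx Ax].
have [Ux|nUx] := pselect (U x); [by left|by right].
Qed.

End LebesgueCompletion.

Definition coord_events : set (set (nat -> bool)) :=
  [set [set y : nat -> bool | y n] | n in [set: nat]].

Definition bits := g_sigma_algebraType coord_events.

Lemma measurable_bit n : measurable ([set y | y n] : set bits).
Proof. by apply: sub_sigma_algebra; exists n. Qed.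

Lemma measurable_prefix n (P : seq bool -> Prop) :
  measurable ([set y | P (mkseq y n)] : set bits).
Proof.
have H (s : seq bool) m : measurable ([set y | mkseq y m = s] : set bits).
  elim/last_ind: s m => [|s b IH] [|m].
  - rewrite (_ : mkset _ = setT) //; exact/seteqP.
  - rewrite (_ : mkset _ = set0) //.
    by apply/seteqP; split => // y /=; rewrite mkseqS => /(congr1 size); rewrite size_rcons.
  - rewrite (_ : mkset _ = set0) //.
    by apply/seteqP; split => // y /= /(congr1 size); rewrite size_rcons.
  rewrite (_ : mkset _ = [set y : bits | mkseq y m = s] `&` [set y | y m = b]).
    apply: measurableI; first exact: IH.
    case: b; first exact: measurable_bit.
    rewrite (_ : mkset _ = ~` [set y : bits | y m]); last first.
      by apply/seteqP; split => y /= => [->//|/negP/negbTE].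
    by apply: measurableC; exact: measurable_bit.
  apply/seteqP; split => y /=; rewrite mkseqS; first by move=> /rcons_inj [-> ->].
  by move=> [-> ->].
rewrite (_ : mkset _ = \bigcup_(s in [set: seq bool]) ([set y : bits | mkseq y n = s] `&` [set y | P s])).
  apply: countable_bigcupT_measurable => // s; have [Ps|nPs] := pselect (P s).
    rewrite (_ : [set y : bits | P s] = setT) ?setIT; first exact: H.
    by apply/seteqP; split.
  rewrite (_ : [set y : bits | P s] = set0) ?setI0 //.
  by apply/seteqP; split.
by apply/seteqP; split => y /= => [Py|[s _ [<-]]] //; exists (mkseq y n).
Qed.

(** * Coding bit streams by points of the unit interval *)

Section Coding.
Variables (R : realType) (p : seq bool -> R).
Hypotheses (p0 : p [::] = 1) (p_ge0 : forall s, 0 <= p s).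
Hypothesis pS : forall s, p s = p (rcons s false) + p (rcons s true).
Hypothesis p_cvg : forall y : nat -> bool, p (mkseq y n) @[n --> \oo] --> (0 : R).
Implicit Types (y : nat -> bool) (x : R).

(* The streams with prefix [mkseq y n] are coded by the points of
   [[left_end y n, right_end y n)], an interval of length [p (mkseq y n)]. *)
Let left_end y n : R :=
  \sum_(i < n) (if y i then p (rcons (mkseq y i) false) else 0).
Let right_end y n : R := left_end y n + p (mkseq y n).

Let eq_prefix y z n m : (n <= m)%N -> mkseq y m = mkseq z m -> mkseq y n = mkseq z n.
Proof.
move=> nm /(congr1 (take n)); rewrite /mkseq -!map_take take_iota.
by rewrite (minn_idPl nm).
Qed.

Let eq_left y z n : mkseq y n = mkseq z n -> left_end y n = left_end z n.
Proof.
move=> yz; apply: eq_bigr => i _.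
have := eq_prefix (ltn_ord i) yz; rewrite !mkseqS => /rcons_inj [-> ->].
by [].
Qed.

Let eq_right y z n : mkseq y n = mkseq z n -> right_end y n = right_end z n.
Proof. by move=> yz; rewrite /right_end (eq_left yz) yz. Qed.

Let mkseq_nth s : mkseq (nth false s) (size s) = s.
Proof. exact: mkseq_nth. Qed.

Let leftS y n : left_end y n.+1 =
  left_end y n + (if y n then p (rcons (mkseq y n) false) else 0).
Proof. by rewrite /left_end big_ord_recr. Qed.

Let rightS y n : right_end y n.+1 =
  if y n then right_end y n else left_end y n + p (rcons (mkseq y n) false).
Proof.
rewrite /right_end leftS mkseqS; case: (y n); last by rewrite addr0.
by rewrite -addrA -pS.
Qed.

Let left_le y n : left_end y n <= left_end y n.+1.
Proof. by rewrite leftS lerDl; case: (y n). Qed.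

Let right_ge y n : right_end y n.+1 <= right_end y n.
Proof.
rewrite rightS; case: (y n) => //.
by rewrite /right_end lerD2l [leRHS]pS lerDl.
Qed.

Let left_homo y n m : (n <= m)%N -> left_end y n <= left_end y m.
Proof. by move=> /subnK <-; elim: (m - n)%N => // k IH; exact: le_trans IH (left_le _ _). Qed.

Let right_homo y n m : (n <= m)%N -> right_end y m <= right_end y n.
Proof. by move=> /subnK <-; elim: (m - n)%N => // k IH; exact: le_trans (right_ge _ _) IH. Qed.

Let left_le_right y n : left_end y n <= right_end y n.
Proof. by rewrite lerDl. Qed.

Let left_right y n m : left_end y n <= right_end y m.
Proof.
have [nm|/ltnW mn] := leqP n m.
  by apply: le_trans (left_le_right y m); exact: left_homo.
by apply: le_trans (left_le_right y n) _; exact: right_homo.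
Qed.

(** The point that splits the interval of [s] between its two extensions, [false] to the left; the
    next digit of [x] is the outcome of comparing [x] with it. *)
Let cut (s : seq bool) : R :=
  left_end (nth false s) (size s) + p (rcons s false).

Let cutE y n : cut (mkseq y n) = left_end y n + p (rcons (mkseq y n) false).
Proof.
rewrite /cut size_mkseq; congr (_ + _); apply: eq_left.
by rewrite -{2}(mkseq_nth (mkseq y n)) size_mkseq.
Qed.

Let prefix_of x := fix prefix_of n : seq bool :=
  if n is n'.+1 then rcons (prefix_of n') (cut (prefix_of n') <= x) else [::].

Let psi x : bits := fun n => cut (prefix_of x n) <= x.

Let prefix_ofE x n : prefix_of x n = mkseq (psi x) n.
Proof. by elim: n => //= n IH; rewrite mkseqS -IH. Qed.

Let psiE x n : psi x n = (left_end (psi x) n + p (rcons (mkseq (psi x) n) false) <= x).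
Proof. by rewrite /psi prefix_ofE cutE. Qed.

Let psi_in x n : 0 <= x < 1 -> left_end (psi x) n <= x < right_end (psi x) n.
Proof.
move=> x01; elim: n => [|n /andP [lx xr]].
  by rewrite /right_end /left_end big_ord0 add0r /= p0.
rewrite rightS leftS psiE; case: ifPn => [-> //|]; rewrite -ltNge => ->.
by rewrite addr0 lx.
Qed.

Let in_psi y x n : left_end y n <= x < right_end y n -> mkseq (psi x) n = mkseq y n.
Proof.
elim: n => // n IH /andP [lx xr].
have e : mkseq (psi x) n = mkseq y n.
  by apply: IH; rewrite (le_trans (left_le _ _) lx) (lt_le_trans xr (right_ge _ _)).
rewrite !mkseqS e; congr rcons; rewrite psiE e (eq_left e).
move: lx xr; rewrite leftS rightS; case: (y n) => [-> //|].
by rewrite ltNge => _ /negbTE.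
Qed.

Let in_unit y x n : left_end y n <= x < right_end y n -> 0 <= x < 1.
Proof.
move=> /andP [lx xr]; apply/andP; split.
  by apply: le_trans lx; apply: sumr_ge0 => i _; case: ifP.
apply: (lt_le_trans xr); rewrite (le_trans (right_homo _ (leq0n n))) //.
by rewrite /right_end /left_end big_ord0 add0r /= p0.
Qed.

Let theta (y : bits) : R := sup (range (left_end y)).

Let left_theta y n : left_end y n <= theta y.
Proof.
apply: ub_le_sup; last by exists n.
by exists (right_end y 0) => _ [k _ <-].
Qed.

Let theta_right y n : theta y <= right_end y n.
Proof. by apply: ge_sup; [exists (left_end y 0), 0%N|move=> _ [k _ <-]]. Qed.

Let small y (e : R) : 0 < e -> exists n, p (mkseq y n) < e.
Proof.
move=> e0; have /cvgrPdist_lt /(_ e e0) [N _ H] := p_cvg y.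
by exists N; have := H N (leqnn N); rewrite /= sub0r normrN ger0_norm.
Qed.

Let theta_unique y x : (forall n, left_end y n <= x <= right_end y n) -> theta y = x.
Proof.
move=> H; apply/eqP; rewrite eq_le; apply/andP; split.
  apply: ge_sup; first by exists (left_end y 0), 0%N.
  by move=> _ [n _ <-]; case/andP: (H n).
apply/ler_addgt0Pr => e /(small y) [n pn].
case/andP: (H n) => _ /le_trans; apply.
by rewrite /right_end lerD // ltW.
Qed.

Let U : set R := `[0, 1[%classic.

Let UE x : U x <-> 0 <= x < 1.
Proof. by rewrite /U /= in_itv. Qed.

Let psiK : {in U, cancel psi theta}.
Proof.
move=> x /set_mem /UE x01; apply: theta_unique => n.
by have /andP [-> /ltW] := psi_in n x01.
Qed.

(** The intervals are open on the right, so a stream is missed exactly when its right ends are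
    constant from some point on: [theta] then yields that excluded end. The condition involves
    prefixes only, whence the measurability of the image. *)
Let rangeE : psi @` U =
  \bigcap_n \bigcup_k [set y : bits | right_end y k < right_end y n].
Proof.
apply/seteqP; split => [_ [x /UE x01 <-] n _|y H].
  have /andP [_ xr] := psi_in n x01.
  have [k pk] : exists k, p (mkseq (psi x) k) < right_end (psi x) n - x.
    by apply: small; rewrite subr_gt0.
  exists k => //=; rewrite /right_end -/(right_end _ _).
  have /andP [lx _] := psi_in k x01.
  by rewrite (le_lt_trans (lerD lx (lexx _))) // -ltrBrDl.
have lr n : left_end y n <= theta y < right_end y n.
  rewrite left_theta /=; have [k _ /=] := H n I.
  exact: le_lt_trans.
exists (theta y); first by apply/UE; exact: (in_unit (lr 0%N)).
apply/funext => n; have := in_psi (lr n.+1).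
by rewrite !mkseqS => /rcons_inj [].
Qed.

Let m_range : measurable (psi @` U : set bits).
Proof.
rewrite rangeE; apply: bigcapT_measurable => n; apply: bigcupT_measurable => k.
pose z (s : seq bool) := nth false s.
rewrite (_ : mkset _ = [set y : bits | right_end (z (mkseq y (maxn k n))) k <
    right_end (z (mkseq y (maxn k n))) n]).
  exact: (measurable_prefix (maxn k n) (fun s => right_end (z s) k < right_end (z s) n)).
have e (y : bits) m : (m <= maxn k n)%N -> right_end (z (mkseq y (maxn k n))) m = right_end y m.
  move=> mm; apply: eq_right; apply: (eq_prefix mm).
  by rewrite -[RHS](mkseq_nth (mkseq y _)) size_mkseq.
by apply/seteqP; split => y /=; rewrite !e ?leq_maxl ?leq_maxr.
Qed.

Let m_theta : measurable_fun [set: bits] (theta : bits -> measurableTypeR R).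
Proof.
apply: (measurability _ (measurable_realfun.RGenOInfty.measurableE R)) => _ [_ [a ->] <-].
rewrite setTI (_ : _ @^-1` _ = \bigcup_n [set y : bits | a < left_end y n]).
  apply: bigcupT_measurable => n.
  rewrite (_ : mkset _ = [set y : bits | a < left_end (nth false (mkseq y n)) n]).
    exact: (measurable_prefix n (fun s => a < left_end (nth false s) n)).
  have e (y : bits) : left_end (nth false (mkseq y n)) n = left_end y n.
    by apply: eq_left; rewrite -[RHS](mkseq_nth (mkseq y _)) size_mkseq.
  by apply/seteqP; split => y /=; rewrite e.
apply/seteqP; split => y /=; rewrite in_itv /= andbT.
  move=> /sup_gt [|_ [n _ <-] an]; first by exists (left_end y 0), 0%N.
  by exists n.
by move=> [n _ /= an]; apply: lt_le_trans an (left_theta y n).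
Qed.

Let m_prefix_of n s : measurable ([set x | prefix_of x n = s] : set (measurableTypeR R)).
Proof.
elim/last_ind: s n => [|s b IH] [|n].
- rewrite (_ : mkset _ = setT) //; exact/seteqP.
- rewrite (_ : mkset _ = set0) //.
  by apply/seteqP; split => // y /= /(congr1 size); rewrite size_rcons.
- rewrite (_ : mkset _ = set0) //.
  by apply/seteqP; split => // y /= /(congr1 size); rewrite size_rcons.
rewrite (_ : mkset _ = [set x | prefix_of x n = s] `&` [set x | (cut s <= x) = b]).
  apply: measurableI; first exact: IH.
  case: b.
    rewrite (_ : mkset _ = `[cut s, +oo[%classic); first exact: measurable_itv.
    by apply/seteqP; split => x /=; rewrite in_itv /= andbT.
  rewrite (_ : mkset _ = `]-oo, (cut s)[%classic); first exact: measurable_itv.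
  apply/seteqP; split => x /=; rewrite in_itv /= ltNge.
    by move=> ->.
  by move/negbTE.
apply/seteqP; split => x /=; first by move=> /rcons_inj [-> ->].
by move=> [-> ->].
Qed.

Let m_psi : measurable_fun [set: R] (psi : measurableTypeR R -> bits).
Proof.
have bitsE : (measurable : set (set bits)) = <<s coord_events >> by [].
apply: (measurability _ bitsE) => _ [_ [n _ <-] <-]; rewrite setTI.
rewrite (_ : _ @^-1` _ = \bigcup_(s in [set: seq bool])
   [set x | prefix_of x n.+1 = rcons s true]).
  by apply: countable_bigcupT_measurable => // s; exact: m_prefix_of.
apply/seteqP; split => x /=; first by move=> H; exists (prefix_of x n) => //=; rewrite -H.
by move=> [s _ /= /rcons_inj []].
Qed.

Let nu (B : set bits) : \bar R := lebesgue_measure (U `&` psi @^-1` B).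

Let m_pre B : measurable B -> measurable (U `&` psi @^-1` B : set (measurableTypeR R)).
Proof.
move=> mB; apply: measurableI; first exact: measurable_itv.
by rewrite -[X in measurable X]setTI; exact: m_psi.
Qed.

Let nu0 : nu set0 = 0%E.
Proof. by rewrite /nu preimage_set0 setI0 measure0. Qed.

Let nu_ge0 B : (0 <= nu B)%E.
Proof. exact: measure_ge0. Qed.

Let nu_sigma : semi_sigma_additive nu.
Proof.
move=> F mF tF mUF; rewrite /nu preimage_bigcup setI_bigcupr.
apply: measure_semi_sigma_additive.
- by move=> n; exact: m_pre.
- apply/trivIsetP => i j _ _ ij; rewrite setIACA setIid -preimage_setI.
  by move/trivIsetP : tF => /(_ _ _ _ _ ij) ->//; rewrite preimage_set0 setI0.
- by rewrite -setI_bigcupr -preimage_bigcup; exact: m_pre.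
Qed.

HB.instance Definition _ := isMeasure.Build _ _ _ nu nu0 nu_ge0 nu_sigma.

Let nuT : nu setT = 1%E.
Proof. by rewrite /nu preimage_setT setIT lebesgue_measure_itv /= lte01 sube0. Qed.

HB.instance Definition _ := Measure_isProbability.Build _ _ _ nu nuT.

(** The measure is the law of the digits of a uniform point, so it comes together with its
    isomorphism to the interval. The hypothesis [p_cvg], absence of atoms, shrinks the intervals to
    points and makes [theta] invert [psi]. *)
Lemma bits_probability : exists nu : probability bits R,
  (forall s, nu [set y | mkseq y (size s) = s] = (p s)%:E) /\
  nonatomic_lebesgue_space (completion nu).
Proof.
exists nu; split; last exact: (nonatomic_lebesgue_completion m_theta m_psi psiK m_range).
move=> s; pose y := nth false s; pose n := size s.
have ys : mkseq y n = s by exact: mkseq_nth.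
transitivity (lebesgue_measure (`[left_end y n, right_end y n[%classic : set R)).
  congr lebesgue_measure; apply/seteqP; split => x /=; rewrite in_itv /=.
    move=> [/UE x01 xs]; rewrite -(eq_right (y := psi x)) ?ys //.
    by rewrite -(eq_left (y := psi x)) ?ys //; exact: psi_in.
  move=> H; split; first by apply/UE; exact: in_unit H.
  by rewrite -/n -ys; exact: in_psi.
rewrite lebesgue_measure_itv /= lte_fin /right_end ltrDl ys.
case: ltP => [_|ps]; first by rewrite -EFinD addrAC subrr add0r.
by congr EFin; apply/eqP; rewrite eq_le p_ge0 ps.
Qed.

End Coding.

(** * The process with given void probabilities *)

Section CylinderMonotone.
Variables (R : realType) (Q : eqType) (v : seq Q -> R).
Hypothesis v_ext : forall O O', O =i O' -> v O = v O'.

Lemma cylw_ext O O' Z : O =i O' -> cylw v O Z = cylw v O' Z.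
Proof.
elim: Z O O' => [|z Z IH] O O' OO /=; first exact: v_ext.
by congr (_ - _); apply: IH => // x; rewrite !inE OO.
Qed.

Lemma cylw_eq0 O Z z : z \in O -> z \in Z -> cylw v O Z = 0.
Proof.
elim: Z O => // z' Z IH O zO; rewrite inE => /predU1P [<-|zZ] /=.
  rewrite [X in _ - X](@cylw_ext _ O) ?subrr // => x.
  by rewrite inE; case: eqP => // ->.
by rewrite !IH ?subrr // inE zO orbT.
Qed.

Lemma cylw_insert O B z Z :
  cylw v O (B ++ z :: Z) = cylw v O (B ++ Z) - cylw v (z :: O) (B ++ Z).
Proof.
elim: B O => //= b B IH O; rewrite !IH.
rewrite (@cylw_ext (b :: z :: O) (z :: b :: O)); first by ring.
by move=> x; rewrite !inE orbCA.
Qed.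

Hypothesis cylw_ge0 : forall O Z, 0 <= cylw v O Z.

(** Dropping one constraint changes the weight by another cylinder weight, which is nonnegative. *)
Lemma cylw_filter (P : pred Q) O Z :
  cylw v O Z <= cylw v [seq x <- O | P x] [seq x <- Z | P x].
Proof.
apply: (@le_trans _ _ (cylw v O [seq x <- Z | P x])).
  suff H B : cylw v O (B ++ Z) <= cylw v O (B ++ [seq x <- Z | P x]) by exact: (H [::]).
  elim: Z B => //= z Z IH B; case: ifP => _; first by rewrite -!cat_rcons.
  by apply: le_trans (IH B); rewrite cylw_insert gerBl.
move: [seq x <- Z | P x] => {}Z.
suff H A : cylw v (A ++ O) Z <= cylw v (A ++ [seq x <- O | P x]) Z by exact: (H [::]).
elim: O A => //= o O IH A; case: ifP => _; first by rewrite -!cat_rcons.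
apply: le_trans (IH A); rewrite (@cylw_ext _ (o :: A ++ O)); last first.
  by move=> x; rewrite !(inE, mem_cat) orbCA.
by have := cylw_ge0 (A ++ O) (o :: Z); rewrite /= subr_ge0.
Qed.

Lemma cylw_indep (s : seq Q) (c : R) O Z :
  (forall O', uniq O' -> {subset O' <= s} -> v O' = c ^+ size O') ->
  uniq (O ++ Z) -> {subset O ++ Z <= s} ->
  cylw v O Z = c ^+ size O * (1 - c) ^+ size Z.
Proof.
move=> vs; elim: Z O => [|z Z IH] O /=.
  by rewrite cats0 mulr1 => uO Os; exact: vs.
have pz := permEl (perm_catCA O [:: z] Z); rewrite /= in pz.
rewrite (perm_uniq pz) /= => /andP [zO uO] OZs.
have zs : z \in s by apply: OZs; rewrite (perm_mem pz) mem_head.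
have OZs' : {subset O ++ Z <= s}.
  by move=> x xO; apply: OZs; rewrite (perm_mem pz) inE xO orbT.
rewrite !IH //=; last 2 first.
- by rewrite zO.
- by move=> x; rewrite inE => /predU1P [->|/OZs'].
by rewrite !exprS; ring.
Qed.

End CylinderMonotone.

Section Coordinates.
Variables (Q : eqType) (e : nat -> Q).

(** The indices run backwards so that [rcons] on the prefix becomes a cons here, which is the way
    [cylw] recurses. *)
Definition ones (s : seq bool) : seq Q :=
  [seq e i | i <- rev (iota 0 (size s)) & nth false s i].

Definition zeros (s : seq bool) : seq Q :=
  [seq e i | i <- rev (iota 0 (size s)) & ~~ nth false s i].

Let iota_rcons (s : seq bool) b (P : bool -> bool) :
  [seq i <- rev (iota 0 (size (rcons s b))) | P (nth false (rcons s b) i)] =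
  (if P b then [:: size s] else [::]) ++ [seq i <- rev (iota 0 (size s)) | P (nth false s i)].
Proof.
rewrite size_rcons -addn1 iotaD rev_cat filter_cat /= nth_rcons ltnn eqxx.
congr (_ ++ _); apply: eq_in_filter => i; rewrite mem_rev mem_iota /= add0n => is_.
by rewrite nth_rcons is_.
Qed.

Lemma ones_rcons s b : ones (rcons s b) = if b then e (size s) :: ones s else ones s.
Proof. by rewrite /ones (iota_rcons s b id); case: b. Qed.

Lemma zeros_rcons s b : zeros (rcons s b) = if b then zeros s else e (size s) :: zeros s.
Proof. by rewrite /zeros (iota_rcons s b negb); case: b. Qed.

Lemma mem_ones s i : injective e -> (e i \in ones s) = nth false s i.
Proof.
move=> inj; rewrite mem_map // mem_filter mem_rev mem_iota /= add0n andbC.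
by case: ltnP => // si; rewrite nth_default.
Qed.

Lemma mem_zeros s i : injective e -> (e i \in zeros s) = (i < size s)%N && ~~ nth false s i.
Proof. by move=> inj; rewrite mem_map // mem_filter mem_rev mem_iota /= add0n andbC. Qed.

Lemma uniq_ones_zeros s : injective e -> uniq (ones s ++ zeros s).
Proof.
move=> inj; rewrite cat_uniq !map_inj_uniq ?filter_uniq ?rev_uniq ?iota_uniq //= andbT.
apply/hasPn => _ /mapP [i + ->]; rewrite mem_filter /= => /andP [ni _].
by rewrite mem_ones.
Qed.

End Coordinates.

(** Induction on measurable sets: Dynkin's principle, with closure under outer approximation added
    to reach the sets of the completion. In this form nothing that follows depends on the coding by
    bits. *)
Definition generating (R : realType) (G : zmodType) (S : system R G) (I : Type)
    (E : I -> set (sys_space S)) : Prop :=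
  forall P : set (set (sys_space S)),
  [/\ forall i, P (E i),
      forall A, measurable A -> P A -> P (~` A),
      forall F : nat -> set (sys_space S), (forall n, measurable (F n) /\ P (F n)) ->
        trivIset setT F -> P (\bigcup_n F n) &
      forall A, measurable A -> (forall eps : R, 0 < eps -> exists B,
        [/\ measurable B, P B, A `<=` B & (sys_mu S (B `\` A) <= eps%:E)%E]) -> P A] ->
  forall A, measurable A -> P A.

Section VoidProcess.
Variables (R : realType) (G Q : zmodType) (f : {additive G -> Q}).
Variables (e : nat -> Q) (eI : Q -> nat).
Hypotheses (eK : cancel e eI) (eIK : cancel eI e).
Variable v : seq Q -> R.
Hypothesis v_ext : forall O O', O =i O' -> v O = v O'.
Hypothesis v_nil : v [::] = 1.
Hypothesis v_ge0 : forall O Z, 0 <= cylw v O Z.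
Hypothesis v_shift : forall q F, v [seq x + q | x <- F] = v F.
Variable c : R.
Hypotheses (c_gt0 : 0 < c) (c_le : c <= 1 - c).
Hypothesis v_indep : forall k, exists s : seq Q, [/\ uniq s, size s = k &
  forall O, uniq O -> {subset O <= s} -> v O = c ^+ size O].

Let e_inj : injective e := can_inj eK.

Let p (s : seq bool) : R := cylw v (ones e s) (zeros e s).

Let p0 : p [::] = 1. Proof. exact: v_nil. Qed.

Let p_ge0 s : 0 <= p s. Proof. exact: v_ge0. Qed.

Let pS s : p s = p (rcons s false) + p (rcons s true).
Proof. by rewrite /p !ones_rcons !zeros_rcons /= subrK. Qed.

(** Absence of atoms: forgetting all sites outside [k] independent ones bounds the probability of a
    long prefix by a product of [k] factors [c] or [1 - c], hence by [(1 - c) ^+ k]. *)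
Let p_cvg (y : nat -> bool) : p (mkseq y n) @[n --> \oo] --> (0 : R).
Proof.
apply/cvgrPdist_lt => eps eps0.
have c1 : 0 <= 1 - c by apply: le_trans c_le; exact: ltW.
have c01 : `|1 - c| < 1 by rewrite ger0_norm // ltrBlDr ltrDl.
have /cvgrPdist_lt /(_ _ eps0) [k _ /(_ k (leqnn k)) /=] := cvg_expr c01.
rewrite sub0r normrN ger0_norm ?exprn_ge0 // => ck.
have [s [us ss sv]] := v_indep k.
exists (\max_(x <- s) eI x).+1 => // n /= Nn.
rewrite sub0r normrN ger0_norm //; apply: le_lt_trans ck.
rewrite /p; apply: le_trans (cylw_filter v_ext v_ge0 (mem s) _ _) _.
set O := [seq x <- _ | _]; set Z := [seq x <- _ | _].
have uOZ : uniq (O ++ Z) by rewrite -filter_cat filter_uniq // uniq_ones_zeros.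
have OZs x : (x \in O ++ Z) = (x \in s).
  rewrite -filter_cat mem_filter /= mem_cat andbC.
  case: (boolP (x \in s)) => [xs|]; last by rewrite andbF.
  rewrite andbT -[x]eIK mem_ones // mem_zeros // size_mkseq.
  have -> : (eI x < n)%N.
    by apply: leq_ltn_trans Nn; rewrite leq_bigmax_seq.
  by rewrite /= orbN.
rewrite (cylw_indep sv) // => [|x]; last by rewrite OZs.
have -> : k = (size O + size Z)%N.
  by rewrite -ss -size_cat; apply/perm_size/uniq_perm => // x; rewrite OZs.
rewrite exprD ler_wpM2r ?exprn_ge0 //.
by apply: lerXn2r => //; rewrite nnegrE ltW.
Qed.

Let ev (F : seq Q) : set bits := [set y | all (fun q => y (eI q)) F].

Let ev_cat F F' : ev F `&` ev F' = ev (F ++ F').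
Proof. by apply/seteqP; split => y; rewrite /ev /= all_cat => /andP. Qed.

Let ev_nil : ev [::] = setT. Proof. exact/seteqP. Qed.

Let ev_cons q F : ev (q :: F) = [set y : bits | y (eI q)] `&` ev F.
Proof. by apply/seteqP; split => y; rewrite /ev /= => /andP. Qed.

Let m_ev F : measurable (ev F).
Proof.
elim: F => [|q F IH]; first by rewrite ev_nil.
by rewrite ev_cons; apply: measurableI => //; exact: measurable_bit.
Qed.

Let bits_ind (P : set (set bits)) :
  (forall F, P (ev F)) -> (forall A, measurable A -> P A -> P (~` A)) ->
  (forall F : nat -> set bits, (forall n, measurable (F n) /\ P (F n)) ->
     trivIset setT F -> P (\bigcup_n F n)) ->
  forall A, measurable A -> P A.
Proof.
move=> Pev PC PU A mA; pose gen : set (set bits) := range ev.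
have genI : setI_closed gen.
  by move=> _ _ [F _ <-] [F' _ <-]; rewrite ev_cat; exists (F ++ F').
suff : <<s gen >> `<=` [set A : set bits | measurable A /\ P A].
  move=> H; have [] // : [set A : set bits | measurable A /\ P A] A.
  apply: H; apply: sub_sigma_algebra2 mA => _ [n _ <-].
  exists [:: e n] => //.
  by apply/seteqP; split => y; rewrite /ev /= eK andbT.
rewrite -(setI_closed_g_dynkin_g_sigma_algebra genI).
apply: smallest_sub; last by move=> _ [F _ <-]; split.
split.
- by rewrite -ev_nil; split.
- by move=> B [mB PB]; split; [exact: measurableC|exact: PC].
- move=> F tF PF; split; last exact: PU.
  by apply: bigcupT_measurable => n; have [] := PF n.
Qed.

Let act (g : G) (y : bits) : bits := fun n => y (eI (e n + f g)).

Let act0 y : act 0 y = y.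
Proof. by apply/funext => n; rewrite /act raddf0 addr0 eK. Qed.

Let actD g h y : act (g + h) y = act g (act h y).
Proof. by apply/funext => n; rewrite /act raddfD eIK addrA. Qed.

Let act_ev g F : act g @^-1` ev F = ev [seq q + f g | q <- F].
Proof.
apply/seteqP; split => y; rewrite /ev /act /= all_map;
  by move=> /allP H; apply/allP => q /H /=; rewrite eIK.
Qed.

Let m_act g : measurable_fun [set: bits] (act g).
Proof.
have bitsE : (measurable : set (set bits)) = <<s coord_events >> by [].
apply: (measurability _ bitsE) => _ [_ [n _ <-] <-]; rewrite setTI.
by rewrite /act; exact: measurable_bit.
Qed.

Section Law.
Variable nu : probability bits R.
Hypothesis nu_prefix : forall s, nu [set y | mkseq y (size s) = s] = (p s)%:E.

Let m_pre s : measurable ([set y | mkseq y (size s) = s] : set bits).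
Proof. exact: (measurable_prefix _ (fun s' => s' = s)). Qed.

Let nu_ev F : nu (ev F) = (v F)%:E.
Proof.
pose N := (\max_(q <- F) eI q).+1.
have FN q : q \in F -> (eI q < N)%N by move=> qF; rewrite ltnS leq_bigmax_seq.
(* Induction on the number [k] of coordinates still to be revealed; summing over the next bit undoes
   one step of inclusion-exclusion. At the end the prefix decides [ev F]: either [F] adds nothing to
   its ones, or some site is required to be both 0 and 1 and the weight vanishes. *)
have key k s : (size s + k)%N = N ->
    nu ([set y | mkseq y (size s) = s] `&` ev F) = (cylw v (ones e s ++ F) (zeros e s))%:E.
  elim: k s => [|k IH] s sN.
    rewrite addn0 in sN.
    have preF y q : mkseq y (size s) = s -> q \in F -> y (eI q) = nth false s (eI q).
      by move=> <- qF; rewrite nth_mkseq // sN FN.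
    have [sF|] := boolP (all (fun q => nth false s (eI q)) F).
      rewrite (_ : _ `&` _ = [set y | mkseq y (size s) = s]); last first.
        apply/setIidPl => y /= ys; apply/allP => q qF /=.
        by rewrite (preF _ _ ys qF) (allP sF).
      rewrite nu_prefix; congr EFin; apply: cylw_ext => //= q.
      rewrite mem_cat orbC; case: (boolP (q \in F)) => //= qF.
      by rewrite -[q]eIK mem_ones //; have := allP sF _ qF.
    move=> /allPn [q qF nq].
    rewrite (_ : _ `&` _ = set0) ?measure0; last first.
      apply/seteqP; split => // y /= [ys /allP /(_ q qF) /=].
      by rewrite (preF _ _ ys qF) (negbTE nq).
    rewrite (@cylw_eq0 _ _ _ v_ext _ _ q) ?mem_cat ?qF ?orbT //.
    by rewrite -[q]eIK mem_zeros // sN FN.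
  have e1 b : nu ([set y | mkseq y (size s).+1 = rcons s b] `&` ev F) =
      (cylw v (ones e (rcons s b) ++ F) (zeros e (rcons s b)))%:E.
    by rewrite -IH size_rcons // addSnnS.
  set X := _ `&` _; pose Y b : set bits := [set y : bits | mkseq y (size s).+1 = rcons s b] `&` ev F.
  have mY b : measurable (Y b).
    by apply: measurableI => //; have := m_pre (rcons s b); rewrite size_rcons.
  have -> : X = Y true `|` Y false.
    apply/seteqP; split => y /=.
      move=> [ys Fy]; rewrite /Y /= !mkseqS ys.
      by case: (y (size s)); [left|right].
    by rewrite /Y /= !mkseqS => -[] [/rcons_inj [ys _] Fy]; split.
  have -> : nu (Y true `|` Y false) = (nu (Y true) + nu (Y false))%E.
    apply: measureU => //.
    apply/seteqP; split => // y [[yt _] [yf _]].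
    by have := etrans (esym yt) yf; move=> /rcons_inj [].
  by rewrite !e1 -EFinD !ones_rcons !zeros_rcons /= addrC subrK.
have := key N [::] (add0n _); rewrite (_ : [set y | _] = setT) ?setTI //.
by apply/seteqP.
Qed.

Let nu_act g A : measurable A -> nu (act g @^-1` A) = nu A.
Proof.
have m_pact B : measurable B -> measurable (act g @^-1` B).
  by move=> mB; rewrite -[X in measurable X]setTI; exact: m_act.
move: A; apply: (@bits_ind (fun A => nu (act g @^-1` A) = nu A)) => [F|B mB H|F mF tF].
- by rewrite act_ev !nu_ev v_shift.
- rewrite preimage_setC !probability_setC ?H //; exact: m_pact.
- rewrite preimage_bigcup !measure_bigcup //.
  + by apply: eq_eseriesr => n _; exact: (mF n).2.
  + by move=> n _; have [] := mF n.
  + by move=> n _; apply: m_pact; have [] := mF n.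
  + apply/trivIsetP => i j _ _ ij; rewrite -preimage_setI.
    by move/trivIsetP : tF => /(_ _ _ _ _ ij) ->//; rewrite preimage_set0.
Qed.

Let ext_act g E : (nu^*)%mu (act g @^-1` E) = (nu^*)%mu E.
Proof.
have H h B : ((nu^*)%mu (act h @^-1` B) <= (nu^*)%mu B)%E.
  apply: le_ereal_inf_tmp => _ [/= F [mF BF] <-].
  apply: ereal_inf_lbound; exists (fun k => act h @^-1` F k).
    split; first by move=> k; rewrite -[X in measurable X]setTI; exact: m_act.
    by rewrite -preimage_bigcup; exact: preimage_subset.
  by apply: eq_eseriesr => k _; exact: nu_act.
apply/eqP; rewrite eq_le H /=.
have := H (- g) (act g @^-1` E); rewrite -comp_preimage.
rewrite (_ : act g \o act (- g) = id) //.
by apply/funext => y /=; rewrite -actD subrr act0.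
Qed.

Let cara_act g (A : set (completion_type nu)) : measurable A -> measurable (act g @^-1` A : set (completion_type nu)).
Proof.
have caraN (B : set (completion_type nu)) :
  measurable B = caratheodory_measurable (nu^*)%mu B by [].
rewrite !caraN => mA X.
have XE : act g @^-1` (act (- g) @^-1` X) = X.
  by apply/seteqP; split => y /=; rewrite -actD addNr act0.
rewrite -{1}XE ext_act (mA (act (- g) @^-1` X)) -(ext_act g) -[X in (_ + X)%E](ext_act g).
by rewrite !preimage_setI XE preimage_setC.
Qed.

Hypothesis nu_leb : nonatomic_lebesgue_space (completion nu).

Let m_act_completion g : measurable_fun [set: completion_type nu] (act g : completion_type nu -> completion_type nu).
Proof. by move=> _ A mA; rewrite setTI; exact: cara_act. Qed.

Let completion_act g (A : set (completion_type nu)) : measurable A ->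
  completion nu (act g @^-1` A) = completion nu A.
Proof. by move=> _; exact: ext_act. Qed.

Definition void_system : system R G :=
  @System R G _ (completion_type nu) (completion nu) act nu_leb act0 actD
    m_act_completion completion_act.

Lemma void_systemP : exists E : seq Q -> set (sys_space void_system),
  [/\ forall F, measurable (E F) /\ sys_mu void_system (E F) = (v F)%:E,
      forall F F', E F `&` E F' = E (F ++ F'),
      forall g F, sys_act void_system g @^-1` E F = E [seq q + f g | q <- F] &
      generating E].
Proof.
exists ev; split => //.
- move=> F; split; first exact: measurable_completion.
  by rewrite -nu_ev; exact: completionE.
- move=> P [Pev PC PU Papx].
  have Pbits (A : set bits) : measurable A -> P A.
    move: A; apply: bits_ind => // [A' mA' PA'|F mF tF].
      by apply: PC => //; exact: measurable_completion.
    apply: PU => // n; have [mFn PFn] := mF n; split => //.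
    exact: measurable_completion.
  move=> A mA; apply: Papx => // eps eps0.
  have [B [mB AB Be]] := completion_approx eps0 mA.
  by exists B; split => //; [exact: measurable_completion|exact: Pbits].
Qed.

End Law.

Lemma void_system_exists : exists (S : system R G) (E : seq Q -> set (sys_space S)),
  [/\ forall F, measurable (E F) /\ sys_mu S (E F) = (v F)%:E,
      forall F F', E F `&` E F' = E (F ++ F'),
      forall g F, sys_act S g @^-1` E F = E [seq q + f g | q <- F] &
      generating E].
Proof.
have [nu [nu_prefix nu_leb]] := bits_probability p0 p_ge0 pS p_cvg.
by exists (void_system nu_prefix nu_leb); exact: void_systemP.
Qed.

End VoidProcess.

(** * Weak mixing *)

Section FolnerAverages.
Variables (R : realType) (G : zmodType) (Phi : nat -> {fset G}).
Implicit Types h : G -> R.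

Definition average h N : R := (#|` Phi N|%:R)^-1 * \sum_(g <- Phi N) h g.

(** Only an upper bound is required, so the notion passes to smaller functions without sign
    conditions; nonnegativity enters when a limit is extracted. *)
Definition avg_null h : Prop := forall eps : R, 0 < eps ->
  exists N0, forall N, (N0 <= N)%N -> average h N < eps.

Hypothesis folPhi : folner R Phi.

Let card_gt0 N : 0 < #|` Phi N|%:R :> R.
Proof. by rewrite ltr0n cardfs_gt0; case: folPhi. Qed.

Lemma average_le h h' N : (forall g, h g <= h' g) -> average h N <= average h' N.
Proof.
move=> hh; rewrite /average ler_pM2l ?invr_gt0 //.
by apply: ler_sum => g _.
Qed.

Lemma averageD h h' N :
  average (fun g => h g + h' g) N = average h N + average h' N.
Proof. by rewrite /average big_split mulrDr. Qed.

Lemma average_sum (I : Type) (s : seq I) (h : I -> G -> R) N :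
  average (fun g => \sum_(i <- s) h i g) N = \sum_(i <- s) average (h i) N.
Proof. by rewrite /average exchange_big mulr_sumr. Qed.

Lemma average_cst (c : R) N : average (fun=> c) N = c.
Proof.
by rewrite /average big_tnth sumr_const card_ord -[c *+ _]mulr_natl mulKf ?gt_eqF.
Qed.

Lemma avg_null_le h h' : (forall g, h g <= h' g) -> avg_null h' -> avg_null h.
Proof.
move=> hh h0 eps /h0 [N0 H]; exists N0 => N /H.
by apply: le_lt_trans; exact: average_le.
Qed.

Lemma avg_nullD h h' : avg_null h -> avg_null h' -> avg_null (fun g => h g + h' g).
Proof.
move=> H H' eps eps0; have eps2 : 0 < eps / 2 by rewrite divr_gt0.
have [N1 H1] := H _ eps2; have [N2 H2] := H' _ eps2.
exists (maxn N1 N2) => N; rewrite geq_max => /andP [N1N N2N].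
by rewrite averageD [ltRHS](splitr eps) ltrD ?H1 ?H2.
Qed.

Lemma avg_null_sum (I : Type) (s : seq I) (h : I -> G -> R) :
  (forall i, avg_null (h i)) -> avg_null (fun g => \sum_(i <- s) h i g).
Proof.
move=> H; elim: s => [|i s IH].
  move=> eps eps0; exists 0%N => N _.
  rewrite (_ : (fun g => _) = fun=> 0) ?average_cst //.
  by apply/funext => g; rewrite big_nil.
rewrite (_ : (fun g => _) = fun g => h i g + \sum_(j <- s) h j g).
  by apply: avg_nullD.
by apply/funext => g; rewrite big_cons.
Qed.

Lemma avg_null_approx h : (forall eps : R, 0 < eps -> exists h',
    avg_null h' /\ forall g, h g <= h' g + eps) -> avg_null h.
Proof.
move=> H eps eps0; have eps2 : 0 < eps / 2 by rewrite divr_gt0.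
have [h' [h'0 hh']] := H _ eps2; have [N0 HN] := h'0 _ eps2.
exists N0 => N /HN h'N; apply: le_lt_trans (average_le N hh') _.
by rewrite averageD average_cst [ltRHS](splitr eps) ltrD2r.
Qed.

Lemma avg_null_cvg h : (forall g, 0 <= h g) -> avg_null h ->
  average h N @[N --> \oo] --> (0 : R).
Proof.
move=> h0 H; apply/cvgrPdist_lt => eps /H [N0 HN]; exists N0 => // N /= /HN.
rewrite sub0r normrN ger0_norm // mulr_ge0 ?invr_ge0 //.
by apply: sumr_ge0.
Qed.

(** The shifted sum runs over the translate of [Phi N]. Since [h] is between 0 and 1, the loss is at
    most the number of points of [Phi N] outside that translate. *)
Lemma average_shift h t eps : (forall g, 0 <= h g <= 1) -> 0 < eps ->
  exists N0, forall N, (N0 <= N)%N -> average h N <= average (fun g => h (g + t)) N + eps.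
Proof.
move=> h01 eps0.
have [_ /(_ t) /cvgrPdist_lt /(_ _ eps0) [N0 _ HN]] := folPhi.
exists N0 => N /HN /=; rewrite sub0r normrN ger0_norm ?divr_ge0 //.
set S := Phi N; set St := [fset _ | _ in S]%fset => H.
rewrite -(ler_pM2l (card_gt0 N)) mulrDr /average !mulVKf ?gt_eqF //.
have -> : \sum_(g <- Phi N) h (g + t) = \sum_(g <- St) h g.
  by rewrite big_imfset //= => x y _ _ /addIr.
rewrite -/S (big_fsetID _ (mem St)) /=.
apply: lerD.
  rewrite [leRHS](big_fsetID _ (mem S)) /=.
  rewrite (_ : [fset x in S | x \in St]%fset = [fset x in St | x \in S]%fset).
    by rewrite lerDl; apply: sumr_ge0 => g _; case/andP: (h01 g).
  by apply/fsetP => x; rewrite !inE andbC.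
apply: (@le_trans _ _ (#|` S `\` St|%fset%:R)).
  rewrite (_ : [fset x in S | x \notin St]%fset = (S `\` St)%fset); last first.
    by apply/fsetP => x; rewrite !inE andbC.
  apply: (@le_trans _ _ (\sum_(g <- (S `\` St)%fset) 1)).
    by apply: ler_sum => g _; case/andP: (h01 g).
  by rewrite big_tnth sumr_const card_ord.
apply: (@le_trans _ _ (#|` (St `\` S) `|` (S `\` St)|%fset%:R)).
  by rewrite ler_nat fsubset_leq_card // fsubsetUr.
by rewrite mulrC -ler_pdivrMr; [exact: ltW H|exact: card_gt0].
Qed.

(* The [k] translates have almost the same mean as [h] over a Folner set, so
   [k] times that mean is at most about 1. *)
Lemma avg_null_translates h : (forall g, 0 <= h g <= 1) ->
  (forall k, exists2 ts : seq G, size ts = k &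
     forall g, \sum_(t <- ts) h (g + t) <= 1) ->
  avg_null h.
Proof.
move=> h01 H eps eps0; have eps2 : 0 < eps / 2 by rewrite divr_gt0.
pose k := (Num.bound (eps / 2)^-1).+1.
have kP : (k%:R)^-1 < eps / 2.
  rewrite invf_plt ?posrE ?ltr0n //.
  by rewrite (lt_trans (archi_boundP _)) ?invr_ge0 ?ltW // ltr_nat.
have [ts tsk Hts] := H k.
have [N0 HN] : exists N0, forall N, (N0 <= N)%N -> forall t, t \in ts ->
    average h N <= average (fun g => h (g + t)) N + eps / 2.
  elim: (ts) => [|t s [N1 H1]]; first by exists 0%N.
  have [N2 H2] := average_shift t h01 eps2.
  exists (maxn N1 N2) => N; rewrite geq_max => /andP [N1N N2N] u.
  by rewrite inE => /predU1P [->|]; [exact: H2|exact: H1].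
exists N0 => N /HN {}HN.
have : k%:R * average h N <= 1 + k%:R * (eps / 2).
  have -> : k%:R * average h N = \sum_(t <- ts) average h N.
    by rewrite big_tnth sumr_const card_ord tsk mulr_natl.
  have -> : k%:R * (eps / 2) = \sum_(t <- ts) (eps / 2).
    by rewrite big_tnth sumr_const card_ord tsk mulr_natl.
  apply: (@le_trans _ _ (\sum_(t <- ts) (average (fun g => h (g + t)) N + eps / 2))).
    by rewrite big_seq [leRHS]big_seq; apply: ler_sum => t; exact: HN.
  rewrite big_split lerD2r /= -average_sum -[leRHS](average_cst 1 N).
  exact: average_le.
have k0 : 0 < k%:R :> R by rewrite ltr0n.
rewrite -ler_pdivlMl // mulrDr mulr1 mulKf ?gt_eqF // => /le_lt_trans; apply.
by rewrite [ltRHS](splitr eps) ltrD2r.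
Qed.

End FolnerAverages.

Section WeakMixingInduction.
Variables (R : realType) (G : zmodType) (S : system R G).
Local Notation X := (sys_space S).
Local Notation T := (sys_act S).
Implicit Types A B : set X.

Definition pr A : R := fine (sys_mu S A).

Lemma sys_act_imageE g B : T g @` B = T (- g) @^-1` B.
Proof.
apply/seteqP; split => [_ [x Bx <-]|x Bx] /=.
  by rewrite -sys_actD addNr sys_act0.
by exists (T (- g) x) => //; rewrite -sys_actD subrr sys_act0.
Qed.

Lemma measurable_act g B : measurable B -> measurable (T g @^-1` B).
Proof. by move=> mB; rewrite -[X in measurable X]setTI; exact: sys_act_measurable. Qed.

Lemma measurable_act_image g B : measurable B -> measurable (T g @` B).
Proof. by move=> mB; rewrite sys_act_imageE; exact: measurable_act. Qed.

Lemma prE A : measurable A -> sys_mu S A = (pr A)%:E.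
Proof. by move=> mA; rewrite /pr fineK // fin_num_measure. Qed.

Lemma pr_ge0 A : 0 <= pr A.
Proof. by apply: fine_ge0; exact: measure_ge0. Qed.

Lemma pr_le1 A : measurable A -> pr A <= 1.
Proof. by move=> mA; rewrite -lee_fin -prE //; exact: probability_le1. Qed.

Lemma pr_le A B : measurable A -> measurable B -> A `<=` B -> pr A <= pr B.
Proof. by move=> mA mB AB; rewrite -lee_fin -!prE //; apply: le_measure; rewrite ?inE. Qed.

Lemma prD A B : measurable A -> measurable B -> pr (A `\` B) = pr A - pr (A `&` B).
Proof.
move=> mA mB; apply: EFin_inj; rewrite EFinB -!prE ?measureD //.
- by rewrite -ge0_fin_numE // fin_num_measure.
- exact: measurableI.
- exact: measurableD.
Qed.

Lemma prU A B : measurable A -> measurable B -> A `&` B = set0 ->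
  pr (A `|` B) = pr A + pr B.
Proof.
move=> mA mB AB; apply: EFin_inj; rewrite EFinD -!prE ?measureU //.
exact: measurableU.
Qed.

Lemma prC A : measurable A -> pr (~` A) = 1 - pr A.
Proof.
move=> mA; apply: EFin_inj; rewrite EFinB -!prE ?probability_setC //.
exact: measurableC.
Qed.

Lemma pr_act g A : measurable A -> pr (T g @^-1` A) = pr A.
Proof. by move=> mA; rewrite /pr sys_act_preserving. Qed.

Lemma pr_act_image g A : measurable A -> pr (T g @` A) = pr A.
Proof. by move=> mA; rewrite sys_act_imageE pr_act. Qed.

Definition prd A B : R := pr (A `\` B) + pr (B `\` A).

Lemma pr_dist A B C : measurable A -> measurable B -> measurable C ->
  `|pr (A `&` C) - pr (B `&` C)| <= prd A B.
Proof.
have H A' B' : measurable A' -> measurable B' -> measurable C ->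
    pr (A' `&` C) - pr (B' `&` C) <= pr (A' `\` B').
  move=> mA' mB' mC; rewrite lerBlDr.
  rewrite -[X in pr X](setUIDK (A' `&` C) B') prU.
  - rewrite addrC lerD //; apply: pr_le => //.
    + by apply: measurableD => //; exact: measurableI.
    + exact: measurableD.
    + by move=> x [[]].
    + by apply: measurableI => //; exact: measurableI.
    + exact: measurableI.
    + by move=> x [[]].
  - by apply: measurableI => //; exact: measurableI.
  - by apply: measurableD => //; exact: measurableI.
  - by apply/seteqP; split => // x [[_ Bx] [_ /(_ Bx)]].
move=> mA mB mC; rewrite ler_norml; apply/andP; split.
  rewrite lerNl opprB; apply: le_trans (H _ _ mB mA mC) _.
  by rewrite /prd lerDr pr_ge0.
by apply: le_trans (H _ _ mA mB mC) _; rewrite /prd lerDl pr_ge0.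
Qed.

End WeakMixingInduction.

(** * Induction on measurable sets for asymptotically vanishing defects *)

Section NullInduction.
Variables (R : realType) (G : zmodType) (S : system R G).
Local Notation X := (sys_space S).
Local Notation T := (sys_act S).
Local Notation pr := (@pr R G S).
Local Notation prd := (@prd R G S).
Implicit Types A B : set X.

Lemma prd_sym A B : prd A B = prd B A.
Proof. by rewrite /prd addrC. Qed.

Lemma prd_sub A B : A `<=` B -> prd A B = pr (B `\` A).
Proof. move=> AB; have -> : prd A B = pr (A `\` B) + pr (B `\` A) by [].
rewrite (_ : A `\` B = set0); last by rewrite setD_eq0.
by rewrite {1}/pr measure0 add0r. Qed.

Lemma prdC A B : prd (~` A) (~` B) = prd A B.
Proof. by rewrite /prd !setDE !setCK addrC (setIC (~` A)) (setIC (~` B)). Qed.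

Lemma prd_act g A B : measurable A -> measurable B ->
  prd (T g @^-1` A) (T g @^-1` B) = prd A B.
Proof.
move=> mA mB; rewrite /prd -[in RHS](pr_act g (measurableD mA mB)).
by rewrite -[in RHS](pr_act g (measurableD mB mA)).
Qed.

Lemma prd_triangle A B C : measurable A -> measurable B -> measurable C ->
  prd A C <= prd A B + prd B C.
Proof.
have H A' B' C' : measurable A' -> measurable B' -> measurable C' ->
    pr (A' `\` C') <= pr (A' `\` B') + pr (B' `\` C').
  move=> mA mB mC.
  have mAC : measurable (A' `\` C') by exact: measurableD.
  rewrite -[leLHS]/(pr _) -(setUIDK (A' `\` C') B') prU.
  - rewrite addrC; apply: lerD; apply: pr_le.
    + exact: measurableD.
    + exact: measurableD.
    + by move=> x [[Ax _] Bx].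
    + exact: measurableI.
    + exact: measurableD.
    + by move=> x [[_ Cx] Bx].
  - exact: measurableI.
  - exact: measurableD.
  - by apply/seteqP; split => // x [[_ Bx] [_ /(_ Bx)]].
move=> mA mB mC; rewrite /prd [leRHS]addrACA lerD ?H //.
by rewrite addrC H.
Qed.

Lemma pr_bigcup_approx (F : nat -> set X) (eps : R) : (forall n, measurable (F n)) ->
  0 < eps -> exists k,
  pr (\bigcup_n F n `\` \big[setU/set0]_(i < k) F i) <= eps.
Proof.
move=> mF eps0.
pose B k := \big[setU/set0]_(i < k.+1) F i.
have mB k : measurable (B k) by exact: bigsetU_measurable.
have BE : \bigcup_k B k = \bigcup_k F k by exact: bigcup_bigsetU_bigcup.
have mU : measurable (\bigcup_k F k) by exact: bigcupT_measurable.
have : sys_mu S \o B @ \oo --> sys_mu S (\bigcup_k B k).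
  apply: nondecreasing_cvg_mu => //; first by rewrite BE.
  by move=> i j ij; apply/subsetPset; apply: subset_bigsetU.
rewrite BE (prE mU) => /fine_cvgP [_ /cvgrPdist_lt /(_ _ eps0) [k _ /(_ k (leqnn k)) /= H]].
exists k.+1; rewrite prD; [|exact: mU|exact: (mB k)]; rewrite setIidr; last first.
  by rewrite -BE; exact: (bigcup_sup (i := k)).
by apply: le_trans (ltW H); rewrite ler_norm.
Qed.

Variables (K : Type) (E : K -> set X).
Hypothesis genE : generating E.
Hypothesis mE : forall i, measurable (E i).

Variables (J : Type) (null : (J -> R) -> Prop).
Hypothesis null0 : null (fun=> 0).
Hypothesis null_le : forall h h', (forall j, h j <= h' j) -> null h' -> null h.
Hypothesis nullD : forall h h', null h -> null h' -> null (fun j => h j + h' j).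
Hypothesis null_approx : forall h, (forall eps : R, 0 < eps -> exists h',
  null h' /\ forall j, h j <= h' j + eps) -> null h.

Variable cor : J -> set X -> R.
Hypothesis corE : forall i, null (cor ^~ (E i)).
Hypothesis cor0 : forall j, cor j set0 <= 0.
Hypothesis corC : forall j B, measurable B -> cor j (~` B) <= cor j B.
Hypothesis corU : forall j B B', measurable B -> measurable B' -> B `&` B' = set0 ->
  cor j (B `|` B') <= cor j B + cor j B'.
Hypothesis corD : forall j B B', measurable B -> measurable B' ->
  cor j B <= cor j B' + 2 * prd B B'.

(** A defect that is invariant under complements, subadditive on disjoint unions and Lipschitz for
    the measure of symmetric differences need only be controlled on generators. [null] stays
    abstract in order to cover both Folner averages and limits along a sequence. *)
Lemma null_ind B : measurable B -> null (cor ^~ B).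
Proof.
have approx A : measurable A -> (forall eps : R, 0 < eps -> exists A',
    [/\ measurable A', null (cor ^~ A') & prd A A' <= eps]) -> null (cor ^~ A).
  move=> mA H; apply: null_approx => eps eps0.
  have [A' [mA' nA' AA']] := H (eps / 2) (divr_gt0 eps0 (ltr0n _ 2)).
  exists (cor ^~ A'); split => // j.
  apply: le_trans (corD j mA mA') _; rewrite lerD2l.
  by rewrite mulrC -ler_pdivlMr.
move: B; apply: genE; split.
- exact: corE.
- by move=> A mA; apply: null_le => j; exact: corC.
- move=> F mPF tF; have mF n : measurable (F n) by have [] := mPF n.
  have mU : measurable (\bigcup_n F n) by exact: bigcupT_measurable.
  apply: approx => // eps eps0.
  have [k Hk] := pr_bigcup_approx mF eps0.
  exists (\big[setU/set0]_(i < k) F i); split; first exact: bigsetU_measurable.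
    elim: k {Hk} => [|k IH].
      by rewrite big_ord0; apply: null_le null0 => j; exact: cor0.
    rewrite big_ord_recr /=.
    apply: null_le (nullD IH (mPF k).2) => j; apply: corU => //.
      exact: bigsetU_measurable.
    rewrite -bigcup_mkord setI_bigcupl; apply: bigcup0 => i /= ik.
    by move/trivIsetP : tF => /(_ i k I I); apply; rewrite neq_ltn ik.
  rewrite prd_sym prd_sub //; rewrite -bigcup_mkord.
  by move=> x [i _ Fi]; exists i.
- move=> A mA H; apply: approx => // eps eps0.
  have [A' [mA' nA' AA' muA]] := H _ eps0.
  exists A'; split => //; rewrite prd_sub // -lee_fin -prE //.
  exact: measurableD.
Qed.

End NullInduction.

Section VoidSystem.
Variables (R : realType) (G Q : zmodType) (f : {additive G -> Q}) (S : system R G).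
Local Notation X := (sys_space S).
Local Notation T := (sys_act S).
Local Notation pr := (@pr R G S).
Local Notation prd := (@prd R G S).
Implicit Types A B : set X.
Variables (v : seq Q -> R) (E : seq Q -> set X).
Hypothesis vE : forall F, measurable (E F) /\ sys_mu S (E F) = (v F)%:E.
Hypothesis E_cat : forall F F', E F `&` E F' = E (F ++ F').
Hypothesis E_act : forall g F, T g @^-1` E F = E [seq q + f g | q <- F].
Hypothesis genE : generating E.
Hypothesis v_shift : forall q F, v [seq x + q | x <- F] = v F.

Let mE F : measurable (E F). Proof. by have [] := vE F. Qed.

Let prE F : pr (E F) = v F. Proof. by rewrite /pr (vE F).2. Qed.

(** The correlation depends on two sets, so the induction is run twice: on the second set against a
    fixed generator, then on the first set against an arbitrary one. *)
Lemma void_weakly_mixing :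
  (forall Phi, folner R Phi -> forall F F', avg_null Phi (fun g =>
     `|v (F ++ [seq q - f g | q <- F']) - v F * v F'|)) ->
  weakly_mixing S.
Proof.
move=> mix Phi folPhi A B mA mB.
pose cor g A B := `|pr (A `&` T g @` B) - pr A * pr B|.
have corC' g A1 B1 : measurable A1 -> measurable B1 ->
    cor g A1 (~` B1) = cor g A1 B1 /\ cor g (~` A1) B1 = cor g A1 B1.
  move=> mA1 mB1; have mT := measurable_act_image g mB1.
  have TC : T g @` (~` B1) = ~` (T g @` B1).
    by rewrite !sys_act_imageE preimage_setC.
  split; rewrite /cor; rewrite -normrN; congr `|_|.
    by rewrite TC -setDE prD // prC //; ring.
  by rewrite (setIC (~` A1)) -setDE prD // (setIC _ A1) prC // pr_act_image //; ring.
have cor0' g A1 B1 : cor g A1 set0 <= 0 /\ cor g set0 B1 <= 0.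
  by rewrite /cor image_set0 setI0 set0I /pr measure0 /= mulr0 mul0r subrr normr0.
have corU' g A1 B1 B2 : measurable A1 -> measurable B1 -> measurable B2 ->
    B1 `&` B2 = set0 -> cor g A1 (B1 `|` B2) <= cor g A1 B1 + cor g A1 B2 /\
    cor g (B1 `|` B2) A1 <= cor g B1 A1 + cor g B2 A1.
  move=> mA1 m1 m2 d; have mT C : measurable C -> measurable (T g @` C) by exact: measurable_act_image.
  split; rewrite /cor; apply: le_trans (ler_normD _ _); rewrite le_eqVlt; apply/orP; left;
    apply/eqP; congr `|_|.
    rewrite image_setU setIUr !prU //; first by ring.
    - by apply: measurableI => //; exact: mT.
    - by apply: measurableI => //; exact: mT.
    - rewrite setIACA !sys_act_imageE -preimage_setI d preimage_set0.
      by rewrite setI0.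
  rewrite setIUl !prU //; first by ring.
  - by apply: measurableI => //; exact: mT.
  - by apply: measurableI => //; exact: mT.
  - by rewrite setIACA d set0I.
(* The factor 2 pays for one replacement in the measure of the intersection and one in the product
   of measures. *)
have two (x x' a b b' d : R) : `|x - x'| <= d -> `|b - b'| <= d -> 0 <= a <= 1 ->
    `|x - a * b| <= `|x' - a * b'| + 2 * d.
  move=> xx bb /andP [a0 a1].
  have -> : x - a * b = (x' - a * b') + (x - x') + a * (b' - b) by ring.
  rewrite (_ : `|x' - a * b'| + 2 * d = (`|x' - a * b'| + d) + d); last by ring.
  apply: le_trans (ler_normD _ _) _; apply: lerD.
    by apply: le_trans (ler_normD _ _) _; rewrite lerD2l.
  rewrite normrM (ger0_norm a0) distrC; apply: le_trans bb.
  by rewrite ler_piMl.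
have pr01 A1 : measurable A1 -> 0 <= pr A1 <= 1.
  by move=> mA1; rewrite pr_ge0 pr_le1.
have prd_pr A1 B1 : measurable A1 -> measurable B1 -> `|pr A1 - pr B1| <= prd A1 B1.
  by move=> m1 m2; have := pr_dist m1 m2 measurableT; rewrite !setIT.
have corD' g A1 B1 B2 : measurable A1 -> measurable B1 -> measurable B2 ->
    cor g A1 B1 <= cor g A1 B2 + 2 * prd B1 B2 /\
    cor g B1 A1 <= cor g B2 A1 + 2 * prd B1 B2.
  move=> mA1 m1 m2; have mT C : measurable C -> measurable (T g @` C) by exact: measurable_act_image.
  split; rewrite /cor.
    apply: two => //; [|exact: prd_pr|exact: pr01].
    rewrite !(setIC A1); have := pr_dist (mT _ m1) (mT _ m2) mA1.
    by rewrite !sys_act_imageE prd_act.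
  rewrite !(mulrC _ (pr A1)); apply: two => //; [|exact: prd_pr|exact: pr01].
  by apply: pr_dist => //; exact: mT.
have nl := @avg_null_le R G Phi folPhi.
have na := @avg_null_approx R G Phi folPhi.
have n0 : avg_null Phi (fun=> 0 : R).
  by move=> eps eps0; exists 0%N => N _; rewrite average_cst.
have step1 F B1 : measurable B1 -> avg_null Phi (fun g => cor g (E F) B1).
  move=> mB1; apply: (@null_ind R G S _ E genE G (avg_null Phi) n0 nl (@avg_nullD R G Phi) na (fun g B => cor g (E F) B) _ _ _ _ _ B1 mB1) => // {B1 mB1}.
  - move=> F'; apply: nl (mix Phi folPhi F F') => g.
    by rewrite /cor sys_act_imageE E_act E_cat !prE raddfN.
  - by move=> g; have [] := cor0' g (E F) set0.
  - by move=> g B1 m1; have [-> _] := corC' g _ _ (mE F) m1.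
  - by move=> g B1 B2 m1 m2 d; have [] := corU' g _ _ _ (mE F) m1 m2 d.
  - by move=> g B1 B2 m1 m2; have [] := corD' g _ _ _ (mE F) m1 m2.
have step2 : avg_null Phi (fun g => cor g A B).
  apply: (@null_ind R G S _ E genE G (avg_null Phi) n0 nl (@avg_nullD R G Phi) na (fun g A => cor g A B) _ _ _ _ _ A mA) => // {A mA}.
  - by move=> F; exact: step1.
  - by move=> g; have [] := cor0' g set0 B.
  - by move=> g A1 m1; have [_ ->] := corC' g _ _ m1 mB.
  - by move=> g A1 A2 m1 m2 d; have [] := corU' g _ _ _ mB m1 m2 d.
  - by move=> g A1 A2 m1 m2; have [] := corD' g _ _ _ mB m1 m2.
by apply: avg_null_cvg step2 => // g; exact: normr_ge0.
Qed.

Definition null_seq (h : nat -> R) : Prop := forall eps : R, 0 < eps ->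
  exists N, forall n, (N <= n)%N -> h n < eps.

Lemma null_seq_le h h' : (forall n, h n <= h' n) -> null_seq h' -> null_seq h.
Proof.
move=> hh h0 eps /h0 [N H]; exists N => n /H.
exact: le_lt_trans.
Qed.

Lemma null_seqD h h' : null_seq h -> null_seq h' -> null_seq (fun n => h n + h' n).
Proof.
move=> H H' eps eps0; have eps2 : 0 < eps / 2 by rewrite divr_gt0.
have [N1 H1] := H _ eps2; have [N2 H2] := H' _ eps2.
exists (maxn N1 N2) => n; rewrite geq_max => /andP [N1n N2n].
by rewrite [ltRHS](splitr eps) ltrD ?H1 ?H2.
Qed.

Lemma null_seq_approx h : (forall eps : R, 0 < eps -> exists h',
    null_seq h' /\ forall n, h n <= h' n + eps) -> null_seq h.
Proof.
move=> H eps eps0; have eps2 : 0 < eps / 2 by rewrite divr_gt0.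
have [h' [h'0 hh']] := H _ eps2; have [N HN] := h'0 _ eps2.
exists N => n /HN h'n; apply: le_lt_trans (hh' n) _.
by rewrite [ltRHS](splitr eps) ltrD2r.
Qed.

Lemma void_rigid_sets (a : nat -> G) :
  (forall F, null_seq (fun n => v F - v ([seq q + f (a n) | q <- F] ++ F))) ->
  forall A, measurable A -> null_seq (fun n => prd (T (a n) @^-1` A) A).
Proof.
move=> rig.
have mT n A : measurable A -> measurable (T (a n) @^-1` A) by exact: measurable_act.
move=> A mA; apply: (@null_ind R G S _ E genE nat null_seq _ null_seq_le null_seqD
  null_seq_approx (fun n A => prd (T (a n) @^-1` A) A) _ _ _ _ _ A mA) => {A mA}.
- by move=> eps eps0; exists 0%N.
(* The two halves of the symmetric difference have the same measure, by invariance of [v]; hence the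
   same bound is used twice. *)
- move=> F; apply: null_seq_le (null_seqD (rig F) (rig F)) => n.
  by rewrite /prd E_act !prD ?mE // (setIC (E F)) !E_cat !prE v_shift.
- by move=> n; rewrite preimage_set0 /prd setD0 /pr measure0 /= addr0.
- by move=> n A mA; rewrite preimage_setC prdC.
- move=> n A B mA mB AB; rewrite preimage_setU /prd !setDUl addrACA.
  set A' := _ @^-1` A; set B' := _ @^-1` B.
  have mA' : measurable A' by exact: mT.
  have mB' : measurable B' by exact: mT.
  have dAB : A' `&` B' = set0 by rewrite -preimage_setI AB preimage_set0.
  have le1 (C D W : set X) : measurable C -> measurable D -> measurable W ->
      D `<=` W -> pr (C `\` W) <= pr (C `\` D).
    move=> mC mD mW DW; apply: pr_le; [exact: measurableD|exact: measurableD|].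
    by move=> x [Cx Wx]; split => // /DW.
  have mU : measurable (A `|` B) by exact: measurableU.
  have mU' : measurable (A' `|` B') by exact: measurableU.
  have sl (C D : set X) : C `<=` C `|` D by left.
  have sr (C D : set X) : D `<=` C `|` D by right.
  rewrite prU; first last.
  + by apply/seteqP; split => // x [[Ax _] [Bx _]]; rewrite -dAB.
  + exact: measurableD.
  + exact: measurableD.
  rewrite [X in _ + X <= _]prU; first last.
  + by apply/seteqP; split => // x [[Ax _] [Bx _]]; rewrite -AB.
  + exact: measurableD.
  + exact: measurableD.
  by apply: lerD; apply: lerD; apply: le1.
- move=> n A B mA mB; have mA' := mT n _ mA; have mB' := mT n _ mB.
  have := prd_triangle mA' mB' mA; have := prd_triangle mB' mB mA.
  rewrite prd_act // (prd_sym B A).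
  by move: (prd A B) (prd _ A) (prd _ B) (prd _ A) => x y z w; lra.
Qed.

End VoidSystem.

(** * Rigidity in L2 *)

Import HBNNSimple.

Section SquareIntegrals.
Context (R : realType) (d : measure_display) (X : measurableType d).
Variable mu : probability X R.
Local Open Scope ereal_scope.
Implicit Types (g h k : X -> R) (f : X -> R[i]).

(** The squared norm, with values in the extended reals: no roots and no integrability conditions,
    at the price of [(g + h)^2 <= 2 g^2 + 2 h^2] in place of the triangle inequality. *)
Definition sqint g : \bar R := \int[mu]_x ((g x) ^+ 2)%:E.

Lemma sqint_ge0 g : 0 <= sqint g.
Proof. by apply: integral_ge0 => x _; rewrite lee_fin sqr_ge0. Qed.

Let measurable_sq g : measurable_fun [set: X] g ->
  measurable_fun [set: X] ((fun x => ((g x) ^+ 2)%:E) : X -> \bar R).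
Proof. by move=> mg; apply/measurable_EFinP; exact: measurable_funX. Qed.

Lemma le_sqint g h : measurable_fun [set: X] g -> measurable_fun [set: X] h ->
  (forall x, ((g x) ^+ 2 <= (h x) ^+ 2)%R) -> sqint g <= sqint h.
Proof.
move=> mg mh gh; apply: ge0_le_integral => //.
- by move=> x _; rewrite lee_fin sqr_ge0.
- exact: measurable_sq.
- exact: measurable_sq.
- by move=> x _; rewrite lee_fin.
Qed.

Lemma sqintD g h : measurable_fun [set: X] g -> measurable_fun [set: X] h ->
  sqint (fun x => g x + h x)%R <= 2%:E * sqint g + 2%:E * sqint h.
Proof.
move=> mg mh.
have e (k : X -> R) : measurable_fun [set: X] k ->
    2%:E * sqint k = \int[mu]_x (2%:E * ((k x) ^+ 2)%:E).
  move=> mk; rewrite ge0_integralZl_EFin //; last exact: measurable_sq.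
  by move=> x _; rewrite lee_fin sqr_ge0.
rewrite !e // -ge0_integralD //; last 4 first.
- by move=> x _; rewrite -EFinM lee_fin mulr_ge0 // sqr_ge0.
- by apply: measurable_funeM; exact: measurable_sq.
- by move=> x _; rewrite -EFinM lee_fin mulr_ge0 // sqr_ge0.
- by apply: measurable_funeM; exact: measurable_sq.
apply: ge0_le_integral => //.
- by move=> x _; rewrite lee_fin sqr_ge0.
- by apply: measurable_sq; exact: measurable_funD.
- by apply: emeasurable_funD; apply: measurable_funeM; exact: measurable_sq.
move=> x _; rewrite -!EFinM -EFinD lee_fin -subr_ge0.
rewrite (_ : _ - _ = (g x - h x) ^+ 2)%R ?sqr_ge0 //; by ring.
Qed.

Lemma sqintZ (c : R) g : measurable_fun [set: X] g ->
  sqint (fun x => c * g x)%R = (c ^+ 2)%:E * sqint g.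
Proof.
move=> mg; rewrite /sqint -ge0_integralZl_EFin ?sqr_ge0 //.
- by apply: eq_integral => x _; rewrite -EFinM exprMn.
- by move=> x _; rewrite lee_fin sqr_ge0.
- exact: measurable_sq.
Qed.

Lemma sqint_indic_diff (A B : set X) : measurable A -> measurable B ->
  sqint (fun x => \1_A x - \1_B x)%R = mu ((A `\` B) `|` (B `\` A)).
Proof.
move=> mA mB; rewrite -[X in mu X]setIT -integral_indic //; last first.
  by apply: measurableU; exact: measurableD.
apply: eq_integral => x _; congr EFin.
rewrite !indicE !in_setU !in_setD.
by case: (x \in A); case: (x \in B); rewrite /= ?subrr ?subr0 ?sub0r ?sqrrN ?expr1n ?expr0n.
Qed.

Lemma sqint_comp (T : X -> X) g : measurable_fun [set: X] T ->
  (forall A, measurable A -> mu (T @^-1` A) = mu A) ->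
  measurable_fun [set: X] g -> sqint (g \o T) = sqint g.
Proof.
move=> mT muT mg; rewrite /sqint.
have -> : \int[mu]_x ((g \o T) x ^+ 2)%:E =
    \int[mu]_(x in T @^-1` setT) ((fun x => ((g x) ^+ 2)%:E) \o T) x by [].
rewrite -ge0_integral_pushforward //.
- by apply: eq_measure_integral => A mA _; exact: muT.
- exact: measurable_sq.
- by move=> x _; rewrite lee_fin sqr_ge0.
Qed.

Lemma L2normE f : measurable_fun [set: X] (fun x => complex.Re (f x)) ->
  measurable_fun [set: X] (fun x => complex.Im (f x)) ->
  L2norm mu f = sqrte (sqint (fun x => complex.Re (f x)) + sqint (fun x => complex.Im (f x))).
Proof.
move=> mRe mIm; rewrite /L2norm unlock -poweR12_sqrt; last first.
  by rewrite adde_ge0 ?sqint_ge0.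
congr (_ `^ _); rewrite /sqint -ge0_integralD //.
- apply: eq_integral => x _; case: (f x) => a b /=.
  rewrite ger0_norm ?sqrtr_ge0 // powR_mulrn ?sqrtr_ge0 // sqr_sqrtr //.
  by rewrite addr_ge0 ?sqr_ge0.
- by move=> x _; rewrite lee_fin sqr_ge0.
- exact: measurable_sq.
- by move=> x _; rewrite lee_fin sqr_ge0.
- exact: measurable_sq.
Qed.

(** Dominated convergence along increasing simple functions: the squared errors are dominated by the
    square of [g]. *)
Lemma sqint_approx g (e : R) : (0 < e)%R -> measurable_fun [set: X] g ->
  (forall x, (0 <= g x)%R) -> sqint g < +oo ->
  exists s : {nnsfun X >-> R}, sqint (fun x => g x - s x)%R <= e%:E.
Proof.
move=> e0 mg g0 gfin.
have mg' : measurable_fun [set: X] (EFin \o g) by exact/measurable_EFinP.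
pose s := nnsfun_approx measurableT mg'.
have s_cvg x : (s n x)%:E @[n --> \oo] --> (g x)%:E.
  by apply: (cvg_nnsfun_approx measurableT mg') => // y _; rewrite lee_fin.
have s_cvgR x : s n x @[n --> \oo] --> g x.
  by have /fine_cvgP [_] := s_cvg x.
have s_le n x : (s n x <= g x)%R.
  rewrite -(cvg_lim (@Rhausdorff R) (s_cvgR x)).
  apply: (@nondecreasing_cvgn_le _ (fun i => s i x)); last by apply/cvg_ex; exists (g x).
  by move=> i j ij; exact/lefP/nd_nnsfun_approx.
have ms n : measurable_fun [set: X] (fun x => g x - s n x)%R.
  by apply: measurable_funB => //; exact: measurable_funP.
have [|||||_ _] := @dominated_convergence _ _ _ mu setT measurableT
    (fun n x => ((g x - s n x) ^+ 2)%:E) (cst 0) (fun x => ((g x) ^+ 2)%:E).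
- by move=> n; exact: measurable_sq.
- exact: measurable_cst.
- apply/aeW => x _; apply: cvg_EFin; first by apply: nearW.
  have -> : 0%R = ((g x - g x) ^+ 2)%R :> R by rewrite subrr expr0n.
  by apply: (cvgM (cvgB (cvg_cst _) (s_cvgR x)) (cvgB (cvg_cst _) (s_cvgR x))).
- apply/integrableP; split; first exact: measurable_sq.
  apply: le_lt_trans gfin; apply: ge0_le_integral => //.
  + by apply: measurableT_comp => //; exact: measurable_sq.
  + exact: measurable_sq.
  + by move=> x _; rewrite gee0_abs // lee_fin sqr_ge0.
- apply/aeW => x n _; rewrite gee0_abs ?lee_fin ?sqr_ge0 //.
  rewrite lerXn2r ?nnegrE ?subr_ge0 //.
  by rewrite gerBl.
rewrite integral0 => /fine_cvgP [[N1 _ H1] /cvgrPdist_lt /(_ _ e0) [N2 _ H2]].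
exists (s (maxn N1 N2)).
have := H1 (maxn N1 N2) (leq_maxl _ _); have := H2 (maxn N1 N2) (leq_maxr _ _).
rewrite /= sub0r normrN => H3 H4.
rewrite /sqint -(fineK H4) lee_fin; apply: le_trans (ltW H3).
exact: ler_norm.
Qed.

Lemma le_sqintB_add g h k : measurable_fun [set: X] g -> measurable_fun [set: X] h ->
  measurable_fun [set: X] k ->
  sqint (fun x => g x - k x)%R <=
  2%:E * sqint (fun x => g x - h x)%R + 2%:E * sqint (fun x => h x - k x)%R.
Proof.
move=> mg mh mk; rewrite (_ : (fun x => g x - k x)%R = (fun x => (g x - h x) + (h x - k x))%R).
  by apply: sqintD; exact: measurable_funB.
by apply/funext => x; rewrite addrA subrK.
Qed.

End SquareIntegrals.

Section RigiditySequence.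
Variables (R : realType) (G : zmodType) (S : system R G) (a : nat -> G).
Local Notation X := (sys_space S).
Local Notation T n := (sys_act S (a n)).
Local Notation mu := (sys_mu S).
Local Open Scope ereal_scope.
Implicit Types (g h : X -> R).

Let mT n : measurable_fun [set: X] (T n). Proof. exact: sys_act_measurable. Qed.

Let mgT g n : measurable_fun [set: X] g -> measurable_fun [set: X] (fun x => g (T n x) : R).
Proof. by move=> mg; exact: measurableT_comp. Qed.

Let sqintT g n : measurable_fun [set: X] g -> sqint mu (fun x => g (T n x)) = sqint mu g.
Proof. by move=> mg; apply: (sqint_comp (mT n)) mg => A; exact: sys_act_preserving. Qed.

Definition rigid_fun (g : X -> R) : Prop := measurable_fun [set: X] g /\
  forall e : R, (0 < e)%R -> exists N, forall n, (N <= n)%N ->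
    sqint mu (fun x => g (T n x) - g x)%R <= e%:E.

Lemma rigid_funD g h : rigid_fun g -> rigid_fun h -> rigid_fun (fun x => g x + h x)%R.
Proof.
move=> [mg Hg] [mh Hh]; split; first exact: measurable_funD.
move=> e e0; have e4 : (0 < e / 4)%R by rewrite divr_gt0.
have [N1 H1] := Hg _ e4; have [N2 H2] := Hh _ e4.
exists (maxn N1 N2) => n; rewrite geq_max => /andP [/H1 G1 /H2 G2].
rewrite (_ : (fun x => _) = (fun x => (g (T n x) - g x) + (h (T n x) - h x))%R); last first.
  by apply/funext => x; ring.
apply: le_trans (sqintD _ _ _) _.
- by apply: measurable_funB => //; exact: mgT.
- by apply: measurable_funB => //; exact: mgT.
apply: (@le_trans _ _ (2%:E * (e / 4)%:E + 2%:E * (e / 4)%:E)).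
  by apply: leeD; apply: lee_wpmul2l.
by rewrite -!EFinM -EFinD lee_fin; lra.
Qed.

Lemma rigid_funZ c g : rigid_fun g -> rigid_fun (fun x => c * g x)%R.
Proof.
move=> [mg Hg]; split; first exact: measurable_funM.
move=> e e0; have c0 : (0 < c ^+ 2 + 1)%R by rewrite ltr_wpDl ?sqr_ge0.
have [N H] := Hg _ (divr_gt0 e0 c0); exists N => n /H Hn.
rewrite (_ : (fun x => _) = (fun x => c * (g (T n x) - g x))%R); last first.
  by apply/funext => x; ring.
rewrite sqintZ; last by apply: measurable_funB => //; exact: mgT.
apply: (@le_trans _ _ ((c ^+ 2 + 1)%:E * (e / (c ^+ 2 + 1))%:E)).
  apply: lee_pmul => //; [by rewrite lee_fin sqr_ge0|exact: sqint_ge0|].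
  by rewrite lee_fin lerDl.
by rewrite -EFinM mulrC divfK // gt_eqF.
Qed.

Lemma rigid_fun_approx g : measurable_fun [set: X] g ->
  (forall e : R, (0 < e)%R -> exists s : X -> R, rigid_fun s /\ sqint mu (fun x => g x - s x)%R <= e%:E) ->
  rigid_fun g.
Proof.
move=> mg H; split => // e e0.
(* Two uses of the quadratic inequality, together with invariance of the norm under [T n], cost
   [2 + 2 * (2 + 2) = 10] such errors. *)
have e12 : (0 < e / 12)%R by rewrite divr_gt0.
have [s [[ms Hs] gs]] := H _ e12; have [N HN] := Hs _ e12.
exists N => n /HN Hn.
have b1 := le_sqintB_add mu (mgT n mg) (mgT n ms) mg.
have b2 := le_sqintB_add mu (mgT n ms) ms mg.
have e1 : sqint mu (fun x => g (T n x) - s (T n x))%R = sqint mu (fun x => g x - s x)%R.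
  by rewrite -(sqintT n (measurable_funB mg ms)).
have e2 : sqint mu (fun x => s x - g x)%R = sqint mu (fun x => g x - s x)%R.
  by apply: eq_integral => x _; congr EFin; ring.
apply: (le_trans b1); rewrite e1.
apply: (@le_trans _ _ (2%:E * (e / 12)%:E + 2%:E * (2%:E * (e / 12)%:E + 2%:E * (e / 12)%:E))).
  apply: leeD; apply: lee_wpmul2l => //.
  by apply: (le_trans b2); rewrite e2; apply: leeD; apply: lee_wpmul2l.
by rewrite -!(EFinM, EFinD) lee_fin; lra.
Qed.

Hypothesis rigid_sets : forall A : set X, measurable A ->
  null_seq (fun n => prd (T n @^-1` A) A).

Lemma rigid_fun_indic A : measurable A -> rigid_fun (\1_A : X -> R).
Proof.
move=> mA; split; first exact: measurable_indic.
move=> e e0; have [N H] := rigid_sets mA e0; exists N => n /H Hn.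
have mTA : measurable (T n @^-1` A) by exact: measurable_act.
have -> : sqint mu (fun x => \1_A (T n x) - \1_A x)%R =
    mu ((T n @^-1` A `\` A) `|` (A `\` T n @^-1` A)).
  by rewrite -sqint_indic_diff.
have m1 := measurableD mTA mA; have m2 := measurableD mA mTA.
rewrite prE; last exact: measurableU.
rewrite prU // ?lee_fin; first exact: ltW.
by apply/seteqP; split => // x [[_ nA] [Ax _]].
Qed.

Lemma rigid_fun_sfun (s : {nnsfun X >-> R}) : rigid_fun s.
Proof.
pose r := enum_fset (fset_set (s @` setT)).
have -> : (s : X -> R) = (fun x => \sum_(y <- r) y * \1_(s @^-1` [set y]) x)%R.
  by apply/funext => x; rewrite fimfunE fsbig_finite.
elim: r => [|y r IH].
  rewrite (_ : (fun x => _) = (fun=> 0%R)); last by apply/funext => x; rewrite big_nil.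
  split; first exact: measurable_cst.
  move=> e e0; exists 0%N => n _; rewrite subrr /sqint expr0n /= integral0.
  by rewrite lee_fin ltW.
rewrite (_ : (fun x => _) = (fun x => y * \1_(s @^-1` [set y]) x +
   \sum_(z <- r) z * \1_(s @^-1` [set z]) x)%R); last first.
  by apply/funext => x; rewrite big_cons.
apply: rigid_funD => //; apply: rigid_funZ; apply: rigid_fun_indic.
exact: measurable_funPTI.
Qed.

Let rigid_fun_ge0 g : measurable_fun [set: X] g -> (forall x, (0 <= g x)%R) ->
  sqint mu g < +oo -> rigid_fun g.
Proof.
move=> mg g0 gfin; apply: rigid_fun_approx => // e e0.
have [s sg] := sqint_approx e0 mg g0 gfin.
by exists s; split => //; exact: rigid_fun_sfun.
Qed.

Lemma rigid_fun_sqint g : measurable_fun [set: X] g -> sqint mu g < +oo -> rigid_fun g.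
Proof.
move=> mg gfin.
have part (h : X -> R) : measurable_fun [set: X] h -> sqint mu h = sqint mu g ->
    rigid_fun (fun x => Num.max (h x) 0)%R.
  move=> mh hg.
  have mh0 : measurable_fun [set: X] (fun x => Num.max (h x) 0)%R.
    by apply: measurable_maxr => //; exact: measurable_cst.
  apply: rigid_fun_ge0 => //; first by move=> x; rewrite le_max lexx orbT.
  apply: le_lt_trans gfin; rewrite -hg; apply: le_sqint => // x.
  by case: (leP 0%R (h x)) => // _; rewrite expr0n sqr_ge0.
have mNg : measurable_fun [set: X] (fun x => - g x)%R by exact: measurableT_comp.
have -> : g = (fun x => Num.max (g x) 0 + -1 * Num.max (- g x) 0)%R.
  apply/funext => x; case: (leP 0%R (g x)) => g0.
    by rewrite max_r ?oppr_le0 // mulr0 addr0.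
  by rewrite max_l ?oppr_ge0 ?ltW // add0r mulN1r opprK.
apply: rigid_funD; first exact: part.
apply: rigid_funZ; apply: part => //.
by apply: eq_integral => x _; rewrite sqrrN.
Qed.

Lemma rigidity_sequence_of_sets : rigidity_sequence S a.
Proof.
move=> f [mRe mIm ffin].
have := ffin; rewrite L2normE //.
set I1 := sqint mu _; set I2 := sqint mu _ => fin12.
have I12 : I1 + I2 < +oo.
  by move: fin12; case: (I1 + I2) => [r||] /=; rewrite ?ltry ?ltNyr.
have I1fin : I1 < +oo by apply: le_lt_trans I12; rewrite leeDl ?sqint_ge0.
have I2fin : I2 < +oo by apply: le_lt_trans I12; rewrite leeDr ?sqint_ge0.
have [_ H1] := rigid_fun_sqint mRe I1fin; have [_ H2] := rigid_fun_sqint mIm I2fin.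
pose u n := sqint mu (fun x => complex.Re (f (T n x)) - complex.Re (f x))%R +
  sqint mu (fun x => complex.Im (f (T n x)) - complex.Im (f x))%R.
have uE n : L2norm mu (fun x => f (T n x) - f x)%R = sqrte (u n).
  have Re_sub (z w : R[i]) : complex.Re (z - w)%R = (complex.Re z - complex.Re w)%R.
    by case: z; case: w.
  have Im_sub (z w : R[i]) : complex.Im (z - w)%R = (complex.Im z - complex.Im w)%R.
    by case: z; case: w.
  rewrite L2normE.
  - by congr (sqrte (_ + _)); apply: eq_integral => x _; rewrite ?Re_sub ?Im_sub.
  - rewrite (_ : (fun x => _) = (fun x => complex.Re (f (T n x)) - complex.Re (f x))%R).
      by apply: measurable_funB => //; exact: (mgT n mRe).
    by apply/funext => x; rewrite Re_sub.
  - rewrite (_ : (fun x => _) = (fun x => complex.Im (f (T n x)) - complex.Im (f x))%R).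
      by apply: measurable_funB => //; exact: (mgT n mIm).
    by apply/funext => x; rewrite Im_sub.
have u0 n : 0 <= u n by rewrite adde_ge0 ?sqint_ge0.
have u_small (e : R) : (0 < e)%R -> exists N, forall n, (N <= n)%N -> u n <= e%:E.
  move=> e0; have e2 : (0 < e / 2)%R by rewrite divr_gt0.
  have [N1 G1] := H1 _ e2; have [N2 G2] := H2 _ e2.
  exists (maxn N1 N2) => n; rewrite geq_max => /andP [/G1 K1 /G2 K2].
  by rewrite [e](splitr e) EFinD leeD.
under eq_fun do rewrite uE.
apply/fine_cvgP; split.
  have [N HN] := u_small 1%R ltr01; exists N => // n /HN un.
  have := u0 n; case: (u n) un => //.
apply/cvgrPdist_lt => e e0.
have e2 : (0 < (e / 2) ^+ 2)%R by rewrite exprn_gt0 // divr_gt0.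
have [N HN] := u_small _ e2; exists N => // n /= /HN un.
rewrite sub0r normrN.
have := u0 n; case: (u n) un => [r|//|//] /=; rewrite !lee_fin => re r0.
rewrite ger0_norm ?sqrtr_ge0 //.
apply: (@le_lt_trans _ _ (Num.sqrt ((e / 2) ^+ 2))).
  by rewrite ler_sqrt // sqr_ge0.
by rewrite sqrtr_sqr ger0_norm ?divr_ge0 ?ltW //; lra.
Qed.

End RigiditySequence.

(** * Eigenfunctions *)

Notation normc := ComplexField.Normc.normc.

Section Eigenfunctions.
Variables (R : realType) (G : zmodType) (S : system R G).
Local Notation X := (sys_space S).
Local Notation T := (sys_act S).
Local Notation mu := (sys_mu S).
Local Open Scope ereal_scope.
Implicit Types (f : X -> R[i]).

Let normc_ge0 (z : R[i]) : (0 <= normc z)%R.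
Proof. by case: z => x y; exact: sqrtr_ge0. Qed.

Lemma L2norm_sqint f : L2norm mu f = sqrte (sqint mu (fun x => normc (f x))).
Proof.
rewrite /L2norm unlock -poweR12_sqrt; last exact: sqint_ge0.
congr (_ `^ _); apply: eq_integral => x _ /=.
by rewrite ger0_norm // powR_mulrn.
Qed.

Lemma measurable_normc f : measurable_fun [set: X] (fun x => complex.Re (f x)) ->
  measurable_fun [set: X] (fun x => complex.Im (f x)) ->
  measurable_fun [set: X] (fun x => normc (f x) : R).
Proof.
move=> mRe mIm.
rewrite (_ : (fun x => _) = Num.sqrt \o
    (fun x => complex.Re (f x) ^+ 2 + complex.Im (f x) ^+ 2)%R); last first.
  by apply/funext => x /=; case: (f x).
apply: measurableT_comp.
  by apply: continuous_measurable_fun; exact: sqrt_continuous.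
by apply: measurable_funD; exact: measurable_funX.
Qed.

Lemma inL2_sqint f : inL2 mu f -> sqint mu (fun x => normc (f x)) < +oo.
Proof.
move=> [_ _]; rewrite L2norm_sqint; case: (sqint _ _) => [r||] /=;
  by rewrite ?ltry ?ltNyr.
Qed.

Lemma ae_act g (P : X -> Prop) : {ae mu, forall x, P x} -> {ae mu, forall x, P (T g x)}.
Proof.
move=> [A [mA A0 PA]]; exists (T g @^-1` A); split.
- exact: measurable_act.
- by rewrite sys_act_preserving.
- by move=> x /= nP; apply: PA.
Qed.

Lemma ae_eq_sqint (g h : X -> R) : measurable_fun [set: X] g ->
  measurable_fun [set: X] h -> {ae mu, forall x, g x = h x} -> sqint mu g = sqint mu h.
Proof.
move=> mg mh gh; apply: ae_eq_integral => //.
- by apply/measurable_EFinP; exact: measurable_funX.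
- by apply/measurable_EFinP; exact: measurable_funX.
- by apply: filterS gh => x /= ->.
Qed.

Lemma sqint_eq0 (g : X -> R) : measurable_fun [set: X] g -> sqint mu g = 0 ->
  {ae mu, forall x, g x = 0%R}.
Proof.
move=> mg g0.
have mg2 : measurable_fun [set: X] (fun x => ((g x) ^+ 2)%:E).
  by apply/measurable_EFinP; exact: measurable_funX.
have /(ae_eq_integral_abs mu measurableT mg2) : \int[mu]_x `|((g x) ^+ 2)%:E| = 0.
  rewrite -g0; apply: eq_integral => x _.
  by rewrite gee0_abs // lee_fin sqr_ge0.
by apply: filterS => x /= /(_ Logic.I) [] /eqP; rewrite sqrf_eq0 => /eqP.
Qed.

(** If [f] is not null, its eigenvalues form a unitary character: multiplicative by comparison of
    [f] at [T (g + h) x], of modulus 1 because [T g] preserves the norm. Since [f] composed with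
    [T (a n)] differs from [f] by [|chi (a n) - 1|] times the norm of [f], rigidity makes
    [chi (a n)] tend to 1. A null [f] puts no constraint on [chi] and is treated apart. *)
Lemma eigenfunction_invariant (a : nat -> G) f :
  (forall chi : G -> R[i], (forall g h, chi (g + h)%R = chi g * chi h)%R ->
     (forall g, normc (chi g) = 1%R) ->
     (forall e : R, (0 < e)%R -> exists N, forall n, (N <= n)%N ->
        (normc (chi (a n) - 1) <= e)%R) ->
     forall g, chi g = 1%R) ->
  rigidity_sequence S a -> eigenfunction f ->
  forall g, {ae mu, forall x, f (T g x) = f x}.
Proof.
move=> achar rig [fL2 [chi chiE]] g.
have [mRe mIm _] := fL2.
have mf := measurable_normc mRe mIm.
have ffin := inL2_sqint fL2.
have [f0|f0] := pselect {ae mu, forall x, f x = 0%R}.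
  by apply: filterS2 (ae_act g f0) f0 => x -> ->.
set N := sqint mu (fun x => normc (f x)) in ffin.
have N0 : N != 0.
  apply/eqP => /(sqint_eq0 mf) H; apply: f0.
  by apply: filterS H => x /ComplexField.Normc.eq0_normc.
have [r [r0 NE]] : exists r : R, (0 < r)%R /\ N = r%:E.
  have := sqint_ge0 mu (fun x => normc (f x)); rewrite -/N.
  case: N N0 ffin => [r||] // r0 _; rewrite lee_fin => r1; exists r; split => //.
  by rewrite lt_neqAle r1 eq_sym andbT; apply: contra r0 => /eqP ->.
have chi_eq c : {ae mu, forall x, c * f x = 0}%R -> c = 0%R.
  move=> cf; apply/eqP/negP => /negP c0; apply: f0.
  by apply: filterS cf => x /eqP; rewrite mulf_eq0 (negPf c0) => /eqP.
have mfT h : measurable_fun [set: X] (fun x => normc (f (T h x)) : R).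
  exact: (measurableT_comp mf (sys_act_measurable h)).
suff chi1 : chi g = 1%R.
  by move: (chiE g); apply: filterS => x ->; rewrite chi1 mul1r.
apply: (achar chi _ _ _ g) => [h h'|h|e e0].
- apply/subr0_eq/chi_eq.
  apply: filterS3 (chiE (h + h')%R) (chiE h') (ae_act h' (chiE h)) => x.
  by rewrite sys_actD => H1 H2 H3; rewrite mulrBl -H1 H3 H2 mulrA subrr.
- have : sqint mu (fun x => normc (f (T h x))) = (normc (chi h) ^+ 2)%:E * N.
    rewrite -sqintZ //; apply: ae_eq_sqint => //; first exact: measurable_funM.
    by apply: filterS (chiE h) => x ->; rewrite ComplexField.Normc.normcM.
  have -> : sqint mu (fun x => normc (f (T h x))) = N.
    rewrite /N -(sqint_comp (sys_act_measurable h) _ mf) // => A.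
    exact: sys_act_preserving.
  rewrite NE -EFinM => -[] /esym/eqP.
  rewrite -[X in _ == X]mul1r (inj_eq (mulIf (lt0r_neq0 r0))) => /eqP h1.
  by apply/eqP; rewrite -sqrp_eq1 // h1.
- have := rig f fL2.
  have uE n : L2norm mu (fun x => f (T (a n) x) - f x)%R =
      (normc (chi (a n) - 1)%R * Num.sqrt r)%:E.
    have m_diff : measurable_fun [set: X] (fun x => normc (f (T (a n) x) - f x)%R : R).
      apply: measurable_normc.
        rewrite (_ : (fun x => _) = (fun x => complex.Re (f (T (a n) x)) - complex.Re (f x))%R).
          apply: measurable_funB => //.
          exact: (measurableT_comp mRe (sys_act_measurable (a n))).
        by apply/funext => x; case: (f x) (f (T _ x)) => [u v] [w z].
      rewrite (_ : (fun x => _) = (fun x => complex.Im (f (T (a n) x)) - complex.Im (f x))%R).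
        apply: measurable_funB => //.
        exact: (measurableT_comp mIm (sys_act_measurable (a n))).
      by apply/funext => x; case: (f x) (f (T _ x)) => [u v] [w z].
    rewrite L2norm_sqint (_ : sqint _ _ = (normc (chi (a n) - 1)%R ^+ 2 * r)%:E).
      by rewrite /= sqrtrM ?sqr_ge0 // sqrtr_sqr ger0_norm.
    rewrite EFinM -NE -sqintZ //; apply: ae_eq_sqint => //; first exact: measurable_funM.
    apply: filterS (chiE (a n)) => x ->.
    by rewrite -ComplexField.Normc.normcM mulrBl mul1r.
  under eq_fun do rewrite uE.
  have sr0 : (0 < Num.sqrt r)%R by rewrite sqrtr_gt0.
  move=> /fine_cvgP [_ /cvgrPdist_lt /(_ _ (mulr_gt0 e0 sr0)) [M _ HM]].
  exists M => n /HM /=; rewrite sub0r normrN ger0_norm ?mulr_ge0 ?sqrtr_ge0 //.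
  by rewrite ltr_pM2r // => /ltW.
Qed.

End Eigenfunctions.

(** * Ergodic systems with discrete spectrum *)

Section HalfSet.
Variables (R : realType) (d : measure_display) (X : measurableType d).
Variable mu : probability X R.
Local Open Scope ereal_scope.

(** Each half of the unit interval meets [I0] in measure at most [1 / 2], and the two measures add
    up to 1. *)
Lemma nonatomic_half : nonatomic_lebesgue_space mu ->
  exists A, measurable A /\ mu A = (2^-1)%:E.
Proof.
move=> [_ [X0 [I0 [phi [[mX0 X01] [I01 mI0 cI0] bij meas]]]]].
pose c := @completed_lebesgue_measure R.
pose J1 : set R := [set` `[0%R, 2^-1%R] ]; pose J2 : set R := [set` `]2^-1%R, 1%R] ].
have half01 : (0 <= 2^-1 :> R)%R /\ (2^-1 <= 1 :> R)%R by split; lra.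
have mJ (J : interval R) : lebesgue_measurable ([set` J] : set R).
  by apply: sub_caratheodory; exact: measurable_itv.
have mIJ (J : interval R) : lebesgue_measurable (I0 `&` [set` J]).
  exact: (measurableI _ _ mI0 (mJ J)).
have c_le (J : interval R) : c (I0 `&` [set` J]) <= lebesgue_measure ([set` J] : set R).
  change (c (I0 `&` [set` J]) <= c [set` J]).
  by apply: le_measure; rewrite ?inE; [exact: mIJ|exact: mJ|exact: subIsetr].
have c1 : c (I0 `&` J1) <= (2^-1)%:E.
  apply: (le_trans (c_le _)); rewrite lebesgue_measure_itv /= lte_fin.
  by rewrite invr_gt0 ltr0n sube0.
have c2 : c (I0 `&` J2) <= (2^-1)%:E.
  apply: (le_trans (c_le _)); rewrite lebesgue_measure_itv /= lte_fin.
  by rewrite ifT -?EFinB ?lee_fin; lra.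
have c12 : c (I0 `&` J1) + c (I0 `&` J2) = 1.
  rewrite -cI0; transitivity (c ((I0 `&` J1) `|` (I0 `&` J2))).
    apply/esym; apply: (@measureU _ _ _ (@completed_lebesgue_measure R)).
    - exact: mIJ.
    - exact: mIJ.
    - apply/seteqP; split => // x [[_ +] [_ +]].
      rewrite /J1 /J2 /= !in_itv /= => /andP [_ x1] /andP [x2 _].
      by move: (lt_le_trans x2 x1); rewrite ltxx.
  congr (c _); rewrite -setIUr; apply/seteqP; split => x; first by case.
  move=> Ix; split => //; have := I01 _ Ix; rewrite /J1 /J2 /= !in_itv /= => /andP [x0 x1].
  by case: (leP x 2^-1%R) => x2; [left; rewrite x0|right].
exists (X0 `&` phi @^-1` (I0 `&` J1)).
have [m1 m2] := meas _ (@subIsetl _ I0 J1).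
split; first exact/m1/mIJ.
rewrite m2; last exact: mIJ.
change (c (I0 `&` J1) = (2^-1)%:E).
move: c1 c2 c12; case: (c (I0 `&` J1)) => [u||]; case: (c (I0 `&` J2)) => [v||] //.
rewrite -EFinD !lee_fin => u1 v1 -[uv]; congr EFin; lra.
Qed.

End HalfSet.

Section NoDiscreteSpectrum.
Variables (R : realType) (G : zmodType) (S : system R G).
Variables (enumG : nat -> G).
Hypothesis enumG_surj : forall g, exists n, enumG n = g.
Local Notation X := (sys_space S).
Local Notation T := (sys_act S).
Local Notation mu := (sys_mu S).
Hypothesis ergS : ergodic S.

(** Ergodicity speaks of exactly invariant sets. As the group is countable, the intersection of all
    translates of [B] is such a set and differs from [B] by a null set. *)
Lemma ergodic_ae_invariant (B : set X) : measurable B ->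
  (forall g, {ae mu, forall x, B (T g x) <-> B x}) -> mu B = 0%E \/ mu B = 1%E.
Proof.
move=> mB Binv; pose B' := \bigcap_n T (enumG n) @^-1` B.
have mB' : measurable B' by apply: bigcap_measurableType => n _; exact: measurable_act.
have B'P x : B' x <-> forall g, B (T g x).
  split; first by move=> H g; have [n <-] := enumG_surj g; exact: H.
  by move=> H n _; exact: H.
suff -> : mu B = mu B'.
  apply: ergS => // g; rewrite sys_act_imageE; apply/seteqP; split => x.
    move=> /B'P H; apply/B'P => h.
    by rewrite -[h](subrK (- g)) opprK sys_actD.
  by move=> /B'P H; apply/B'P => h; rewrite -sys_actD.
have B'B : B' `<=` B by move=> x /B'P /(_ 0); rewrite sys_act0.
have BB' : mu (B `\` B') = 0%E.
  apply: measure_negligible; first exact: measurableD.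
  have := ae_foralln (fun n => Binv (enumG n)); apply: negligibleS.
  by move=> x [Bx nB'] H; apply: nB' => n _ /=; apply/H.
rewrite -[in LHS](setDUK B'B); transitivity (mu B' + mu (B `\` B'))%E.
  by rewrite -measureU ?setDIK //; exact: measurableD.
by rewrite BB' adde0.
Qed.

(** A combination [s] of eigenfunctions within [1 / 4] of the indicator of a set [A] of measure
    [1 / 2] is almost everywhere invariant, so [B], where the real part of [s] exceeds [1 / 2], has
    measure 0 or 1. The symmetric difference of [A] and [B] then has measure at least [1 / 2], but
    also less than [4 * (1 / 4)^2]. *)
Lemma no_discrete_spectrum (a : nat -> G) :
  (forall chi : G -> R[i], (forall g h, chi (g + h) = chi g * chi h) ->
     (forall g, normc (chi g) = 1) ->
     (forall e : R, 0 < e -> exists N, forall n, (N <= n)%N ->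
        normc (chi (a n) - 1) <= e) ->
     forall g, chi g = 1) ->
  discrete_spectrum S -> ~ rigidity_sequence S a.
Proof.
move=> achar discS rig.
have [A [mA A2]] := nonatomic_half (sys_lebesgue S).
have normc_ge0 (z : R[i]) : 0 <= normc z by case: z => x y; exact: sqrtr_ge0.
pose f : X -> R[i] := fun x => (\1_A x)%:C%C.
have mf : measurable_fun [set: X] (fun x => \1_A x : R) by exact: measurable_indic.
have mf0 : measurable_fun [set: X] (fun x => complex.Im (f x)) by exact: measurable_cst.
have fL2 : inL2 mu f.
  split => //.
  rewrite L2norm_sqint.
  have : (sqint mu (fun x => normc (f x)) <= sqint mu (fun x => (\1_setT x : R)))%E.
    apply: le_sqint; [exact: measurable_normc|exact: measurable_indic|].
    move=> x; rewrite /f /= expr0n addr0 sqr_sqrtr ?sqr_ge0 // !indicE in_setT.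
    by case: (_ \in _); rewrite ?expr1n ?expr0n ?ler01.
  rewrite (_ : sqint mu (fun x => \1_setT x) = 1%:E); last first.
    rewrite /sqint; under eq_integral do rewrite indicE in_setT expr1n.
    by rewrite integral_cst // mul1e; exact: probability_setT.
  by case: (sqint _ _) => [r||] //=; rewrite ?ltry.
have [n [c [h [h_eig h_lt]]]] := discS f fL2 4^-1 ltac:(by rewrite invr_gt0 ltr0n).
pose s x := \sum_(i < n) c i * h i x.
have sRe x : complex.Re (s x) = \sum_(i < n)
    (complex.Re (c i) * complex.Re (h i x) - complex.Im (c i) * complex.Im (h i x)).
  rewrite (raddf_sum (@complex.Re R)); apply: eq_bigr => i _.
  by case: (c i) (h i x) => [u v] [w z].
have sIm x : complex.Im (s x) = \sum_(i < n)
    (complex.Re (c i) * complex.Im (h i x) + complex.Im (c i) * complex.Re (h i x)).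
  rewrite (raddf_sum (@complex.Im R)); apply: eq_bigr => i _.
  by case: (c i) (h i x) => [u v] [w z].
have mhRe i : measurable_fun [set: X] (fun x => complex.Re (h i x)) by have [[]] := h_eig i.
have mhIm i : measurable_fun [set: X] (fun x => complex.Im (h i x)) by have [[]] := h_eig i.
have msRe : measurable_fun [set: X] (fun x => complex.Re (s x)).
  rewrite (_ : (fun x => _) = (fun x => \sum_(i < n) (complex.Re (c i) * complex.Re (h i x)
      - complex.Im (c i) * complex.Im (h i x)))); last by apply/funext.
  by apply: measurable_sum => i; apply: measurable_funB; exact: measurable_funM.
have msIm : measurable_fun [set: X] (fun x => complex.Im (s x)).
  rewrite (_ : (fun x => _) = (fun x => \sum_(i < n) (complex.Re (c i) * complex.Im (h i x)
      + complex.Im (c i) * complex.Re (h i x)))); last by apply/funext.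
  by apply: measurable_sum => i; apply: measurable_funD; exact: measurable_funM.
have s_inv g : {ae mu, forall x, s (T g x) = s x}.
  have : {ae mu, forall x, forall i, h i (T g x) = h i x}.
    by apply: filter_forall => i; exact: (eigenfunction_invariant achar rig (h_eig i) g).
  by apply: filterS => x H; apply: eq_bigr => i _; rewrite H.
pose B := [set x | 2^-1 < complex.Re (s x)].
have mB : measurable B.
  have := msRe measurableT _ (measurable_itv `]2^-1, +oo[).
  rewrite setTI (_ : _ @^-1` _ = B) //; apply/seteqP; split => x; rewrite /B /= in_itv /= ?andbT //.
have B01 : mu B = 0%E \/ mu B = 1%E.
  apply: ergodic_ae_invariant => // g.
  by move: (s_inv g); apply: filterS => x; rewrite /B /= => ->.
pose w x : R := normc (f x - s x).
have mw : measurable_fun [set: X] w.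
  apply: measurable_normc.
    rewrite (_ : (fun x => _) = (fun x => \1_A x - complex.Re (s x))).
      exact: measurable_funB.
    by apply/funext => x; rewrite /f; case: (s x).
  rewrite (_ : (fun x => _) = (fun x => complex.Im (f x) - complex.Im (s x))).
    exact: measurable_funB.
  by apply/funext => x; rewrite /f; case: (s x).
have w_lt : (sqint mu w < (16^-1)%:E)%E.
  have := h_lt; rewrite L2norm_sqint -/w.
  have := sqint_ge0 mu w; case: (sqint mu w) => [r||] //=; rewrite !lte_fin lee_fin => r0 r4.
  rewrite -(sqr_sqrtr r0) (_ : 16^-1 = 4^-1 ^+ 2); last by lra.
  by rewrite ltrXn2r ?nnegrE ?sqrtr_ge0 //; lra.
(* The threshold [1 / 2] is halfway between the values of an indicator: where the two indicators
   differ, [w] is at least [1 / 2]. Squaring gives the factor 4. *)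
have AB : (sqint mu (fun x => \1_A x - \1_B x)%R <= 4%:E * sqint mu w)%E.
  rewrite (_ : 4 = 2 ^+ 2); last by lra.
  rewrite -sqintZ //; apply: le_sqint.
  - by apply: measurable_funB => //; exact: measurable_indic.
  - exact: measurable_funM.
  move=> x; rewrite exprMn.
  have -> : w x ^+ 2 = (\1_A x - complex.Re (s x)) ^+ 2 + complex.Im (s x) ^+ 2.
    rewrite /w /f; case: (s x) => u v /=.
    by rewrite sqr_sqrtr ?addr_ge0 ?sqr_ge0 // sub0r sqrrN.
  have Im0 := sqr_ge0 (complex.Im (s x)).
  rewrite !indicE; have [xB|xB] := boolP (x \in B).
    have : 2^-1 < complex.Re (s x) by move: xB; rewrite inE.
    case: (x \in A) => Bx; first by rewrite subrr expr0n mulr_ge0 ?addr_ge0 ?sqr_ge0.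
    by rewrite /= ?mulr0n ?mulr1n; nra.
  have : complex.Re (s x) <= 2^-1.
    by rewrite leNgt; apply: contra xB => Bx; rewrite inE.
  case: (x \in A) => Bx; last by rewrite subrr expr0n mulr_ge0 ?addr_ge0 ?sqr_ge0.
  by rewrite /= ?mulr0n ?mulr1n; nra.
have AB2 : ((2^-1)%:E <= sqint mu (fun x => \1_A x - \1_B x)%R)%E.
  rewrite sqint_indic_diff //.
  have mAB := measurableD mA mB; have mBA := measurableD mB mA.
  have := A2; rewrite prE // => -[A2']; rewrite prE ?lee_fin; last exact: measurableU.
  rewrite prU //; last by apply/seteqP; split => // x [[_ nB] [Bx _]].
  have : pr B = 0 \/ pr B = 1.
    by move: B01; rewrite !prE // => -[[->]|[->]]; [left|right].
  have := pr_dist mA mB measurableT; rewrite !setIT /prd A2'.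
  by move=> H [E|E]; move: H; rewrite E ler_norml; lra.
have := le_trans AB2 AB; have := sqint_ge0 mu w; move: w_lt.
case: (sqint mu w) => [r||] //; rewrite -EFinM !lee_fin lte_fin => r1 r2 r3.
by have : (2^-1 : R) < 2^-1; [lra|rewrite ltxx].
Qed.

End NoDiscreteSpectrum.

(** * Characters along doubling blocks *)

Section BlockSequence.
Variables (T : eqType) (x0 : T) (B : nat -> seq T).
Hypothesis B_neq0 : forall k, B k != [::].

(** Concatenation of the blocks. That late terms lie in late blocks serves rigidity; that elements
    of late blocks are late terms serves the characters. *)
Lemma block_sequence : exists a : nat -> T,
  (forall K, exists N, forall n, (N <= n)%N -> exists2 k, (K <= k)%N & a n \in B k) /\
  (forall k x, x \in B k -> exists2 n, (k <= n)%N & a n = x).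
Proof.
pose F m := flatten [seq B k | k <- iota 0 m].
have F_split m m' : (m <= m')%N -> F m' = F m ++ flatten [seq B k | k <- iota m (m' - m)].
  by move=> mm'; rewrite /F -{1}(subnKC mm') iotaD map_cat flatten_cat add0n.
have F_size m : (m <= size (F m))%N.
  elim: m => // m IH; rewrite (F_split m m.+1) // subSnn size_cat /= cats0.
  rewrite -addn1 leq_add //; by case: (B m) (B_neq0 m).
exists (fun n => nth x0 (F n.+1) n); split.
  move=> K; exists (size (F K)) => n FKn.
  have Kn : (K <= n)%N := leq_trans (F_size K) FKn.
  have : nth x0 (F n.+1) n \in flatten [seq B k | k <- iota K (n.+1 - K)].
    have := F_size n.+1; rewrite (F_split K n.+1) ?leqW // size_cat => nF.
    rewrite nth_cat ltnNge FKn /= mem_nth // ltn_subLR //.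
  move=> /flattenP [_ /mapP [k + ->] xk]; rewrite mem_iota => /andP [Kk _].
  by exists k.
move=> k x xk; pose n := (size (F k) + index x (B k))%N.
have kn : (k <= n)%N by apply: leq_trans (F_size k) (leq_addr _ _).
exists n => //; rewrite (F_split k.+1 n.+1) // (F_split k k.+1) // subSnn /= cats0.
rewrite -catA nth_cat ltnNge leq_addr /= addKn nth_cat index_mem xk.
exact: nth_index.
Qed.

End BlockSequence.

Section Characters.
Variables (R : realType) (G : zmodType) (chi : G -> R[i]).
Hypothesis chiD : forall g h, chi (g + h) = chi g * chi h.
Hypothesis chi1 : forall g, normc (chi g) = 1.

Let normc_triangle (z w : R[i]) : normc (z + w) <= normc z + normc w.
Proof. exact: (le_normcD (z : Rcomplex R) w). Qed.

Let normcB (z w : R[i]) : normc (z - w) = normc (w - z).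
Proof. by rewrite -(normcN (z - w : Rcomplex R)) opprB. Qed.

Lemma char0 : chi 0 = 1.
Proof.
have : chi 0 * chi 0 = 1 * chi 0 by rewrite -chiD addr0 mul1r.
apply: mulIf; apply/eqP => c0; have := chi1 0.
by rewrite c0 ComplexField.Normc.normc0 => /eqP; rewrite eq_sym oner_eq0.
Qed.

(** In [z^2 - 1 = (z - 1)(z + 1)] the second factor has modulus at least [2 - 1 / 2]. *)
Lemma char_double g : normc (chi g - 1) <= 2^-1 ->
  normc (chi g - 1) <= 2 / 3 * normc (chi (g *+ 2) - 1).
Proof.
move=> g12.
have -> : chi (g *+ 2) - 1 = (chi g - 1) * (chi g + 1).
  by rewrite mulr2n chiD; ring.
rewrite ComplexField.Normc.normcM.
have : 2 <= normc (chi g + 1) + normc (chi g - 1).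
  have -> : 2 = normc (1 + 1 : R[i]) :> R.
    by rewrite /= addr0 expr0n addr0 sqrtr_sqr ger0_norm //; lra.
  rewrite (_ : 1 + 1 = (chi g + 1) + (1 - chi g)); last by ring.
  by rewrite (normcB (chi g) 1) normc_triangle.
have : 0 <= normc (chi g - 1) by case: (chi g - 1) => x y; exact: sqrtr_ge0.
by nra.
Qed.

Lemma char_root g t : (forall j, (j <= t)%N -> normc (chi (g *+ 2 ^ j) - 1) <= 2^-1) ->
  normc (chi g - 1) <= (2 / 3) ^+ t.
Proof.
elim: t g => [|t IH] g H.
  by have := H 0%N isT; rewrite mulr1n expr0; lra.
have := char_double (H 0%N isT); rewrite expn0 mulr1n => /le_trans; apply.
rewrite exprS ler_pM2l ?divr_gt0 //; apply: IH => j jt.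
by rewrite -mulrnA -expnS; apply: H.
Qed.

Lemma char_sum m (b : 'I_m -> G) : normc (chi (\sum_i b i) - 1) <= \sum_i normc (chi (b i) - 1).
Proof.
elim: m b => [|m IH] b.
  by rewrite !big_ord0 char0 subrr ComplexField.Normc.normc0.
rewrite !big_ord_recr /= chiD.
set x := \sum_(i < m) b _.
rewrite (_ : _ - 1 = chi x * (chi (b ord_max) - 1) + (chi x - 1)); last by ring.
apply: le_trans (normc_triangle _ _) _.
by rewrite ComplexField.Normc.normcM chi1 mul1r [X in _ <= X]addrC lerD2l IH.
Qed.

End Characters.

Section BlockCharacters.
Variables (R : realType) (G : zmodType) (b : forall k : nat, 'I_k.+2 -> G).
Arguments b : clear implicits.

(* Deep enough to have [k.+2 * (2 / 3) ^ block_depth k <= 1 / k.+2]. *)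
Definition block_depth k := (2 * k.+2 ^ 2)%N.
Definition block k := [seq b k i *+ 2 ^ j | i <- enum 'I_k.+2, j <- iota 0 (block_depth k).+1].

Variable h : nat -> G.
Hypothesis b_sum : forall k, \sum_i b k i = h k.
Hypothesis h_recurrent : forall g K, exists2 k, (K <= k)%N & h k = g.

Lemma recurrent_block_character (chi : G -> R[i]) :
  (forall g g', chi (g + g') = chi g * chi g') -> (forall g, normc (chi g) = 1) ->
  (exists K, forall k x, (K <= k)%N -> x \in block k -> normc (chi x - 1) <= 2^-1) ->
  forall g, chi g = 1.
Proof.
move=> chiD chi1 [K HK] g.
have bound k : (K <= k)%N -> normc (chi (h k) - 1) <= k.+2%:R^-1.
  move=> Kk; rewrite -b_sum; apply: (le_trans (char_sum chiD chi1 _)).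
  apply: (@le_trans _ _ (\sum_(i < k.+2) (2 / 3) ^+ block_depth k)).
    apply: ler_sum => i _; apply: char_root => // j jt.
    by apply: (HK k) => //; apply: allpairs_f; rewrite ?mem_enum // mem_iota.
  rewrite sumr_const card_ord -[_ *+ _]mulr_natl.
  (* Bernoulli's inequality; at [n = block_depth k] its left side is [1 + y^2] with [y = k + 2]. *)
  have bern (n : nat) : 1 + n%:R / 2 <= (3 / 2 : R) ^+ n.
    elim: n => [|n IH]; first by rewrite mul0r addr0 expr0.
    by rewrite exprS -natr1; have := ler0n R n; nra.
  have -> : (2 / 3 : R) = (3 / 2)^-1 by rewrite invf_div.
  rewrite exprVn ler_pdivrMr ?exprn_gt0 ?divr_gt0 // mulrC ler_pdivlMr ?ltr0n //.
  apply: le_trans (bern _); rewrite /block_depth natrM natrX.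
  by set y := k.+2%:R; nra.
apply/subr0_eq/ComplexField.Normc.eq0_normc/eqP; rewrite eq_le; apply/andP; split; last first.
  by case: (chi g - 1) => x y; exact: sqrtr_ge0.
apply/ler_addgt0Pl => e e0; rewrite addr0.
have [M HM] : exists M : nat, e^-1 < M%:R by exists (Num.truncn e^-1).+1; exact: truncnS_gt.
have [k kM <-] := h_recurrent g (maxn K M); move: kM; rewrite geq_max => /andP [/bound Kk Mk].
apply: (le_trans Kk); rewrite invf_ple ?posrE ?ltr0n //.
apply: (le_trans (ltW HM)); rewrite ler_nat; lia.
Qed.

End BlockCharacters.

(** * Quotients with generic elements *)

Section Multiples.
Variables (G : zmodType) (p : nat).

Definition multiples : pred G := fun x => `[< exists g, x = g *+ p >].

Lemma multiplesP x : reflect (exists g, x = g *+ p) (x \in multiples).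
Proof. exact: asboolP. Qed.

Fact multiples_zmod_closed : zmod_closed multiples.
Proof.
split; first by apply/multiplesP; exists 0; rewrite mul0rn.
move=> x y /multiplesP [g ->] /multiplesP [g' ->].
by apply/multiplesP; exists (g - g'); rewrite mulrnBl.
Qed.

HB.instance Definition _ := GRing.isZmodClosed.Build G multiples multiples_zmod_closed.

End Multiples.

Section Dichotomy.
Local Open Scope quotient_scope.
Variable G : zmodType.
Hypothesis Ginfinite : infinite_set [set: G].

Lemma infinite_notin (T : choiceType) (A : set T) (s : seq T) : infinite_set A ->
  exists2 x, A x & x \notin s.
Proof.
move=> Ainf; apply: contrapT => H; apply: Ainf.
apply: (@sub_finite_set _ _ [set` s]); last exact: finite_seq.
by move=> x Ax /=; apply: contrapT => /negP xs; apply: H; exists x.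
Qed.

Let ints n : seq int := [seq Posz m | m <- iota 0 n.+1] ++ [seq - Posz m | m <- iota 0 n.+1].

Let mem_ints n (z : int) : (`|z| <= n)%N -> z \in ints n.
Proof.
move=> zn; have mz : `|z|%N \in iota 0 n.+1 by rewrite mem_iota ltnS.
rewrite mem_cat; have [z0|z0] := leP 0 z; apply/orP; [left|right].
  by apply/mapP; exists `|z|%N; rewrite ?gez0_abs.
by apply/mapP; exists `|z|%N; rewrite ?ltz0_abs ?opprK.
Qed.

(** If [b *~ y] is in [E] with [0 < |y| <= N], then [N! b] is a multiple of it by a factor of size
    at most [N!]. So it is enough that [N! b] avoids finitely many elements. *)
Let generic_infinite_multiples :
  (forall n, (0 < n)%N -> infinite_set (range (fun g : G => g *+ n))) ->
  generic_exponent G 0.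
Proof.
move=> Ginf; split => // N E.
have [_ [b _ <-] bs] := infinite_notin [seq e *~ z | e <- enum_fset E, z <- ints N`!]
  (Ginf _ (fact_gt0 N)).
exists b => y yN byE; rewrite dvd0n; apply: contraT => y0; apply: contraNT bs => _.
have /dvdzP [z zE] : (y %| Posz N`!)%Z.
  by rewrite dvdzE; apply: dvdn_fact; rewrite lt0n y0.
rewrite pmulrn zE mulrC mulrzA; apply: allpairs_f => //; apply: mem_ints.
have := congr1 absz zE; rewrite abszM /= => ->.
by rewrite leq_pmulr // lt0n.
Qed.

(** A coefficient prime to [p] is invertible modulo [p], so [b *~ y] in [E] would make [b] one of
    the finitely many multiples of elements of [E]. *)
Let generic_quotient (Q : zmodType) p : prime p -> infinite_set [set: Q] ->
  (forall q : Q, q *+ p = 0) -> generic_exponent Q p.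
Proof.
move=> p_pr Qinf Qp; split => //; first by apply: contraTneq p_pr => ->.
move=> N E; have [b _ bs] := infinite_notin [seq e *~ z | e <- enum_fset E, z <- ints p] Qinf.
exists b => y _ byE; apply: contraNT bs => py.
have p0 := prime_gt0 p_pr.
have mod_p (x : Q) m : x *+ m = x *+ (m %% p).
  by rewrite {1}(divn_eq m p) mulrnDr mulnC mulrnA Qp mul0rn add0r.
have cop : coprime `|y| p by rewrite coprime_sym prime_coprime.
pose u := (egcdn `|y| p).1.
have bu : b *+ (`|y| * u) = b.
  rewrite mod_p /u; case: (egcdnP p (_ : 0 < `|y|)%N).
    by rewrite lt0n; apply: contraNneq py => ->.
  move=> km kn e _; rewrite /= mulnC e (eqP cop) modnMDl modn_small ?prime_gt1 //.
have bE : b = (b *~ y) *~ (sgz y * (u %% p)%N).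
  rewrite -mulrzA mulrA (mulrC y) -abszEsg -PoszM -pmulrn -[LHS]bu mod_p.
  by rewrite modnMmr -mod_p.
rewrite bE; apply: allpairs_f => //; apply: mem_ints.
rewrite abszM (_ : `|sgz y|%N = (y != 0)).
  by case: (y != 0); rewrite ?mul1n ?mul0n // ltnW // ltn_mod.
by rewrite /sgz; case: ltgtP.
Qed.

(* If some multiple [n G] is finite, let [n] be minimal and [p] a prime divisor:
   [G / p G] is infinite because [(n / p) G] is, while [p (n / p) G] is finite. *)
Lemma exists_generic_quotient : exists (Q : zmodType) (f : {additive G -> Q}) (kappa : nat),
  [/\ forall q, exists g, f g = q, generic_exponent Q kappa & infinite_set [set: Q]].
Proof.
have [H|H] := pselect (forall n, (0 < n)%N -> infinite_set (range (fun g : G => g *+ n))).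
  exists G, idfun, 0%N; split => //; last exact: generic_infinite_multiples.
  by move=> q; exists q.
have : exists n, (0 < n)%N && `[< finite_set (range (fun g : G => g *+ n)) >].
  apply: contrapT => K; apply: H => n n0 fin; apply: K; exists n.
  by rewrite n0; apply/asboolP.
move=> exn; case: (ex_minnP exn) => n /andP [n0 /asboolP nfin] nmin.
have n1 : (1 < n)%N.
  rewrite ltn_neqAle n0 andbT; apply/eqP => n1; apply: Ginfinite.
  apply: sub_finite_set nfin => g _; exists g => //.
  by rewrite -n1.
pose p := pdiv n; have p_pr : prime p := pdiv_prime n1.
have [m nE] := dvdnP (pdiv_dvd n).
have m0 : (0 < m)%N by move: n0; rewrite nE muln_gt0 => /andP [].
have minf : infinite_set (range (fun g : G => g *+ m)).
  move=> mfin.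
  have /nmin : (0 < m)%N && `[< finite_set (range (fun g : G => g *+ m)) >].
    by rewrite m0; apply/asboolP.
  by rewrite leqNgt {1}nE ltn_Pmulr //; exact: prime_gt1.
pose I : zmodClosed G := GRing.ZmodClosed.clone G (@multiples G p) _; pose Q := Quotient.quot I : zmodType.
have piE (x y : G) : x - y \in I -> \pi_Q x = \pi_Q y.
  by rewrite (Quotient.idealrBE I) => /eqP.
have Eppi (x y : G) : \pi_Q x = \pi_Q y -> x - y \in I.
  by rewrite (Quotient.idealrBE I) => /eqP.
exists Q, \pi_Q, p.
(* Writing [g = r + p g'] with [r] the representative of its class gives [m g = m r + n g']; with
   [Q] and [n G] finite, [m G] would be finite. *)
have Qinf : infinite_set [set: Q].
  move=> Qfin; apply: minf.
  apply: sub_finite_set (finite_image2 (fun (q : Q) (x : G) => repr q *+ m + x) Qfin nfin).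
  move=> _ [g _ <-].
  have /Eppi/multiplesP [g' g'E] : \pi_Q g = \pi_Q (repr (\pi_Q g)) by rewrite reprK.
  exists (\pi_Q g) => //; exists (g' *+ n); first by exists g'.
  by rewrite [in g' *+ n]nE mulnC mulrnA -g'E mulrnBl addrC subrK.
split => //; first by move=> q; exists (repr q); exact: reprK.
apply: generic_quotient => // q.
rewrite -[q]reprK -raddfMn -(raddf0 \pi_Q); apply: piE.
by rewrite subr0; apply/multiplesP; exists (repr q).
Qed.

End Dichotomy.

(** * Void probabilities of the intensity *)

Lemma sum_undup_le (R : realDomainType) (T : eqType) (s : seq T) (h : T -> R) :
  (forall x, 0 <= h x) -> \sum_(x <- undup s) h x <= \sum_(x <- s) h x.
Proof.
move=> h0; elim: s => //= x s IH; rewrite big_cons; case: ifP => _.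
  by apply: le_trans IH _; rewrite lerDr.
by rewrite big_cons lerD2l.
Qed.

Lemma sum_fset_seq_le (R : realDomainType) (T : choiceType) (s : seq T) (h : T -> R) :
  (forall x, 0 <= h x) -> \sum_(x <- [fset x in s]%fset) h x <= \sum_(x <- s) h x.
Proof.
move=> h0; apply: le_trans (sum_undup_le s h0).
rewrite le_eqVlt; apply/orP; left; apply/eqP/perm_big/uniq_perm.
- exact: fset_uniq.
- exact: undup_uniq.
- by move=> x; rewrite mem_undup inE.
Qed.

Section VoidProbability.
Variables (R : realType) (G Q : zmodType) (f : {additive G -> Q}).
Hypothesis fsurj : forall q, exists g, f g = q.
Variable D : nat -> {fset Q}.
Hypothesis D_neq0 : forall k, D k != fset0.
Hypothesis D_stable : forall F : {fset Q}, exists K, forall k, (K <= k)%N ->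
  (#|` sumset F (D k)| * #|` D K| = #|` sumset F (D K)| * #|` D k|)%N.
Hypothesis D_sparse : forall J : {fset Q}, exists g K, forall k j, (K <= k)%N ->
  j \in J -> #|` sumset [fset g; j]%fset (D k)| = (2 * #|` D k|)%N.
Local Notation m := (intensity R D_stable).
Implicit Types (F : seq Q) (x y q : Q).

Definition void_prob F : R := expR (- m [fset x in F]%fset).
Local Notation v := void_prob.

Lemma void_prob_ext F F' : F =i F' -> v F = v F'.
Proof.
by move=> FF'; congr (expR (- m _)); apply/fsetP => x; rewrite !inE FF'.
Qed.

Let fset_shift q F : [fset x in [seq (x + q)%R | x <- F]]%fset =
  sumset [fset q]%fset [fset x in F]%fset.
Proof.
apply/fsetP => z; rewrite inE; apply/mapP/sumsetP => [[x xF ->]|[x [y []]]].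
  by exists q, x; rewrite !inE xF eqxx addrC.
by rewrite !inE => /eqP -> yF ->; exists y; rewrite // addrC.
Qed.

Lemma void_prob_shift q F : v [seq x + q | x <- F] = v F.
Proof. by rewrite /v fset_shift intensity_translate. Qed.

Let fset_cat F F' : [fset x in F ++ F']%fset = ([fset x in F] `|` [fset x in F'])%fset.
Proof. by apply/fsetP => x; rewrite !inE ?mem_cat. Qed.

Lemma intensity_pair x y : 0 <= 2 - m [fset x; y]%fset <= 1.
Proof.
apply/andP; split.
  have /andP [+ _] := intensityU R D_neq0 D_stable [fset x]%fset [fset y]%fset.
  by rewrite !intensity1.
have : m [fset x]%fset <= m [fset x; y]%fset by apply: intensity_mono; rewrite // fsubsetUl.
by rewrite intensity1 //; lra.
Qed.

Lemma intensity_pair_diff x y : m [fset x; y]%fset = m [fset 0; (y - x)%R]%fset.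
Proof.
rewrite -[RHS](intensity_translate R D_neq0 D_stable x); congr m.
apply/fsetP => z; apply/idP/sumsetP => [|[u [w []]]].
  rewrite !inE => /orP [] /eqP ->; first by exists x, 0; split; rewrite ?inE ?eqxx ?addr0.
  by exists x, (y - x); split; rewrite ?inE ?eqxx ?orbT // addrC subrK.
by rewrite !inE => /eqP -> /orP [] /eqP -> ->; rewrite ?addr0 ?eqxx // addrC subrK eqxx orbT.
Qed.

(** The exponents [M] and [s + s'] satisfy [0 <= M <= s + s'], so the exponentials differ by at most
    [s + s' - M], the relative overlap. *)
Lemma void_prob_cat F F' :
  `|v (F ++ F') - v F * v F'| <= \sum_(x <- F) \sum_(y <- F') (2 - m [fset x; y]%fset).
Proof.
have /andP [d0 d1] := intensityU R D_neq0 D_stable [fset x in F]%fset [fset x in F']%fset.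
apply: (@le_trans _ _ (\sum_(x <- [fset x in F]%fset) \sum_(y <- [fset x in F']%fset)
   (2 - m [fset x; y]%fset))); last first.
  apply: le_trans (sum_fset_seq_le _ _) _.
    by move=> x; apply: sumr_ge0 => y _; have /andP [] := intensity_pair x y.
  apply: ler_sum => x _; apply: sum_fset_seq_le => y.
  by have /andP [] := intensity_pair x y.
apply: le_trans d1; rewrite /v fset_cat -expRD.
move: d0; set M := m (_ `|` _)%fset; set s := m _; set s' := m _.
have M0 : 0 <= M by exact: intensity_ge0.
move=> d0; have le1 : expR (- M) <= 1 by rewrite -expR0 ler_expR oppr_le0.
have -> : - s - s' = - M - (s + s' - M) by ring.
rewrite expRD; have := expR_ge1Dx (- (s + s' - M)).
have : expR (- (s + s' - M)) <= 1 by rewrite -expR0 ler_expR oppr_le0.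
have := expR_gt0 (- M); set a := expR (- M) in le1 *; set b := expR _ => a0 b1 b2.
rewrite ger0_norm; first by nra.
by nra.
Qed.

(** Shifting [g] by a lift of [- x] turns [q - f g] into [q - f g + x]; over a spread set these
    overlaps sum to at most 1, and spread sets can be arbitrarily large. *)
Lemma avg_null_overlap (Phi : nat -> {fset G}) q : folner R Phi ->
  avg_null Phi (fun g => 2 - m [fset 0; (q - f g)%R]%fset).
Proof.
move=> folPhi; apply: avg_null_translates => // [g|k]; first exact: intensity_pair.
have [s sp sk] := spread_exists R D_neq0 D_stable D_sparse k.
pose lift x := sval (cid (fsurj x)).
exists [seq lift (- x) | x <- s]; first by rewrite size_map.
move=> g; rewrite big_map; apply: le_trans (spread_overlap D_neq0 (q - f g) sp).
rewrite le_eqVlt; apply/orP; left; apply/eqP/eq_bigr => x _.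
by rewrite raddfD /= /lift; case: cid => z /= ->; rewrite opprD opprK addrA.
Qed.

Lemma void_prob_mixing (Phi : nat -> {fset G}) F F' : folner R Phi ->
  avg_null Phi (fun g => `|v (F ++ [seq q - f g | q <- F']) - v F * v F'|).
Proof.
move=> folPhi; apply: (@avg_null_le _ _ _ folPhi _ (fun g =>
    \sum_(x <- F) \sum_(y <- F') (2 - m [fset 0; (y - x - f g)%R]%fset))).
  move=> g; rewrite -(void_prob_shift (- f g) F'); apply: le_trans (void_prob_cat _ _) _.
  rewrite le_eqVlt; apply/orP; left; apply/eqP/eq_bigr => x _; rewrite big_map.
  by apply: eq_bigr => y _; rewrite intensity_pair_diff (addrAC y).
apply: (avg_null_sum folPhi) => x; apply: (avg_null_sum folPhi) => y; exact: avg_null_overlap.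
Qed.

(** The translate of [F] is added point by point: next to [x], which is already present, [x + q]
    raises the intensity by at most that of the pair minus 1. *)
Lemma void_prob_recurrence F q :
  v F - v ([seq x + q | x <- F] ++ F) <= (size F)%:R * (m [fset 0; q]%fset - 1).
Proof.
have inc s : {subset s <= F} ->
    m [fset x in [seq (x + q)%R | x <- s] ++ F]%fset <=
    m [fset x in F]%fset + (size s)%:R * (m [fset 0; q]%fset - 1).
  elim: s => [_|y s IH sF]; first by rewrite mul0r addr0.
  rewrite /= fset_cons -natr1 mulrDl mul1r addrA.
  have yF : y \in [fset x in [seq (x + q)%R | x <- s] ++ F]%fset.
    by rewrite !inE sF ?orbT // mem_head.
  apply: le_trans (intensityU1 R D_neq0 D_stable _ yF) _.
  have -> : m [fset (y + q)%R; y]%fset = m [fset 0; q]%fset.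
    by rewrite fsetUC intensity_pair_diff addrAC subrr add0r.
  rewrite lerD2r; apply: IH.
  by move=> x xs; apply: sF; rewrite inE xs orbT.
apply: (@le_trans _ _ (m [fset x in [seq (x + q)%R | x <- F] ++ F]%fset - m [fset x in F]%fset)).
  rewrite /v; set s := m _; set M := m _.
  have sM : s <= M by apply: intensity_mono; rewrite // fset_cat fsubsetUr.
  have s0 : 0 <= s by exact: intensity_ge0.
  rewrite (_ : - M = - s - (M - s)) ?expRD; last by ring.
  have := expR_ge1Dx (- (M - s)).
  have : expR (- s) <= 1 by rewrite -expR0 ler_expR oppr_le0.
  by have := expR_gt0 (- s); nra.
by rewrite lerBlDl; exact: inc.
Qed.

Lemma void_prob_rigid (a : nat -> G) F :
  null_seq (fun n => m [fset 0; f (a n)]%fset - 1) ->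
  null_seq (fun n => v F - v ([seq q + f (a n) | q <- F] ++ F)).
Proof.
move=> an e e0; have F0 : 0 < (size F).+1%:R :> R by rewrite ltr0n.
have [N HN] := an _ (divr_gt0 e0 F0); exists N => n /HN Hn.
apply: le_lt_trans (void_prob_recurrence _ _) _.
rewrite ltr_pdivlMr // mulrC in Hn; apply: le_lt_trans Hn.
rewrite ler_wpM2r ?ler_nat // subr_ge0 -(intensity1 R D_neq0 D_stable 0).
by apply: intensity_mono; rewrite // fsubsetUl.
Qed.

Lemma void_prob_indep k : exists s : seq Q, [/\ uniq s, size s = k &
  forall O : seq Q, uniq O -> {subset O <= s} -> v O = expR (-1) ^+ size O].
Proof.
have [s sp sk] := spread_exists R D_neq0 D_stable D_sparse k.
exists s; split => //; first by case: sp.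
move=> O uO Os; rewrite /v (spread_intensity D_neq0 sp); last by move=> x; rewrite inE; exact: Os.
rewrite -expRM_natl mulrN1; congr (expR (- _%:R)).
by rewrite card_fseq undup_id.
Qed.

End VoidProbability.

(** * Enumerations of the group and construction of the rigidity sequence *)

Lemma infinite_countable_enum (T : Type) : countable [set: T] -> infinite_set [set: T] ->
  exists (e : nat -> T) (eI : T -> nat), cancel e eI /\ cancel eI e.
Proof.
move=> Tc Tinf; have /card_set_bijP [eI [_ inj surj]] := eq_card_nat Tc Tinf.
have eI_surj n : exists x, eI x = n by have [x _ <-] := surj n Logic.I; exists x.
pose e n := sval (cid (eI_surj n)).
have eP n : eI (e n) = n by rewrite /e; case: cid.
exists e, eI; split => // x; apply: inj; rewrite ?inE //.
Qed.

Section RecurrentEnumeration.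
Variables (G : zmodType) (eG : nat -> G) (eIG : G -> nat).
Hypothesis eIGK : cancel eIG eG.

(** The 2-adic valuation takes every value infinitely often. *)
Definition recurrent_enum k := eG (logn 2 k).

Lemma recurrent_enumP g K : exists2 k, (K <= k)%N & recurrent_enum k = g.
Proof.
exists (2 ^ eIG g * (K.*2).+1)%N.
  by rewrite -addnn; have : (0 < 2 ^ eIG g)%N; [rewrite expn_gt0|nia].
rewrite /recurrent_enum lognM ?expn_gt0 // pfactorK // lognE /= dvdn2 /= odd_double /=.
by rewrite addn0 eIGK.
Qed.

End RecurrentEnumeration.

Theorem corollary1p3 (R : realType) (G : zmodType)
    (Gcountable : countable [set: G]) (Ginfinite : infinite_set [set: G]) :
  exists a : nat -> G,
    (exists S : system R G, weakly_mixing S /\ rigidity_sequence S a) /\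
    (forall S : system R G,
       ergodic S -> discrete_spectrum S -> ~ rigidity_sequence S a).
Proof.
have [eG [eIG [eGK eIGK]]] := infinite_countable_enum Gcountable Ginfinite.
have [Q [f [kappa [fsurj genQ Qinf]]]] := exists_generic_quotient Ginfinite.
have Qcountable : countable [set: Q].
  apply/countable_injP; exists (fun q => eIG (sval (cid (fsurj q)))) => x y _ _ xy.
  have := congr1 eG xy; rewrite !eIGK.
  by case: cid => u /= <-; case: cid => w /= <- ->.
have [eQ [eIQ [eQK eIQK]]] := infinite_countable_enum Qcountable Qinf.
have eQ_surj q : exists i, eQ i = q by exists (eIQ q).
have [D [b [D_neq0 D_stable D_rigid b_sum D_sparse]]] :=
  rigid_blocks fsurj genQ (can_inj eQK) eQ_surj (recurrent_enum eG) block_depth.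
have block_neq0 k : block b k != [::].
  rewrite -size_eq0 size_allpairs size_iota -cardE card_ord.
  by rewrite muln_eq0.
have [a [a_block block_a]] := block_sequence 0 block_neq0.
exists a; split; last first.
  move=> S ergS discS; apply: (@no_discrete_spectrum R G S eG _ ergS a _ discS).
    by move=> g; exists (eIG g); rewrite eIGK.
  move=> chi chiD chi1 chi_a.
  apply: (recurrent_block_character b_sum (recurrent_enumP eIGK) chiD chi1).
  have [N HN] := chi_a 2^-1 ltac:(by rewrite invr_gt0 ltr0n).
  by exists N => k x Nk /block_a [n kn <-]; apply: HN; exact: leq_trans kn.
(* This amounts to [exp 1 >= 2]. At independent points no value of a bit is then likelier than
   [1 - exp (-1)], as the absence of atoms requires. *)
have e_half : expR (-1) <= 1 - expR (-1) :> R.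
  have : (2 : R) <= expR 1 by have := expR_ge1Dx (1 : R); lra.
  have : expR 1 * expR (-1) = 1 :> R by rewrite -expRD subrr expR0.
  by have := expR_gt0 (-1 : R); nra.
have v_nil : @void_prob R Q D D_stable [::] = 1.
  rewrite /void_prob (_ : [fset x in [::]]%fset = fset0).
    by rewrite intensity0 // oppr0 expR0.
  by apply/fsetP => x; rewrite !inE.
have [S [E [vE E_cat E_act genE]]] := void_system_exists f eQK eIQK
  (@void_prob_ext R Q D D_stable) v_nil (void_cylw_ge0 R D_neq0 D_stable)
  (void_prob_shift R D_neq0 D_stable) (expR_gt0 (-1)) e_half
  (void_prob_indep R D_neq0 D_stable D_sparse).
exists S; split.
  apply: (void_weakly_mixing vE E_cat E_act genE) => Phi folPhi F F'.
  exact: void_prob_mixing.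
apply: rigidity_sequence_of_sets; apply: (void_rigid_sets vE E_cat E_act genE).
  exact: void_prob_shift.
move=> F; apply: void_prob_rigid => //.
move=> eps eps0.
(* In block [k] the intensity of a pair exceeds 1 by at most [2 / (k + 2)], which is below [eps] as
   soon as [k >= K]. *)
have [K HK] : exists K : nat, 2 / eps < K%:R.
  by exists (Num.truncn (2 / eps)).+1; exact: truncnS_gt.
have [N HN] := a_block K; exists N => n /HN [k Kk /allpairsP [[i j] [_ jt ->]]].
have jt' : (j <= block_depth k)%N by move: jt; rewrite mem_iota ltnS.
have := intensity_le R D_neq0 D_stable (D_rigid k i j ^~ jt').
have k0 : 0 < k.+2%:R :> R by rewrite ltr0n.
move: HK; rewrite ltr_pdivrMr // => HK.
have : K%:R <= k.+2%:R :> R by rewrite ler_nat; lia.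
rewrite -[k.+4]addn2 natrD; set y := k.+2%:R in k0 *; set z := intensity _ _ _.
by move=> Ky zy; rewrite -(ltr_pM2r k0); nra.
Qed.
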